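(* Let $\rho_1,\rho_2\colon\mathrm{Isom}(\mathbf H^1_{\mathbb C})_o\to\mathrm{Isom}(\mathbf H^\infty_{\mathbb C})_o$ be irreducible representations with $\ell(\rho_1)=\ell(\rho_2)$. Then $\rho_1$ and $\rho_2$ are equivalent (i.e. conjugate by an isometry of $\mathbf H^\infty_{\mathbb C}$) if and only if $\mathrm{Arg}(\rho_1)=\mathrm{Arg}(\rho_2)$.
   Context: Complex hyperbolic spaces: $\mathcal H$ a separable complex Hilbert space with a strongly non-degenerate Hermitian form $B$ (linear in the first variable) of signature $(1,n)$; $\mathbf H^n_{\mathbb C}=\{[v]:B(v,v)>0\}$ with $\cosh d([v],[w])=|B(v,w)|/\sqrt{B(v,v)B(w,w)}$, boundary = isotropic lines, $\mathrm{Isom}(\mathbf H^n_{\mathbb C})_o=PU(B)$; complex hyperbolic subspaces are projectivizations of closed complex subspaces of signature $(1,m')$. For $\mathbf H^1_{\mathbb C}$: $\mathbb C^2$ with $B(z,w)=z_1\bar w_1-z_2\bar w_2$, $\xi_1=(e_1+e_2)/\sqrt2,\ \xi_2=(e_1-e_2)/\sqrt2$; $g(\lambda,b)\in SU(1,1)$ ($\lambda>0,b\in\mathbb R$) has matrix $\begin{pmatrix}\lambda&ib\\0&\lambda^{-1}\end{pmatrix}$ in the basis $(\xi_1,\xi_2)$; same symbol for the induced isometry. Representations are orbitally continuous homomorphisms; non-elementary = no fixed point in $\mathbf H^\infty_{\mathbb C}\cup\partial\mathbf H^\infty_{\mathbb C}$ and no invariant pair of boundary points; irreducible = non-elementary with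 no proper invariant complex hyperbolic subspace. For non-elementary $\rho$: $\rho(g(\lambda,b))$ ($\lambda>0,b\in\mathbb R$) have a unique common fixed point $\eta_1\in\partial\mathbf H^\infty_{\mathbb C}$, and $\eta_2$ is the other endpoint of the common axis of the hyperbolic isometries $\rho(g(\lambda,0))$, $\lambda\ne1$. With isotropic representatives $B(\eta_1,\eta_2)=1$ and $E=\eta_1^\perp\cap\eta_2^\perp$: the lift $T_b\in U(B)$ of $\rho(g(1,b))$ with $T_b\eta_1=\eta_1$ satisfies $T_b\eta_2=K(b)\eta_1+\eta_2+c(b)$, $K(b)\in\mathbb C$, $c(b)\in E$. $\ell(\rho)$ is the $t>0$ with $\inf_xd(\rho(g(\lambda,0))x,x)=t|\ln\lambda|$ for all $\lambda>0$; $\mathrm{Arg}(\rho)$ is the argument of $K(1)$ (independent of choices).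
   Formalization: ''Conjugate by an isometry'' is read as conjugation by a holomorphic isometry, i.e. an element of PU(B); antiholomorphic isometries are excluded, since conjugating by one replaces K(1) by its complex conjugate and so changes the sign of Arg, making the claim false. *)

(* Defs.v *)
(* MathComp + MathComp-Analysis (R : realType), complex numbers R[i]
   from mathcomp-real-closed.  Model of H^oo_C: the Hilbert space
   l^2(nat; C) with the Hermitian form
     B(v,w) = v_0 conj(w_0) - sum_{n>=1} v_n conj(w_n)
   (linear in the first variable, signature (1,oo)).  Isom(H^1_C)_o = PU(1,1)
   = SU(1,1)/{+-1}; representations are taken on SU(1,1) and required to
   kill -1.  Elements of PU(B) are represented by lifts in U(B), i.e. a
   representation is a map rho : SU(1,1) -> U(B) that is multiplicative up to
   unit scalars. *)
From mathcomp Require Import all_boot all_algebra.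
From mathcomp Require Import all_classical all_reals all_analysis.
From mathcomp.real_closed Require Import complex.

Set Implicit Arguments.
Unset Strict Implicit.
Unset Printing Implicit Defensive.

Import GRing.Theory Num.Theory numFieldNormedType.Exports.
Local Open Scope classical_set_scope.
Local Open Scope ring_scope.

Section HypDefs.
Variable R : realType.
Local Notation C := (R[i]).

Definition cRe (z : C) : R := complex.Re z.
Definition cIm (z : C) : R := complex.Im z.
Definition cabs (z : C) : R := Num.sqrt (cRe z ^+ 2 + cIm z ^+ 2).
Definition cconj (z : C) : C := conjc z.
Definition rC (x : R) : C := Complex x 0.
Definition iC : C := Complex 0 1.

Definition vec := nat -> C.
Definition vscale (a : C) (v : vec) : vec := fun n => a * v n.
Definition vadd (v w : vec) : vec := fun n => v n + w n.
Definition vsub (v w : vec) : vec := fun n => v n - w n.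
Definition vzero : vec := fun _ => 0.

Definition is_l2 (v : vec) : Prop :=
  cvgn (series (fun n => cabs (v n) ^+ 2)).

Definition l2norm (v : vec) : R :=
  Num.sqrt (limn (series (fun n => cabs (v n) ^+ 2))).

Definition Bform (v w : vec) : C :=
  v 0%N * cconj (w 0%N)
  - (rC (limn (series (fun n => cRe (v n.+1 * cconj (w n.+1)))))
     + iC * rC (limn (series (fun n => cIm (v n.+1 * cconj (w n.+1)))))).

(* points of H^oo_C (representatives), boundary points (representatives) *)
Definition posvec (v : vec) : Prop := is_l2 v /\ 0 < cRe (Bform v v).
Definition isotropic (v : vec) : Prop :=
  is_l2 v /\ v <> vzero /\ Bform v v = 0.

Definition coshd (v w : vec) : R :=
  cabs (Bform v w) / Num.sqrt (cRe (Bform v v) * cRe (Bform w w)).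
Definition hdist (v w : vec) : R :=
  let q := coshd v w in ln (q + Num.sqrt (q ^+ 2 - 1)).

Definition same_line (w v : vec) : Prop := exists a : C, a != 0 /\ w = vscale a v.

Definition unitaryB (T : vec -> vec) : Prop :=
  (forall v, is_l2 v -> is_l2 (T v)) /\
  (forall (a : C) v w, is_l2 v -> is_l2 w ->
      T (vadd (vscale a v) w) = vadd (vscale a (T v)) (T w)) /\
  (forall w, is_l2 w -> exists v, is_l2 v /\ T v = w) /\
  (forall v w, is_l2 v -> is_l2 w -> Bform (T v) (T w) = Bform v w).

Definition J2 : 'M[C]_2 :=
  \matrix_(i < 2, j < 2) (if i == j then (if val i == 0%N then 1 else -1) else 0).
Definition isSU11 (M : 'M[C]_2) : Prop :=
  (map_mx cconj M)^T *m J2 *m M = J2 /\ \det M = 1.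

(* g(lambda,b): matrix [[lambda, i b],[0, lambda^-1]] in the basis
   xi1 = (e1+e2)/sqrt2, xi2 = (e1-e2)/sqrt2, written in the standard basis *)
Definition gmat (lam b : R) : 'M[C]_2 :=
  \matrix_(i < 2, j < 2)
    (if val i == 0%N then
       (if val j == 0%N then (rC (lam + lam^-1) + iC * rC b) / 2
        else (rC (lam - lam^-1) - iC * rC b) / 2)
     else
       (if val j == 0%N then (rC (lam - lam^-1) + iC * rC b) / 2
        else (rC (lam + lam^-1) - iC * rC b) / 2)).

Definition mxdist (M N : 'M[C]_2) : R :=
  \sum_(i < 2) \sum_(j < 2) cabs (M i j - N i j).

(* representations Isom(H^1_C)_o = SU(1,1)/{+-1} -> PU(B), given by lifts *)
Definition is_rep (rho : 'M[C]_2 -> vec -> vec) : Prop :=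
  (forall g, isSU11 g -> unitaryB (rho g)) /\
  (forall g h, isSU11 g -> isSU11 h -> exists c : C, cabs c = 1 /\
      forall v, is_l2 v -> rho (g * h) v = vscale c (rho g (rho h v))) /\
  (exists c : C, cabs c = 1 /\ forall v, is_l2 v -> rho (-1) v = vscale c v) /\
  (forall x, posvec x -> forall g, isSU11 g -> forall eps : R, 0 < eps ->
     exists2 delta : R, 0 < delta & forall h, isSU11 h -> mxdist h g < delta ->
       hdist (rho h x) (rho g x) < eps).

(* a common fixed point in H^oo_C \cup boundary *)
Definition has_fixed_point (rho : 'M[C]_2 -> vec -> vec) : Prop :=
  exists v, is_l2 v /\ v <> vzero /\ 0 <= cRe (Bform v v) /\
    forall g, isSU11 g -> same_line (rho g v) v.

Definition has_invariant_pair (rho : 'M[C]_2 -> vec -> vec) : Prop :=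
  exists xi eta, isotropic xi /\ isotropic eta /\ ~ same_line xi eta /\
    forall g, isSU11 g ->
      (same_line (rho g xi) xi /\ same_line (rho g eta) eta) \/
      (same_line (rho g xi) eta /\ same_line (rho g eta) xi).

Definition non_elementary rho : Prop :=
  is_rep rho /\ ~ has_fixed_point rho /\ ~ has_invariant_pair rho.

(* closed complex subspaces of signature (1,m'), i.e. containing a positive
   vector; their projectivizations are the complex hyperbolic subspaces *)
Definition closed_subspace (W : vec -> Prop) : Prop :=
  (forall v, W v -> is_l2 v) /\ W vzero /\
  (forall (a : C) v w, W v -> W w -> W (vadd (vscale a v) w)) /\
  (forall (u : nat -> vec) v, (forall k, W (u k)) -> is_l2 v ->
      (fun k => l2norm (vsub (u k) v)) @ \oo --> (0 : R) -> W v).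

Definition hyp_subspace (W : vec -> Prop) : Prop :=
  closed_subspace W /\ exists v, W v /\ posvec v.

Definition irreducible rho : Prop :=
  non_elementary rho /\
  ~ exists W, hyp_subspace W /\ (exists v, is_l2 v /\ ~ W v) /\
      forall g, isSU11 g -> forall w, W w -> W (rho g w).

Definition equivalent (rho1 rho2 : 'M[C]_2 -> vec -> vec) : Prop :=
  exists U, unitaryB U /\ forall g, isSU11 g -> exists c : C, cabs c = 1 /\
    forall v, is_l2 v -> rho2 g (U v) = vscale c (U (rho1 g v)).

Definition has_ell rho (t : R) : Prop :=
  0 < t /\ forall lam : R, 0 < lam ->
    inf [set hdist (rho (gmat lam 0) x) x | x in posvec] = t * `|ln lam|.

(* Arg(rho) is the argument of K(1): u = K(1)/|K(1)| *)
Definition has_arg rho (u : C) : Prop :=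
  exists (eta1 eta2 : vec) (T : vec -> vec) (k : C) (c : vec),
    isotropic eta1 /\ isotropic eta2 /\ Bform eta1 eta2 = 1 /\
    (forall lam b : R, 0 < lam -> same_line (rho (gmat lam b) eta1) eta1) /\
    (forall lam : R, 0 < lam -> same_line (rho (gmat lam 0) eta2) eta2) /\
    (exists c0 : C, cabs c0 = 1 /\ T = fun v => vscale c0 (rho (gmat 1 1) v)) /\
    T eta1 = eta1 /\
    is_l2 c /\ Bform c eta1 = 0 /\ Bform c eta2 = 0 /\
    T eta2 = vadd (vadd (vscale k eta1) eta2) c /\
    k != 0 /\ u = k / rC (cabs k).

End HypDefs.

(* Main.v *)
Require Import Defs.
From HB Require Import structures.
From mathcomp Require Import all_boot all_order all_algebra.
From mathcomp Require Import all_classical all_reals all_analysis.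
From mathcomp.real_closed Require Import complex.
From mathcomp Require Import ring lra.

(** Let P = {g(l,b)} and fix isotropic eta1, eta2 with B(eta1, eta2) = 1 as in
   the definition of Arg.  The G-orbit of [eta1] is [eta1] together with the
   lines of the vectors V b = T_b eta2, and the Gram matrix of these vectors is
   B(V b, V c) = K(b - c), B(V b, eta1) = 1.  Conjugation by g(l,0) gives
   K(l^2 b) = |mu|^2 K(b), where mu is the eigenvalue of rho(g(l,0)) at eta1;
   the displacement of rho(g(l,0)) forces |mu| = l^(+-t), and continuity of K at
   0 selects l^t.  Hence K(b) = b^t K(1) for b > 0, K(-b) = conj K(b), and after
   rescaling eta1, eta2 the Gram matrix depends only on t and Arg.  By
   irreducibility the orbit vectors are total, so equal Gram matrices yield an
   intertwining unitary.  Conversely Arg is transported by any equivalence, and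
   it exists: eta1 is the limit of an orbit of the one-parameter group g(l,0),
   eta2 its image under the Weyl element, and K(1) = 0 would make {eta1, eta2}
   an invariant pair. *)

Set Implicit Arguments.
Unset Strict Implicit.
Unset Printing Implicit Defensive.

Import Order.TTheory GRing.Theory Num.Theory numFieldNormedType.Exports.
Local Open Scope classical_set_scope.
Local Open Scope ring_scope.

(** * The space of square-summable sequences *)

(** Two obstacles shape the proof. The form is indefinite, so equality of Gram matrices does not by
    itself bound norms. The remedy is a unit positive vector x: changing the sign of B on the
    complement of x gives a Hilbert norm, with square [hsq x], which is equivalent to the l2 norm
    and is written in terms of B and x alone. Any map preserving B carries it to [hsq] of the image
    of x, which makes B-unitary maps bounded and lets Gram isometries extend to closures. The
    representation is only projective. Dividing the lift of g(1,b) by its eigenvalue at eta1, shown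
    to have modulus 1, turns b -> T_b into a true one-parameter group; this is what makes the Gram
    matrix a function of b - c. Phases return at the end, where the extended unitary intertwines the
    two actions on each orbit vector up to a scalar that may depend on the vector; nonvanishing of
    the off-diagonal Gram entries forces these scalars to agree. Continuity enters at the base point
    eta1 + eta2, where Re K >= 0 turns a small displacement into a small K. *)

Section ComplexScalars.
Variable R : realType.
Implicit Types z w : R[i].

Definition csq z : R := cRe z ^+ 2 + cIm z ^+ 2.

Lemma ceqP z w : cRe z = cRe w -> cIm z = cIm w -> z = w.
Proof. by case: z w => [a b] [c d] /= -> ->. Qed.

Lemma cReD z w : cRe (z + w) = cRe z + cRe w. Proof. by case: z w => [a b] [c d]. Qed.
Lemma cImD z w : cIm (z + w) = cIm z + cIm w. Proof. by case: z w => [a b] [c d]. Qed.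
Lemma cReN z : cRe (- z) = - cRe z. Proof. by case: z. Qed.
Lemma cImN z : cIm (- z) = - cIm z. Proof. by case: z. Qed.
Lemma cReM z w : cRe (z * w) = cRe z * cRe w - cIm z * cIm w.
Proof. by case: z w => [a b] [c d]. Qed.
Lemma cImM z w : cIm (z * w) = cRe z * cIm w + cIm z * cRe w.
Proof. by case: z w => [a b] [c d]. Qed.
Lemma cReJ z : cRe (cconj z) = cRe z. Proof. by case: z. Qed.
Lemma cImJ z : cIm (cconj z) = - cIm z. Proof. by case: z. Qed.
Lemma cReR (x : R) : cRe (rC x) = x. Proof. by []. Qed.
Lemma cImR (x : R) : cIm (rC x) = 0. Proof. by []. Qed.
Lemma cRei : cRe (iC R) = 0. Proof. by []. Qed.
Lemma cImi : cIm (iC R) = 1. Proof. by []. Qed.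
Lemma cRe0 : cRe (0 : R[i]) = 0. Proof. by []. Qed.
Lemma cIm0 : cIm (0 : R[i]) = 0. Proof. by []. Qed.
Lemma cRe1 : cRe (1 : R[i]) = 1. Proof. by []. Qed.
Lemma cIm1 : cIm (1 : R[i]) = 0. Proof. by []. Qed.

Definition cE := (cReD, cImD, cReN, cImN, cReM, cImM, cReJ, cImJ, cReR, cImR,
  cRei, cImi, cRe0, cIm0, cRe1, cIm1).

Lemma cconjD z w : cconj (z + w) = cconj z + cconj w. Proof. exact: rmorphD. Qed.
Lemma cconjN z : cconj (- z) = - cconj z. Proof. exact: rmorphN. Qed.
Lemma cconjM z w : cconj (z * w) = cconj z * cconj w. Proof. exact: rmorphM. Qed.
Lemma cconjV z : cconj z^-1 = (cconj z)^-1. Proof. exact: conjc_inv. Qed.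
Lemma cconjK z : cconj (cconj z) = z. Proof. exact: conjcK. Qed.
Lemma cconjR (x : R) : cconj (rC x) = rC x. Proof. exact: conjc_real. Qed.
Lemma cconj0 : cconj (0 : R[i]) = 0. Proof. exact: conjc0. Qed.
Lemma cconj1 : cconj (1 : R[i]) = 1. Proof. exact: conjc1. Qed.
Lemma cconj_eq0 z : (cconj z == 0) = (z == 0). Proof. exact: conjc_eq0. Qed.

Definition cJ := (cconjD, cconjN, cconjM, cconjV, cconjK, cconjR, cconj0, cconj1).

Lemma rCD (x y : R) : rC (x + y) = rC x + rC y. Proof. exact: (rmorphD (real_complex R)). Qed.
Lemma rCN (x : R) : rC (- x) = - rC x. Proof. exact: (rmorphN (real_complex R)). Qed.
Lemma rCM (x y : R) : rC (x * y) = rC x * rC y. Proof. exact: (rmorphM (real_complex R)). Qed.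
Lemma rCV (x : R) : rC x^-1 = (rC x)^-1. Proof. exact: (fmorphV (real_complex R)). Qed.
Lemma rC1 : rC (1 : R) = 1. Proof. by []. Qed.
Lemma rC_inj : injective (@rC R). Proof. by move=> x y []. Qed.
Lemma rC_eq0 (x : R) : (rC x == 0) = (x == 0).
Proof. by apply/eqP/eqP => [[]|->]. Qed.

Lemma mul_conj z : z * cconj z = rC (csq z).
Proof. by apply: ceqP; rewrite !cE /csq; ring. Qed.

Lemma csq_ge0 z : 0 <= csq z. Proof. by rewrite addr_ge0 ?sqr_ge0. Qed.
Lemma csq0 : csq 0 = 0. Proof. by rewrite /csq !cE; ring. Qed.
Lemma csq1 : csq 1 = 1. Proof. by rewrite /csq !cE; ring. Qed.
Lemma csqR (x : R) : csq (rC x) = x ^+ 2. Proof. by rewrite /csq !cE; ring. Qed.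
Lemma csqM z w : csq (z * w) = csq z * csq w.
Proof. by rewrite /csq !cE; ring. Qed.
Lemma csqJ z : csq (cconj z) = csq z. Proof. by rewrite /csq !cE; ring. Qed.
Lemma csqN z : csq (- z) = csq z. Proof. by rewrite /csq !cE; ring. Qed.
Lemma csq_eq0 z : (csq z == 0) = (z == 0).
Proof.
apply/eqP/eqP => [|->]; last exact: csq0.
move=> /eqP; rewrite paddr_eq0 ?sqr_ge0 // !sqrf_eq0 => /andP[/eqP a /eqP b].
exact: ceqP.
Qed.
Lemma csq_gt0 z : (0 < csq z) = (z != 0).
Proof. by rewrite lt0r csq_ge0 andbT csq_eq0. Qed.
Lemma csqV z : csq z^-1 = (csq z)^-1.
Proof.
have [->|z0] := eqVneq z 0; first by rewrite invr0 csq0 invr0.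
apply: (@mulfI _ (csq z)); first by rewrite csq_eq0.
by rewrite -csqM divff // csq1 divff // csq_eq0.
Qed.

Lemma cabs_ge0 z : 0 <= cabs z. Proof. exact: sqrtr_ge0. Qed.
Lemma sqr_cabs z : cabs z ^+ 2 = csq z. Proof. by rewrite sqr_sqrtr ?csq_ge0. Qed.
Lemma cabs_normc z : cabs z = Normc.normc z. Proof. by case: z. Qed.
Lemma cabsM z w : cabs (z * w) = cabs z * cabs w.
Proof. by rewrite !cabs_normc Normc.normcM. Qed.
Lemma cabsD z w : cabs (z + w) <= cabs z + cabs w.
Proof. by rewrite !cabs_normc le_normcD. Qed.
Lemma cabsV z : cabs z^-1 = (cabs z)^-1.
Proof. by rewrite !cabs_normc Normc.normcV. Qed.
Lemma cabsN z : cabs (- z) = cabs z.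
Proof. by rewrite !cabs_normc normcN. Qed.
Lemma cabsJ z : cabs (cconj z) = cabs z.
Proof. by rewrite /cabs -/(csq _) csqJ. Qed.
Lemma cabs1 : cabs (1 : R[i]) = 1. Proof. by rewrite cabs_normc Normc.normc1. Qed.
Lemma cabsR (x : R) : cabs (rC x) = `|x|.
Proof. by rewrite /cabs -/(csq _) csqR sqrtr_sqr. Qed.
Lemma cabs_eq0 z : (cabs z == 0) = (z == 0).
Proof. by rewrite -sqrf_eq0 sqr_cabs csq_eq0. Qed.
Lemma cabs_gt0 z : (0 < cabs z) = (z != 0).
Proof. by rewrite lt0r cabs_ge0 andbT cabs_eq0. Qed.
Lemma ler_cabs z w : (cabs z <= cabs w) = (csq z <= csq w).
Proof. by rewrite /cabs -/(csq _) -/(csq _) ler_sqrt ?csq_ge0. Qed.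
Lemma Re_le_cabs z : `|cRe z| <= cabs z.
Proof.
by rewrite -cabsR ler_cabs csqR /csq lerDl sqr_ge0.
Qed.
Lemma Im_le_cabs z : `|cIm z| <= cabs z.
Proof. by rewrite -cabsR ler_cabs csqR /csq lerDr sqr_ge0. Qed.

Lemma cabs1_csq z : cabs z = 1 -> csq z = 1.
Proof. by rewrite -sqr_cabs => ->; rewrite expr1n. Qed.
Lemma csq1_cabs z : csq z = 1 -> cabs z = 1.
Proof. by rewrite /cabs -/(csq _) => ->; rewrite sqrtr1. Qed.
Lemma cabs1_neq0 z : cabs z = 1 -> z != 0.
Proof. by move=> h; rewrite -cabs_eq0 h oner_eq0. Qed.
Lemma cabs1_conj z : cabs z = 1 -> z * cconj z = 1.
Proof. by move=> h; rewrite mul_conj cabs1_csq. Qed.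

End ComplexScalars.

Section SquareSummable.
Variable R : realType.
Implicit Types (v w u : vec R) (f g : nat -> R).

Lemma cvgn_unique f (a b : R) : f @ \oo --> a -> f @ \oo --> b -> a = b.
Proof. by move=> /cvg_lim fa /cvg_lim fb; rewrite -fa // -fb. Qed.

Lemma series_cvg_ext f g (a b : R) : f =1 g -> a = b ->
  series f @ \oo --> a -> series g @ \oo --> b.
Proof. by move=> /funext -> ->. Qed.

Lemma series_cvgD f g (a b : R) : series f @ \oo --> a -> series g @ \oo --> b ->
  series (fun n => f n + g n) @ \oo --> a + b.
Proof.
move=> fa gb; rewrite (_ : series _ = series f + series g); first exact: cvgD.
by rewrite -seriesD.
Qed.

Lemma series_cvgZ f (a k : R) : series f @ \oo --> a ->
  series (fun n => k * f n) @ \oo --> k * a.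
Proof.
move=> fa; rewrite (_ : series _ = k *: series f); first exact: cvgZl_tmp.
by rewrite -seriesZ.
Qed.

Lemma series_cvgS f : cvgn (series f) ->
  series (fun n => f n.+1) @ \oo --> limn (series f) - f 0%N.
Proof.
move=> fc.
have -> : series (fun n => f n.+1) = (fun n => series f n.+1 - f 0%N).
  by apply/funext => n; rewrite /series /= big_nat_recl // addrC addKr.
by apply: cvgB; [rewrite (cvg_shiftS (series f)) | exact: cvg_cst].
Qed.

Lemma l2_csq v : is_l2 v <-> cvgn (series (fun n => csq (v n))).
Proof.
rewrite /is_l2 (_ : (fun n => cabs (v n) ^+ 2) = (fun n => csq (v n))) //.
by apply/funext => n; rewrite sqr_cabs.
Qed.

Lemma l2_le v (g : nat -> R) :
  cvgn (series g) -> (forall n, csq (v n) <= g n) -> is_l2 v.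
Proof.
move=> gc h; apply/l2_csq; apply: series_le_cvg gc => // n; first exact: csq_ge0.
exact: le_trans (csq_ge0 _) (h n).
Qed.

Lemma csqD_le (z w : R[i]) : csq (z + w) <= 2 * (csq z + csq w).
Proof.
rewrite /csq !cE.
have := sqr_ge0 (cRe z - cRe w); have := sqr_ge0 (cIm z - cIm w); nra.
Qed.

Lemma l2_add v w : is_l2 v -> is_l2 w -> is_l2 (vadd v w).
Proof.
move=> /l2_csq v2 /l2_csq w2.
apply: (@l2_le _ (fun n => 2 * (csq (v n) + csq (w n)))).
  by apply: cvgP; apply: series_cvgZ; apply: series_cvgD; [exact: v2 | exact: w2].
by move=> n; exact: csqD_le.
Qed.

Lemma l2_scale a v : is_l2 v -> is_l2 (vscale a v).
Proof.
move=> /l2_csq v2.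
apply: (@l2_le _ (fun n => csq a * csq (v n))).
  by apply: cvgP; apply: series_cvgZ; exact: v2.
by move=> n; rewrite csqM.
Qed.

Lemma vsubE v w : vsub v w = vadd v (vscale (-1) w).
Proof. by apply/funext => n; rewrite /vsub /vadd /vscale mulN1r. Qed.

Lemma l2_sub v w : is_l2 v -> is_l2 w -> is_l2 (vsub v w).
Proof. by move=> v2 w2; rewrite vsubE; apply: l2_add => //; exact: l2_scale. Qed.

Lemma l2_zero : is_l2 (vzero R).
Proof.
apply/l2_csq; rewrite (_ : series _ = fun=> 0); first exact: is_cvg_cst.
by apply/funext => n; rewrite /series /= big1 // => i _; exact: csq0.
Qed.

Lemma series_ReIm_cvg v w : is_l2 v -> is_l2 w ->
  cvgn (series (fun n => cRe (v n * cconj (w n)))) /\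
  cvgn (series (fun n => cIm (v n * cconj (w n)))).
Proof.
move=> /l2_csq v2 /l2_csq w2.
have s2 : cvgn (series (fun n => csq (v n) + csq (w n))).
  by apply: cvgP; apply: series_cvgD; [exact: v2 | exact: w2].
have key (f : nat -> R) : (forall n, `|f n| <= csq (v n) + csq (w n)) ->
    cvgn (series f).
  move=> h; apply: normed_cvg; apply: series_le_cvg s2 => n; [exact: normr_ge0| |exact: h].
  by apply: addr_ge0; exact: csq_ge0.
have bnd (z y : R[i]) : cabs (z * cconj y) <= csq z + csq y.
  rewrite cabsM cabsJ -!sqr_cabs.
  have := sqr_ge0 (cabs z - cabs y); have := cabs_ge0 z; have := cabs_ge0 y.
  nra.
split; apply: key => n; apply: le_trans (bnd (v n) (w n)).
  exact: Re_le_cabs.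
exact: Im_le_cabs.
Qed.

(** Together with [Bform_unique] this is the access to the limits inside [Bform]: each algebraic law
    of B becomes a termwise identity between real series. *)
Lemma BformP v w : is_l2 v -> is_l2 w ->
  (series (fun n => cRe (v n.+1 * cconj (w n.+1))) @ \oo -->
     cRe (v 0%N * cconj (w 0%N)) - cRe (Bform v w)) /\
  (series (fun n => cIm (v n.+1 * cconj (w n.+1))) @ \oo -->
     cIm (v 0%N * cconj (w 0%N)) - cIm (Bform v w)).
Proof.
move=> v2 w2; have [/series_cvgS a /series_cvgS b] := series_ReIm_cvg v2 w2.
move: (cvgP _ a) (cvgP _ b) => a' b'.
have -> : cRe (v 0%N * cconj (w 0%N)) - cRe (Bform v w) =
   limn (series (fun n => cRe (v n.+1 * cconj (w n.+1)))).
  by rewrite /Bform !(cReD, cReN) [cRe (iC R * _)]cReM !cE; ring.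
have -> : cIm (v 0%N * cconj (w 0%N)) - cIm (Bform v w) =
   limn (series (fun n => cIm (v n.+1 * cconj (w n.+1)))).
  by rewrite /Bform !(cImD, cImN) [cIm (iC R * _)]cImM !cE; ring.
by split.
Qed.

Lemma Bform_unique v w z : is_l2 v -> is_l2 w ->
  (series (fun n => cRe (v n.+1 * cconj (w n.+1))) @ \oo -->
     cRe (v 0%N * cconj (w 0%N)) - cRe z) ->
  (series (fun n => cIm (v n.+1 * cconj (w n.+1))) @ \oo -->
     cIm (v 0%N * cconj (w 0%N)) - cIm z) ->
  Bform v w = z.
Proof.
move=> v2 w2 a b; have [a' b'] := BformP v2 w2.
have /eqP := cvgn_unique a a'.
rewrite (inj_eq (addrI _)) eqr_opp => /eqP i1.
have /eqP := cvgn_unique b b'.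
rewrite (inj_eq (addrI _)) eqr_opp => /eqP i2.
by apply: ceqP.
Qed.

Lemma BformDl v w u : is_l2 v -> is_l2 w -> is_l2 u ->
  Bform (vadd v w) u = Bform v u + Bform w u.
Proof.
move=> v2 w2 u2.
have [a b] := BformP v2 u2; have [c d] := BformP w2 u2.
apply: Bform_unique => //; first exact: l2_add.
- by apply: series_cvg_ext (series_cvgD a c) => [n|]; rewrite /vadd !cE; ring.
- by apply: series_cvg_ext (series_cvgD b d) => [n|]; rewrite /vadd !cE; ring.
Qed.

Lemma BformZl k v u : is_l2 v -> is_l2 u ->
  Bform (vscale k v) u = k * Bform v u.
Proof.
move=> v2 u2.
have [a b] := BformP v2 u2.
apply: Bform_unique => //; first exact: l2_scale.
- apply: series_cvg_ext (series_cvgD (series_cvgZ (k := cRe k) a)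
    (series_cvgZ (k := - cIm k) b)) => [n|]; rewrite /vscale !cE; ring.
- apply: series_cvg_ext (series_cvgD (series_cvgZ (k := cRe k) b)
    (series_cvgZ (k := cIm k) a)) => [n|]; rewrite /vscale !cE; ring.
Qed.

Lemma BformC v w : is_l2 v -> is_l2 w -> Bform w v = cconj (Bform v w).
Proof.
move=> v2 w2.
have [a b] := BformP v2 w2.
apply: Bform_unique => //.
- by apply: series_cvg_ext a => [n|]; rewrite !cE; ring.
- by apply: series_cvg_ext (series_cvgZ (k := -1) b) => [n|]; rewrite !cE; ring.
Qed.

(** Estimates are kept in squared form throughout, so the triangle inequality will carry a factor
    2. *)
Definition nsq v : R := limn (series (fun n => csq (v n))).

Lemma l2norm_nsq v : l2norm v = Num.sqrt (nsq v).
Proof.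
by rewrite /l2norm /nsq; congr (Num.sqrt (limn (series _))); apply/funext => n;
  rewrite sqr_cabs.
Qed.

(** The tail sum is [nsq v - csq (v 0)], so coordinate 0 is counted twice. The identity converts
    between the form and the norm. *)
Lemma Bform_diag v : is_l2 v -> Bform v v = rC (2 * csq (v 0%N) - nsq v).
Proof.
move=> v2; have := v2 => /l2_csq vc.
have := series_cvgS vc => a.
apply: Bform_unique => //.
- by apply: series_cvg_ext a => [n|]; rewrite /nsq /csq !cE; ring.
- rewrite (_ : series _ = fun=> 0).
    rewrite (_ : _ - _ = 0); first exact: cvg_cst.
    by rewrite !cE; ring.
  by apply/funext => n; rewrite /series /= big1 // => i _; rewrite !cE; ring.
Qed.

Lemma series_csq_nd v : nondecreasing_seq (series (fun n => csq (v n))).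
Proof. by apply: nondecreasing_series => i _ _; exact: csq_ge0. Qed.

Lemma series_csq_le v n : is_l2 v -> series (fun n => csq (v n)) n <= nsq v.
Proof.
by move=> /l2_csq vc; exact: (nondecreasing_cvgn_le (series_csq_nd v) vc n).
Qed.

Lemma nsq_ge v n : is_l2 v -> csq (v n) <= nsq v.
Proof.
move=> v2; apply: le_trans (series_csq_le n.+1 v2).
rewrite /series /= big_nat_recr //= lerDr; apply: sumr_ge0 => i _; exact: csq_ge0.
Qed.

Lemma nsq_ge0 v : is_l2 v -> 0 <= nsq v.
Proof. by move=> v2; apply: le_trans (nsq_ge 0%N v2); exact: csq_ge0. Qed.

Lemma nsq_eq0 v : is_l2 v -> nsq v = 0 -> v = vzero R.
Proof.
move=> v2 h; apply/funext => n; apply/eqP; rewrite -csq_eq0 eq_le csq_ge0 andbT.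
by rewrite -h; exact: nsq_ge.
Qed.

(* Fatou's lemma for partial sums. *)
Lemma l2_pointwise_limit (u : nat -> vec R) v (M : R) :
  (forall k, is_l2 (u k)) ->
  (forall n, cRe (u k n) @[k --> \oo] --> cRe (v n)) ->
  (forall n, cIm (u k n) @[k --> \oo] --> cIm (v n)) ->
  (\forall k \near \oo, nsq (u k) <= M) -> is_l2 v /\ nsq v <= M.
Proof.
move=> u2 re im bd.
have part N : series (fun n => csq (v n)) N <= M.
  have cv : series (fun n => csq (u k n)) N @[k --> \oo]
      --> series (fun n => csq (v n)) N.
    elim: N => [|N IH].
      rewrite (_ : (fun k => _) = fun=> 0); last first.
        by apply/funext => k; rewrite /series /= big_geq.
      by rewrite /series /= big_geq //; exact: cvg_cst.
    have sE (w : vec R) : series (fun n => csq (w n)) N.+1 =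
        series (fun n => csq (w n)) N + (cRe (w N) * cRe (w N) + cIm (w N) * cIm (w N)).
      by rewrite /series /= big_nat_recr //= /csq !expr2.
    rewrite sE; under eq_fun do rewrite sE.
    exact: cvgD IH (cvgD (cvgM (re N) (re N)) (cvgM (im N) (im N))).
  apply: (@closed_cvg _ _ \oo _ (fun k => series (fun n => csq (u k n)) N)
    (fun x => x <= M)) cv; first exact: closed_le.
  by apply: filterS bd => k; apply: le_trans; exact: series_csq_le.
have nd := series_csq_nd v.
have vc : cvgn (series (fun n => csq (v n))).
  by apply: nondecreasing_is_cvgn => //; exists M => _ [n _ <-]; exact: part.
split; first exact/l2_csq.
by apply: limr_le => //; near=> n; exact: part.
Unshelve. all: by end_near. Qed.

(** Each coordinate is Cauchy; the coordinatewise limit v is controlled by applying the Fatou bound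
    to [vsub (u k) (u l)] as l tends to infinity with k fixed. *)
Lemma l2_complete (u : nat -> vec R) : (forall k, is_l2 (u k)) ->
  (forall e : R, 0 < e -> exists N, forall k l, (N <= k)%N -> (N <= l)%N ->
     nsq (vsub (u k) (u l)) <= e) ->
  exists v, is_l2 v /\ forall e : R, 0 < e -> exists N, forall k, (N <= k)%N ->
     nsq (vsub (u k) v) <= e.
Proof.
move=> u2 cau.
have cc (f : R[i] -> R) : (forall z y : R[i], `|f z - f y| <= cabs (z - y)) ->
    forall n, cvgn (fun k => f (u k n)).
  move=> fl n; apply: cauchy_cvg; apply: cauchy_exP => e e0.
  have [|N hN] := cau ((e / 2) ^+ 2); first by rewrite exprn_gt0 // divr_gt0.
  exists (f (u N n)); exists N => // k /= Nk.
  suff : `|f (u N n) - f (u k n)| < e by rewrite -ball_normE /ball_ /=.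
apply: (le_lt_trans (fl (u N n) (u k n))).
  apply: (@le_lt_trans _ _ (e / 2)); last by rewrite ltr_pdivrMr // ltr_pMr // ltr1n.
  rewrite -(@ler_pXn2r _ 2) ?nnegrE ?cabs_ge0 ?divr_ge0 ?(ltW e0) //.
  rewrite sqr_cabs; have := nsq_ge n (l2_sub (u2 N) (u2 k)); rewrite /vsub => /le_trans; apply.
  exact: hN.
pose v : vec R := fun n =>
  Complex (limn (fun k => cRe (u k n))) (limn (fun k => cIm (u k n))).
have re n : cRe (u k n) @[k --> \oo] --> cRe (v n).
  by apply: (cc (@cRe R)) => z y; have := Re_le_cabs (z - y); rewrite !cE.
have im n : cIm (u k n) @[k --> \oo] --> cIm (v n).
  by apply: (cc (@cIm R)) => z y; have := Im_le_cabs (z - y); rewrite !cE.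
have lim e : 0 < e -> exists N, forall k, (N <= k)%N ->
    is_l2 (vsub (u k) v) /\ nsq (vsub (u k) v) <= e.
  move=> e0; have [N hN] := cau e e0; exists N => k Nk.
  apply: (@l2_pointwise_limit (fun l => vsub (u k) (u l))).
  - by move=> l; exact: l2_sub.
  - move=> n; rewrite /vsub !cE; under eq_fun do rewrite !cE.
    by apply: cvgB; [exact: cvg_cst | exact: re].
  - move=> n; rewrite /vsub !cE; under eq_fun do rewrite !cE.
    by apply: cvgB; [exact: cvg_cst | exact: im].
  - by exists N => // l /= Nl; exact: hN.
exists v; split.
  have [N hN] := lim 1 ltr01; have [d2 _] := hN N (leqnn N).
  rewrite (_ : v = vsub (u N) (vsub (u N) v)); first exact: l2_sub.
  by apply/funext => n; rewrite /vsub opprB addrC subrK.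
by move=> e e0; have [N hN] := lim e e0; exists N => k /hN[].
Unshelve. all: by end_near. Qed.

End SquareSummable.

(** * The form of signature (1, oo) *)

Ltac l2_auto := repeat match goal with
  | |- is_l2 (vadd _ _) => apply: l2_add
  | |- is_l2 (vsub _ _) => apply: l2_sub
  | |- is_l2 (vscale _ _) => apply: l2_scale
  | |- is_l2 (vzero _) => exact: l2_zero
  | |- is_l2 _ => assumption
  end.
#[local] Hint Extern 0 (is_l2 _) => solve [l2_auto] : core.
#[local] Opaque Bform is_l2 nsq.

Section HermitianForm.
Variable R : realType.
Implicit Types (v w u x y : vec R) (a b : R[i]).

Lemma BformDr v w u : is_l2 v -> is_l2 w -> is_l2 u ->
  Bform u (vadd v w) = Bform u v + Bform u w.
Proof.
by move=> v2 w2 u2; rewrite BformC // BformDl // cconjD -!BformC //.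
Qed.

Lemma BformZr a v u : is_l2 v -> is_l2 u ->
  Bform u (vscale a v) = cconj a * Bform u v.
Proof.
by move=> v2 u2; rewrite BformC // BformZl // cconjM -BformC //.
Qed.

Lemma BformBl v w u : is_l2 v -> is_l2 w -> is_l2 u ->
  Bform (vsub v w) u = Bform v u - Bform w u.
Proof. by move=> v2 w2 u2; rewrite vsubE BformDl // BformZl // mulN1r. Qed.

Lemma BformBr v w u : is_l2 v -> is_l2 w -> is_l2 u ->
  Bform u (vsub v w) = Bform u v - Bform u w.
Proof.
by move=> v2 w2 u2; rewrite BformC // BformBl // cconjD cconjN -!BformC.
Qed.

Lemma Bform0l u : is_l2 u -> Bform (vzero R) u = 0.
Proof.
move=> u2; rewrite (_ : vzero R = vscale 0 (vzero R)); last first.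
  by apply/funext => n; rewrite /vscale mul0r.
by rewrite BformZl // mul0r.
Qed.

Lemma Bform0r u : is_l2 u -> Bform u (vzero R) = 0.
Proof. by move=> u2; rewrite BformC // Bform0l // cconj0. Qed.

Definition qf v : R := cRe (Bform v v).

Lemma Bform_qf v : is_l2 v -> Bform v v = rC (qf v).
Proof. by move=> v2; rewrite /qf Bform_diag. Qed.

Lemma qf_nsq v : is_l2 v -> qf v = 2 * csq (v 0%N) - nsq v.
Proof. by move=> v2; rewrite /qf Bform_diag. Qed.

Lemma qfD v w : is_l2 v -> is_l2 w ->
  qf (vadd v w) = qf v + qf w + 2 * cRe (Bform v w).
Proof.
move=> v2 w2; rewrite /qf BformDl // !BformDr // (BformC v2 w2) !cE; ring.
Qed.

Lemma qfZ a v : is_l2 v -> qf (vscale a v) = csq a * qf v.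
Proof.
by move=> v2; rewrite /qf BformZl // BformZr // mulrA mul_conj !cE; ring.
Qed.

Lemma qfB v w : is_l2 v -> is_l2 w ->
  qf (vsub v w) = qf v + qf w - 2 * cRe (Bform v w).
Proof.
move=> v2 w2; rewrite vsubE qfD // qfZ // csqN csq1 BformZr // cconjN cconj1.
by rewrite !cE; ring.
Qed.

(** The parallelogram law, obtained from [qfD] and [qfB], with the nonnegative [nsq (vsub v w)]
    dropped. *)
Lemma nsqD_le v w : is_l2 v -> is_l2 w ->
  nsq (vadd v w) <= 2 * (nsq v + nsq w).
Proof.
move=> v2 w2; have := nsq_ge0 (l2_sub v2 w2).
have := qfD v2 w2; have := qfB v2 w2; rewrite !qf_nsq //.
rewrite /vadd /vsub /csq !cE; nra.
Qed.

Lemma nsqZ a v : is_l2 v -> nsq (vscale a v) = csq a * nsq v.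
Proof.
move=> v2; have := qfZ a v2; rewrite !qf_nsq //.
rewrite /vscale csqM; nra.
Qed.

Lemma nsq_subC v w : is_l2 v -> is_l2 w -> nsq (vsub v w) = nsq (vsub w v).
Proof.
move=> v2 w2; rewrite (_ : vsub v w = vscale (-1) (vsub w v)).
  by rewrite nsqZ // csqN csq1 mul1r.
by apply/funext => n; rewrite /vsub /vscale; ring.
Qed.

Lemma nsq_subvv v : is_l2 v -> nsq (vsub v v) = 0.
Proof.
move=> v2; rewrite (_ : vsub v v = vscale 0 v) ?nsqZ ?csq0 ?mul0r //.
by apply/funext => n; rewrite /vsub /vscale mul0r subrr.
Qed.

Lemma nsq_dist_le v u w : is_l2 v -> is_l2 u -> is_l2 w ->
  nsq (vsub v w) <= 2 * (nsq (vsub v u) + nsq (vsub u w)).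
Proof.
move=> v2 u2 w2; rewrite (_ : vsub v w = vadd (vsub v u) (vsub u w)).
  exact: nsqD_le.
by apply/funext => n; rewrite /vsub /vadd; ring.
Qed.

Definition ebase : vec R := fun n => if n == 0%N then 1 else 0.

Lemma l2_ebase : is_l2 ebase.
Proof.
apply: (@l2_le _ _ (geometric 1 2^-1)).
  apply: is_cvg_geometric_series; rewrite ger0_norm ?invr_ge0 ?ler0n //.
  by rewrite invf_lt1 ?ltr0n // ltr1n.
case=> [|n]; rewrite /ebase /geometric /=; first by rewrite csq1 mul1r.
by rewrite csq0 mul1r exprn_ge0 // invr_ge0 ler0n.
Qed.
#[local] Hint Extern 0 (is_l2 ebase) => exact: l2_ebase : core.

Lemma Bform_ebase v : is_l2 v -> Bform v ebase = v 0%N.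
Proof.
move=> v2; have tail n : ebase n.+1 = 0 by [].
have head : ebase 0%N = 1 by [].
have cst0 (f : nat -> R) (l : R) : (forall n, f n = 0) -> l = 0 ->
    series f @ \oo --> l.
  move=> f0 ->; rewrite (_ : series f = fun=> 0); first exact: cvg_cst.
  by apply/funext => n; rewrite /series /= big1.
apply: Bform_unique => //; apply: cst0 => [n|]; rewrite ?tail ?head !cE; ring.
Qed.

Lemma Bform_ebase1 : Bform ebase ebase = 1.
Proof. by rewrite Bform_ebase. Qed.

Lemma coord0_neq0 x : is_l2 x -> 0 < qf x -> x 0%N != 0.
Proof.
move=> x2; rewrite qf_nsq // => h; rewrite -csq_gt0.
by have := nsq_ge 0%N x2; lra.
Qed.

(** This is where the signature (1, oo) enters. The combination u = x_0 v - v_0 x has coordinate 0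
    equal to 0, so qf u = - nsq u <= 0, while orthogonality gives qf u = |x_0|^2 qf v + |v_0|^2 qf
    x. *)
Lemma orth_pos x v : is_l2 x -> is_l2 v -> 0 < qf x -> Bform v x = 0 ->
  qf v <= 0 /\ (qf v = 0 -> v = vzero R).
Proof.
move=> x2 v2 xp vx.
pose u := vsub (vscale (x 0%N) v) (vscale (v 0%N) x).
have u2 : is_l2 u by rewrite /u.
have qu : qf u = csq (x 0%N) * qf v + csq (v 0%N) * qf x.
  rewrite /u qfB ?qfZ //.
  by rewrite BformZl // ?BformZr // ?vx ?mulr0 ?cE; ring.
have nu : qf u <= 0.
  have u0 : u 0%N = 0 by rewrite /u /vsub /vscale; ring.
  rewrite qf_nsq // u0 csq0.
  by have := nsq_ge0 u2; lra.
have x0 : 0 < csq (x 0%N) by rewrite csq_gt0 coord0_neq0.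
have v0 : 0 <= csq (v 0%N) by exact: csq_ge0.
have le1 : qf v <= 0 by rewrite -(pmulr_rle0 _ x0); nra.
split => // qv0; apply: nsq_eq0 => //.
have v00 : csq (v 0%N) = 0 by nra.
by move: qv0; rewrite qf_nsq // v00; lra.
Qed.

(** The usual Cauchy-Schwarz argument for the negative definite complement of x: qf (w) v - B(v,w) w
    has nonpositive form, and one divides by qf w < 0. When qf w = 0, w itself is 0. *)
Lemma orth_pos_CS x v w : is_l2 x -> is_l2 v -> is_l2 w -> 0 < qf x ->
  Bform v x = 0 -> Bform w x = 0 -> csq (Bform v w) <= qf v * qf w.
Proof.
move=> x2 v2 w2 xp vx wx.
have [qw1 qw0] := orth_pos x2 w2 xp wx.
have [/qw0 ->|qwn] := eqVneq (qf w) 0.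
  by rewrite Bform0r // csq0 /qf Bform0l // mulr0.
pose u := vsub (vscale (rC (qf w)) v) (vscale (Bform v w) w).
have u2 : is_l2 u by rewrite /u.
have ux : Bform u x = 0.
  by rewrite /u BformBl ?BformZl // ?vx ?wx ?mulr0 ?subr0.
have [qu _] := orth_pos x2 u2 xp ux; move: qu.
rewrite /u qfB ?qfZ ?BformZl ?BformZr //.
have E : cRe (rC (qf w) * (cconj (Bform v w) * Bform v w)) =
    qf w * csq (Bform v w).
  by rewrite (mulrC (cconj _)) mul_conj -rCM cReR.
rewrite E csqR => h.
have qwl : qf w < 0 by rewrite lt_neqAle qwn.
have : 0 <= qf v * qf w - csq (Bform v w) by rewrite -(nmulr_rle0 _ qwl); nra.
by rewrite subr_ge0.
Qed.

(* When B(x,x) = 1, the square of the Hilbert norm in which x is orthogonal to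
   its B-complement. *)
Definition hsq x v : R := 2 * csq (Bform v x) - qf v.

Lemma qf_gt0 x : Bform x x = 1 -> 0 < qf x.
Proof. by rewrite /qf => ->; rewrite cRe1 ltr01. Qed.

Section PositiveVector.
Variable x : vec R.
Hypotheses (x2 : is_l2 x) (x1 : Bform x x = 1).

Let xp := qf_gt0 x1.

Let orthp v := vsub v (vscale (Bform v x) x).

Fact orthpP v : is_l2 v ->
  [/\ is_l2 (orthp v), Bform (orthp v) x = 0 & qf (orthp v) = qf v - csq (Bform v x)].
Proof.
move=> v2; have o2 : is_l2 (orthp v) by rewrite /orthp.
split => //.
  by rewrite /orthp BformBl ?BformZl // ?x1 ?mulr1 ?subrr.
rewrite /orthp qfB ?qfZ ?BformZr //.
rewrite (mulrC (cconj _)) mul_conj cReR {2}/qf x1 cRe1; ring.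
Qed.

Lemma hsq_orth v : is_l2 v -> hsq x v = csq (Bform v x) - qf (orthp v).
Proof. by move=> v2; have [_ _ ->] := orthpP v2; rewrite /hsq; ring. Qed.

Lemma hsq_ge v : is_l2 v -> csq (Bform v x) <= hsq x v.
Proof.
move=> v2; rewrite hsq_orth //; have [po px _] := orthpP v2.
by have [h _] := orth_pos x2 po xp px; lra.
Qed.

Lemma hsq_ge0 v : is_l2 v -> 0 <= hsq x v.
Proof. by move=> v2; apply: le_trans (hsq_ge v2); exact: csq_ge0. Qed.

(** Split v and w along x and its complement. With a, b the moduli of the components along x and s,
    r the norms of the remainders, |B(v,w)| <= a b + s r, and Cauchy-Schwarz in the plane
    finishes. *)
Lemma hsq_CS v w : is_l2 v -> is_l2 w ->
  csq (Bform v w) <= hsq x v * hsq x w.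
Proof.
move=> v2 w2; have [vo vx vq] := orthpP v2; have [wo wx wq] := orthpP w2.
have cs := orth_pos_CS x2 vo wo xp vx wx.
have [nv _] := orth_pos x2 vo xp vx; have [nw _] := orth_pos x2 wo xp wx.
rewrite !hsq_orth //.
have -> : Bform v w = Bform v x * cconj (Bform w x) + Bform (orthp v) (orthp w).
  rewrite /orthp BformBl ?BformBr ?BformZl ?BformZr ?x1 //.
  by rewrite (BformC w2 x2); ring.
move: cs; set z := Bform (orthp _) _; set n := qf (orthp v); set m := qf (orthp w).
rewrite -!sqr_cabs => cs.
have n0 : 0 <= - n by rewrite oppr_ge0.
have m0 : 0 <= - m by rewrite oppr_ge0.
set s := Num.sqrt (- n); set r := Num.sqrt (- m).
have sE : s ^+ 2 = - n by rewrite sqr_sqrtr.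
have rE : r ^+ 2 = - m by rewrite sqr_sqrtr.
have s0 : 0 <= s by exact: sqrtr_ge0.
have r0 : 0 <= r by exact: sqrtr_ge0.
have zsr : cabs z <= s * r.
  rewrite -(@ler_pXn2r _ 2) ?nnegrE ?cabs_ge0 ?mulr_ge0 //.
  by rewrite exprMn sE rE mulrNN.
have := cabsD (Bform v x * cconj (Bform w x)) z; rewrite cabsM cabsJ.
set t := cabs (_ + z); set a := cabs (Bform v x); set b := cabs (Bform w x).
move=> tl; have t0 : 0 <= t by exact: cabs_ge0.
have : t ^+ 2 <= (a * b + s * r) ^+ 2.
  rewrite ler_pXn2r ?nnegrE ?addr_ge0 ?mulr_ge0 ?cabs_ge0 //.
  by apply: le_trans tl _; rewrite lerD2l.
move=> /le_trans; apply.
rewrite -sE -rE; have := sqr_ge0 (a * r - b * s); nra.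
Qed.

End PositiveVector.

Lemma hsq_ebase v : is_l2 v -> hsq ebase v = nsq v.
Proof. by move=> v2; rewrite /hsq Bform_ebase // qf_nsq //; ring. Qed.

Lemma Bform_CS v w : is_l2 v -> is_l2 w -> csq (Bform v w) <= nsq v * nsq w.
Proof.
by move=> v2 w2; rewrite -!hsq_ebase //; apply: hsq_CS => //; exact: Bform_ebase1.
Qed.

Lemma qf_ge v : is_l2 v -> - nsq v <= qf v.
Proof. by move=> v2; rewrite qf_nsq //; have := csq_ge0 (v 0%N); lra. Qed.

(** Write nsq v = 2 |v_0|^2 - qf v. Since v_0 = B(v, ebase), [hsq_CS] bounds |v_0|^2 by
    [hsq x v * hsq x ebase], and - qf v <= hsq x v. With [hsq_le_nsq], all these norms are
    equivalent. *)
Lemma nsq_le_hsq x v : is_l2 x -> Bform x x = 1 -> is_l2 v ->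
  nsq v <= (2 * hsq x ebase + 1) * hsq x v.
Proof.
move=> x2 x1 v2; have := hsq_CS x2 x1 v2 l2_ebase; rewrite Bform_ebase //.
rewrite {4}/hsq.
have := hsq_ge0 x2 x1 v2; have := csq_ge0 (Bform v x).
by have := qf_nsq v2; rewrite /hsq; nra.
Qed.

Lemma hsq_le_nsq x v : is_l2 x -> is_l2 v -> hsq x v <= (2 * nsq x + 1) * nsq v.
Proof.
by move=> x2 v2; have := Bform_CS v2 x2; have := qf_ge v2; rewrite /hsq; nra.
Qed.

(** The component of y orthogonal to x, scaled by qf x, has nonpositive form by [orth_pos]. This is
    what makes [coshd] at least 1. *)
Lemma reverse_CS x y : is_l2 x -> is_l2 y -> 0 < qf x ->
  qf x * qf y <= csq (Bform x y).
Proof.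
move=> x2 y2 xp.
pose u := vsub (vscale (rC (qf x)) y) (vscale (Bform y x) x).
have u2 : is_l2 u by rewrite /u.
have ux : Bform u x = 0.
  rewrite /u BformBl ?BformZl ?Bform_qf //.
  by rewrite mulrC subrr.
have [qu _] := orth_pos x2 u2 xp ux; move: qu.
rewrite /u qfB ?qfZ ?BformZl ?BformZr //.
have E : cRe (rC (qf x) * (cconj (Bform y x) * Bform y x)) =
    qf x * csq (Bform y x).
  by rewrite (mulrC (cconj _)) mul_conj -rCM cReR.
rewrite E csqR (BformC y2 x2) csqJ => h.
by rewrite -subr_le0 -(pmulr_rle0 _ xp); nra.
Qed.

(** Subtract from v the multiple of w with the same coordinate 0: the difference is again isotropic,
    and an isotropic vector with coordinate 0 equal to 0 has norm 0. For the same reason w_0 is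
    nonzero. *)
Lemma isotropic_orth v w : is_l2 v -> is_l2 w -> w <> vzero R ->
  Bform v v = 0 -> Bform w w = 0 -> Bform v w = 0 -> exists a, v = vscale a w.
Proof.
move=> v2 w2 wn vv ww vw.
have w0 : w 0%N != 0.
  apply/eqP => w0; apply: wn; apply: nsq_eq0 => //.
  by have := qf_nsq w2; rewrite /qf ww w0 csq0 cRe0; lra.
exists (v 0%N / w 0%N).
pose u := vsub v (vscale (v 0%N / w 0%N) w).
have u2 : is_l2 u by rewrite /u.
suff : u = vzero R.
  by move=> E; apply/funext => n; have := congr1 (@^~ n) E;
    rewrite /u /vsub /vzero => /subr0_eq.
apply: nsq_eq0 => //; have := qf_nsq u2.
rewrite {2}/u /vsub /vscale mulrVK ?unitfE // subrr csq0.
rewrite /u qfB ?qfZ ?BformZr //.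
by rewrite /qf vv ww vw mulr0 !cE; lra.
Qed.

Lemma isotropic_orth_line v w : isotropic v -> isotropic w -> Bform v w = 0 ->
  same_line v w.
Proof.
move=> [v2 [vn vv]] [w2 [wn ww]] vw; have [a E] := isotropic_orth v2 w2 wn vv ww vw.
exists a; split => //; apply/eqP => a0; apply: vn; rewrite E a0.
by apply/funext => n; rewrite /vscale mul0r.
Qed.

End HermitianForm.

#[local] Hint Extern 0 (is_l2 (ebase _)) => exact: l2_ebase : core.


Section Lines.
Variable R : realType.
Implicit Types (v w u x y : vec R) (a b c : R[i]) (T : vec R -> vec R).

Lemma vscaleA a b v : vscale a (vscale b v) = vscale (a * b) v.
Proof. by apply/funext => n; rewrite /vscale mulrA. Qed.

Lemma vscale1 v : vscale 1 v = v.
Proof. by apply/funext => n; rewrite /vscale mul1r. Qed.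

Lemma vscale_eq0 a v : a != 0 -> vscale a v = vzero R -> v = vzero R.
Proof.
move=> a0 h; apply/funext => n; have /eqP := congr1 (@^~ n) h.
by rewrite /vscale /vzero mulf_eq0 (negbTE a0) => /eqP.
Qed.

Lemma vaddv0 v : vadd v (vzero R) = v.
Proof. by apply/funext => n; rewrite /vadd addr0. Qed.

Lemma same_line_sym v w : same_line v w -> same_line w v.
Proof.
by move=> [a [a0 ->]]; exists a^-1; rewrite invr_eq0 vscaleA mulVf // vscale1.
Qed.

Lemma same_line_trans u v w : same_line u v -> same_line v w -> same_line u w.
Proof.
by move=> [a [a0 ->]] [b [b0 ->]]; exists (a * b); rewrite mulf_neq0 // vscaleA.
Qed.

Lemma same_line_scale a v : a != 0 -> same_line (vscale a v) v.
Proof. by exists a. Qed.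

Lemma same_line_isotropic v w : same_line v w -> isotropic w -> isotropic v.
Proof.
move=> [a [a0 ->]] [w2 [w0 ww]]; split; first by [].
by split; [move=> /(vscale_eq0 a0) | rewrite BformZl // BformZr // ww !mulr0].
Qed.

(** The sum represents a point of the geodesic joining the two boundary points; it serves as base
    point on the axis. *)
Lemma isotropic_sum_qf v w : isotropic v -> isotropic w -> Bform v w = 1 ->
  is_l2 (vadd v w) /\ qf (vadd v w) = 2.
Proof.
move=> [v2 [_ vv]] [w2 [_ ww]] vw; split => //.
by rewrite qfD // /qf vv ww vw !cE; ring.
Qed.

(** Testing against [ebase] gives v_0 = 0 and testing against v gives qf v = 0, so nsq v = 0. *)
Lemma nondegenerate v : is_l2 v -> (forall w, is_l2 w -> Bform v w = 0) ->
  v = vzero R.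
Proof.
move=> v2 h; apply: nsq_eq0 => //; have := qf_nsq v2.
by rewrite -(Bform_ebase v2) h // /qf h // csq0 cRe0; lra.
Qed.

End Lines.

(** * Maps preserving the form *)

Section Unitary.
Variable R : realType.
Implicit Types (v w u x y : vec R) (a b c : R[i]) (T : vec R -> vec R).

Lemma unitary_l2 T v : unitaryB T -> is_l2 v -> is_l2 (T v).
Proof. by case=> h _; exact: h. Qed.

Lemma unitary_B T v w : unitaryB T -> is_l2 v -> is_l2 w ->
  Bform (T v) (T w) = Bform v w.
Proof. by case=> _ [_ [_ h]]; exact: h. Qed.

Lemma unitary_lin T a v w : unitaryB T -> is_l2 v -> is_l2 w ->
  T (vadd (vscale a v) w) = vadd (vscale a (T v)) (T w).
Proof. by case=> _ [h _]; exact: h. Qed.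

Lemma unitary_surj T w : unitaryB T -> is_l2 w -> exists v, is_l2 v /\ T v = w.
Proof. by case=> _ [_ [h _]]; exact: h. Qed.

Lemma unitaryD T v w : unitaryB T -> is_l2 v -> is_l2 w ->
  T (vadd v w) = vadd (T v) (T w).
Proof. by move=> Tu v2 w2; have := unitary_lin 1 Tu v2 w2; rewrite !vscale1. Qed.

Lemma unitary0 T : unitaryB T -> T (vzero R) = vzero R.
Proof.
move=> Tu; have z2 := @l2_zero R; have := unitary_lin (-1) Tu z2 z2.
have -> : vadd (vscale (-1) (vzero R)) (vzero R) = vzero R.
  by apply/funext => n; rewrite /vadd /vscale /vzero; ring.
by move=> ->; apply/funext => n; rewrite /vadd /vscale /vzero; ring.
Qed.

Lemma unitaryZ T a v : unitaryB T -> is_l2 v -> T (vscale a v) = vscale a (T v).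
Proof.
move=> Tu v2; have := unitary_lin a Tu v2 (@l2_zero R).
by rewrite (unitary0 Tu) !vaddv0.
Qed.

Lemma unitaryB_sub T v w : unitaryB T -> is_l2 v -> is_l2 w ->
  T (vsub v w) = vsub (T v) (T w).
Proof. by move=> Tu v2 w2; rewrite !vsubE (unitaryD Tu) // (unitaryZ _ Tu). Qed.

Lemma unitary_inj T v w : unitaryB T -> is_l2 v -> is_l2 w -> T v = T w -> v = w.
Proof.
move=> Tu v2 w2 E.
suff : vsub v w = vzero R.
  by move=> h; apply/funext => n; have := congr1 (@^~ n) h; apply: subr0_eq.
apply: nondegenerate => // u u2; rewrite BformBl //.
by rewrite -(unitary_B Tu v2 u2) -(unitary_B Tu w2 u2) E subrr.
Qed.

Lemma unitary_same_line T v w : unitaryB T -> is_l2 w -> same_line v w ->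
  same_line (T v) (T w).
Proof. by move=> Tu w2 [a [a0 ->]]; exists a; rewrite (unitaryZ _ Tu). Qed.

Lemma unitary_isotropic T v : unitaryB T -> isotropic v -> isotropic (T v).
Proof.
move=> Tu [v2 [v0 vv]]; split; first exact: unitary_l2.
split; last by rewrite unitary_B.
move=> Tv; apply: v0; apply: (unitary_inj Tu) => //.
by rewrite unitary0.
Qed.

Lemma unitary_scale T c : unitaryB T -> cabs c = 1 ->
  unitaryB (fun v => vscale c (T v)).
Proof.
move=> Tu c1; split; first by move=> v v2; apply: l2_scale; exact: unitary_l2.
split.
  move=> a v w v2 w2; rewrite (unitary_lin a Tu) //.
  by apply/funext => n; rewrite /vscale /vadd; ring.
split.
  move=> w w2; have c0 := cabs1_neq0 c1.
  have [v [v2 Tv]] := unitary_surj Tu (@l2_scale _ c^-1 _ w2).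
  by exists v; split => //; rewrite Tv vscaleA divff // vscale1.
move=> v w v2 w2; have Tv2 := unitary_l2 Tu v2; have Tw2 := unitary_l2 Tu w2.
by rewrite BformZl // BformZr // mulrA cabs1_conj // mul1r unitary_B.
Qed.

Lemma unitary_qf T v : unitaryB T -> is_l2 v -> qf (T v) = qf v.
Proof. by move=> Tu v2; rewrite /qf unitary_B. Qed.

Lemma unitary_posvec T v : unitaryB T -> posvec v -> posvec (T v).
Proof.
by move=> Tu [v2 v0]; split; [exact: unitary_l2 | rewrite unitary_B].
Qed.

(* The l2 norm is hsq at ebase; T carries it to hsq at the positive vector T ebase. *)
Lemma unitary_bounded T : unitaryB T ->
  exists C : R, 0 < C /\ forall v, is_l2 v -> nsq (T v) <= C * nsq v.
Proof.
move=> Tu; have e2 := @l2_ebase R; have Te2 := unitary_l2 Tu e2.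
have Te1 : Bform (T (ebase R)) (T (ebase R)) = 1.
  by rewrite unitary_B // Bform_ebase1.
exists (2 * hsq (T (ebase R)) (ebase R) + 1); split.
  by have := hsq_ge0 Te2 Te1 e2; lra.
move=> v v2; have Tv2 := unitary_l2 Tu v2.
apply: le_trans (nsq_le_hsq Te2 Te1 Tv2) _.
by rewrite -(hsq_ebase v2) /hsq unitary_B // unitary_qf.
Qed.

End Unitary.

(** * The inverse hyperbolic cosine and the distance *)

Section HyperbolicDistance.
Variable R : realType.
Implicit Types (v w x y : vec R) (c : R[i]) (q s m t lam : R).

Definition acosh q : R := ln (q + Num.sqrt (q ^+ 2 - 1)).

Lemma acosh_arg_gt0 q : 1 <= q -> 0 < q + Num.sqrt (q ^+ 2 - 1).
Proof. by move=> q1; have := sqrtr_ge0 (q ^+ 2 - 1); lra. Qed.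

Lemma le_expR_acosh q : 1 <= q -> q <= expR (acosh q).
Proof.
move=> q1; rewrite /acosh lnK ?posrE ?acosh_arg_gt0 //.
by have := sqrtr_ge0 (q ^+ 2 - 1); lra.
Qed.

Lemma expR_acosh_le q : 1 <= q -> expR (acosh q) <= 2 * q.
Proof.
move=> q1; rewrite /acosh lnK ?posrE ?acosh_arg_gt0 //.
suff : Num.sqrt (q ^+ 2 - 1) <= q by lra.
rewrite -[leRHS]ger0_norm ?(le_trans ler01) // -sqrtr_sqr ler_sqrt ?sqr_ge0 //.
by rewrite lerBlDr lerDl ler01.
Qed.

Lemma acosh_ge0 q : 1 <= q -> 0 <= acosh q.
Proof.
by move=> q1; apply: ln_ge0; have := sqrtr_ge0 (q ^+ 2 - 1); lra.
Qed.

Lemma acosh_le q s : 1 <= q -> q <= s -> acosh q <= acosh s.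
Proof.
move=> q1 qs; have s1 := le_trans q1 qs.
rewrite /acosh ler_ln ?posrE ?acosh_arg_gt0 //; apply: lerD => //.
rewrite ler_sqrt; last by rewrite subr_ge0 expr_ge1 // (le_trans ler01).
rewrite lerD2r ler_pXn2r ?nnegrE ?(le_trans ler01) //.
Qed.

Lemma acosh_expR m : 0 < m -> acosh ((m + m^-1) / 2) = `|ln m|.
Proof.
have key n : 1 <= n -> acosh ((n + n^-1) / 2) = ln n.
  move=> n1; have n0 : 0 < n by apply: lt_le_trans n1.
  have nn : n != 0 by rewrite gt_eqF.
  rewrite /acosh (_ : ((n + n^-1) / 2) ^+ 2 - 1 = ((n - n^-1) / 2) ^+ 2); last by field.
  rewrite sqrtr_sqr ger0_norm; first by congr ln; field.
  by rewrite divr_ge0 // subr_ge0; apply: le_trans (n1); rewrite invf_le1.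
move=> m0; have [m1|m1] := leP 1 m; first by rewrite key // ger0_norm // ln_ge0.
have := key m^-1; rewrite invrK addrC lnV ?posrE // => ->.
  by rewrite ler0_norm // ln_le0 // ltW.
by rewrite invf_ge1 // ltW.
Qed.

Lemma hdistE v w : hdist v w = acosh (coshd v w).
Proof. by []. Qed.

Lemma coshd_ge1 v w : posvec v -> posvec w -> 1 <= coshd v w.
Proof.
move=> [v2 v0] [w2 w0].
have h : 0 < qf v * qf w by exact: mulr_gt0.
rewrite /coshd ler_pdivlMr ?sqrtr_gt0 // mul1r ler_sqrt ?csq_ge0 //.
by have := reverse_CS v2 w2 v0; apply.
Qed.

End HyperbolicDistance.

(** * The group SU(1,1) *)

Section SU11.
Variable R : realType.
Implicit Types (a b c d : R[i]) (l x y : R) (M N : 'M[R[i]]_2).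

Definition su a b : 'M[R[i]]_2 :=
  \matrix_(i, j) (if val i == 0%N then (if val j == 0%N then a else b)
                  else (if val j == 0%N then cconj b else cconj a)).

Lemma mx2P M N : M ord0 ord0 = N ord0 ord0 -> M ord0 ord_max = N ord0 ord_max ->
  M ord_max ord0 = N ord_max ord0 -> M ord_max ord_max = N ord_max ord_max ->
  M = N.
Proof.
move=> h1 h2 h3 h4; apply/matrixP => i j.
have o (k : 'I_2) : k = ord0 \/ k = ord_max.
  by case: k => [[|[|k]] kl] //; [left | right]; exact: val_inj.
by case: (o i) => ->; case: (o j) => ->.
Qed.

Lemma mulmx2 M N i j :
  (M *m N) i j = M i ord0 * N ord0 j + M i ord_max * N ord_max j.
Proof.
rewrite !mxE !big_ord_recl big_ord0 addr0; congr (_ + M i _ * N _ j).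
  exact: val_inj.
exact: val_inj.
Qed.

Lemma su00 a b : su a b ord0 ord0 = a. Proof. by rewrite mxE. Qed.
Lemma su01 a b : su a b ord0 ord_max = b. Proof. by rewrite mxE. Qed.
Lemma su10 a b : su a b ord_max ord0 = cconj b. Proof. by rewrite mxE. Qed.
Lemma su11 a b : su a b ord_max ord_max = cconj a. Proof. by rewrite mxE. Qed.
Definition suE := (su00, su01, su10, su11).

Lemma su_eq a b c d : a = c -> b = d -> su a b = su c d.
Proof. by move=> -> ->. Qed.

Lemma su_mul a b c d :
  su a b * su c d = su (a * c + b * cconj d) (a * d + b * cconj c).
Proof.
by apply: mx2P; rewrite -mulmxE mulmx2 !suE ?cJ; ring.
Qed.

Lemma su1 : su 1 0 = 1.
Proof. by apply: mx2P; rewrite suE ?cJ !mxE. Qed.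

Lemma suN1 : su (-1) 0 = -1.
Proof. by apply: mx2P; rewrite suE ?cJ !mxE ?oppr0. Qed.

Lemma J2E : [/\ J2 R ord0 ord0 = 1, J2 R ord0 ord_max = 0,
  J2 R ord_max ord0 = 0 & J2 R ord_max ord_max = -1].
Proof. by split; rewrite mxE. Qed.

Lemma det2E M : \det M = M ord0 ord0 * M ord_max ord_max - M ord0 ord_max * M ord_max ord0.
Proof.
rewrite (expand_det_row _ ord0) !big_ord_recl big_ord0 /cofactor !det_mx11 !mxE.
have -> : lift ord0 ord0 = ord_max :> 'I_2 by exact: val_inj.
have -> : lift ord_max ord0 = ord0 :> 'I_2 by exact: val_inj.
by rewrite /= expr0 expr1; ring.
Qed.

Lemma SU11_form M i j : ((map_mx (@cconj R) M)^T *m J2 R *m M) i j =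
  cconj (M ord0 i) * M ord0 j - cconj (M ord_max i) * M ord_max j.
Proof.
have [j00 j01 j10 j11] := J2E.
by rewrite mulmx2 !mulmx2 j00 j01 j10 j11 !mxE; ring.
Qed.

Lemma isSU11_su a b : csq a - csq b = 1 -> isSU11 (su a b).
Proof.
move=> h; have [j00 j01 j10 j11] := J2E.
have e : a * cconj a - b * cconj b = 1.
  by rewrite !mul_conj -[RHS]rC1 -h rCD rCN.
split; last by rewrite det2E !suE.
apply: mx2P; rewrite SU11_form !suE ?cJ ?j00 ?j01 ?j10 ?j11; try ring.
  by rewrite -[RHS]e; ring.
by rewrite -[in RHS]e; ring.
Qed.

(** For M with rows (p, q) and (r, s), multiply conj p and conj r by det M = 1 and insert the (0,0)
    and (0,1) entries of the form relation: this yields s = conj p and r = conj q. *)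
Lemma SU11_su M : isSU11 M -> exists a b, M = su a b /\ csq a - csq b = 1.
Proof.
move=> [f d]; have [j00 j01 j10 j11] := J2E.
have f00 := congr1 (fun N : 'M[R[i]]_2 => N ord0 ord0) f.
have f01 := congr1 (fun N : 'M[R[i]]_2 => N ord0 ord_max) f.
rewrite /= !SU11_form j00 in f00; rewrite /= !SU11_form j01 in f01.
rewrite det2E in d.
move: f00 f01 d; set p := M ord0 ord0; set q := M ord0 ord_max.
set r := M ord_max ord0; set s := M ord_max ord_max => f00 f01 d.
have sp : s = cconj p.
  rewrite -[RHS]mulr1 -d.
  have -> : cconj p * (p * s - q * r) = (cconj p * p - cconj r * r) * s
     - r * (cconj p * q - cconj r * s) by ring.
  by rewrite f00 f01; ring.
have rq : r = cconj q.
  apply: (can_inj (@cconjK R)); rewrite cconjK -[LHS]mulr1 -d.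
  have -> : cconj r * (p * s - q * r) = (cconj p * p - cconj r * r) * q
     - p * (cconj p * q - cconj r * s) by ring.
  by rewrite f00 f01; ring.
exists p, q; split; first by apply: mx2P; rewrite suE.
apply: (@rC_inj R); rewrite rCD rCN -!mul_conj rC1 -d sp rq; ring.
Qed.

Lemma SU11_mul M N : isSU11 M -> isSU11 N -> isSU11 (M * N).
Proof.
move=> /SU11_su[a [b [-> h]]] /SU11_su[c [d [-> k]]]; rewrite su_mul.
apply: isSU11_su; rewrite -[RHS]mulr1 -{1}h -k /csq !cE; ring.
Qed.

Lemma SU11_N1 : isSU11 (-1 : 'M[R[i]]_2).
Proof. by rewrite -suN1; apply: isSU11_su; rewrite csqN csq1 csq0 subr0. Qed.

Lemma SU11_1 : isSU11 (1 : 'M[R[i]]_2).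
Proof. by rewrite -su1; apply: isSU11_su; rewrite csq1 csq0 subr0. Qed.

Lemma gmatE l x : gmat l x =
  su (Complex ((l + l^-1) / 2) (x / 2)) (Complex ((l - l^-1) / 2) (- x / 2)).
Proof.
have half (z : R[i]) : z / 2 = z * rC 2^-1.
  by rewrite rCV; congr (_ / _); apply: ceqP; rewrite ?cE /=; rewrite ?addr0.
by apply: mx2P; rewrite suE mxE /= half; apply: ceqP; rewrite ?cE /=;
  move: (l^-1) => k; field.
Qed.

Lemma gmatM l x l' x' : l != 0 -> l' != 0 ->
  gmat l x * gmat l' x' = gmat (l * l') (l * x' + x / l').
Proof.
move=> l0 l0'; rewrite !gmatE su_mul.
by apply: su_eq; apply: ceqP; rewrite ?cE /=; field; rewrite ?l0 ?l0'.
Qed.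

Lemma gmat_SU11 l x : l != 0 -> isSU11 (gmat l x).
Proof.
by move=> l0; rewrite gmatE; apply: isSU11_su; rewrite /csq /=; field.
Qed.

Lemma gmat1 : gmat (1 : R) 0 = 1.
Proof.
rewrite gmatE -su1.
by apply: su_eq; apply: ceqP; rewrite ?cE /= ?invr1; field.
Qed.

Lemma gmatN l x : l != 0 -> gmat (- l) (- x) = -1 * gmat l x.
Proof.
move=> l0; rewrite !gmatE -suN1 su_mul.
by apply: su_eq; apply: ceqP; rewrite ?cE /=; field; rewrite ?oppr_eq0.
Qed.

(** The matrix diag(i, -i) sends xi1 to i xi2 and xi2 to i xi1: it exchanges the endpoints of the
    axis of the g(l,0) and hence inverts that subgroup. *)
Definition weyl := su (iC R) 0.

Lemma weyl_SU11 : isSU11 weyl.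
Proof. by apply: isSU11_su; rewrite /csq !cE; ring. Qed.

Lemma weyl_sqr : weyl * weyl = -1.
Proof.
rewrite su_mul -suN1; apply: su_eq; apply: ceqP; rewrite !cE; ring.
Qed.

Lemma weyl_gmat l : l != 0 -> weyl * gmat l 0 = gmat l^-1 0 * weyl.
Proof.
move=> l0; rewrite !gmatE !su_mul.
by apply: su_eq; apply: ceqP; rewrite ?cE /=; field.
Qed.

(** In the basis (xi1, xi2) the left side is the matrix with rows (r, i(1 - r t)/s) and (i s, t),
    the general element with nonzero lower left entry. *)
Lemma su_bigcell (r s t : R) : s != 0 ->
  su (Complex ((r + t) / 2) ((s + (1 - r * t) / s) / 2))
     (Complex ((r - t) / 2) ((s - (1 - r * t) / s) / 2)) =
  gmat 1 (- r / s) * weyl * gmat s (- t).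
Proof.
move=> s0; rewrite !gmatE !su_mul invr1.
by apply: su_eq; apply: ceqP; rewrite ?cE /=; field.
Qed.

Lemma bruhat M : isSU11 M ->
  (exists l x, l != 0 /\ M = gmat l x) \/
  (exists y l x, l != 0 /\ M = gmat 1 y * weyl * gmat l x).
Proof.
move=> /SU11_su[[a1 a2] [[b1 b2] [->]]]; rewrite /csq /= => h.
(* In the basis (xi1, xi2) the rows are (a1 + b1, i(a2 - b2)) and (i(a2 + b2), a1 - b1). The test
   asks whether the line of xi1 is fixed, and the witnesses in both cases are read off from these
   entries. *)
have [c0|c0] := eqVneq (a2 + b2) 0.
  left; exists (a1 + b1), (a2 - b2).
  have hh : (a1 + b1) * (a1 - b1) = 1.
    by rewrite -h; have -> : b2 = - a2; [lra | ring].
  have n0 : a1 + b1 != 0.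
    by apply/eqP => e; move: hh; rewrite e mul0r => /eqP; rewrite eq_sym oner_eq0.
  have iv : (a1 + b1)^-1 = a1 - b1.
    by apply: (mulfI n0); rewrite hh divff.
  split => //; rewrite gmatE iv.
  by apply: su_eq; apply: ceqP => /=; lra.
right; exists (- (a1 + b1) / (a2 + b2)), (a2 + b2), (- (a1 - b1)); split => //.
have key : (1 - (a1 + b1) * (a1 - b1)) / (a2 + b2) = a2 - b2.
  by apply: (mulIf c0); rewrite mulfVK // -h; ring.
rewrite -su_bigcell // key.
by apply: su_eq; apply: ceqP => /=; field.
Qed.

(** The Bruhat decomposition as an induction principle; a negative l is reduced to a positive one by
    the factor -1. *)
Lemma SU11_ind (P : 'M[R[i]]_2 -> Prop) :
  (forall l x, 0 < l -> P (gmat l x)) -> P weyl -> P (-1) ->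
  (forall M N, isSU11 M -> isSU11 N -> P M -> P N -> P (M * N)) ->
  forall M, isSU11 M -> P M.
Proof.
move=> Pg Pw P1 PM M.
have Pg' l x : l != 0 -> P (gmat l x).
  move=> l0; have [lp|ln|e] := ltrgt0P l; first exact: Pg.
    rewrite -[l]opprK -[x]opprK gmatN ?oppr_eq0 //.
    apply: PM => //; [exact: SU11_N1 | | ].
      by apply: gmat_SU11; rewrite oppr_eq0.
    by apply: Pg; rewrite oppr_gt0.
  by rewrite e eqxx in l0.
case/bruhat => [[l [x [l0 ->]]]|[y [l [x [l0 ->]]]]]; first exact: Pg'.
have o0 : (1 : R) != 0 by rewrite oner_neq0.
have s1 := gmat_SU11 y o0; have s2 := gmat_SU11 x l0; have s3 := weyl_SU11.
apply: (PM) => //; [exact: SU11_mul | | exact: Pg'].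
by apply: PM => //; exact: Pg'.
Qed.

Lemma mxdist_gmat1 x : mxdist (gmat 1 x) (gmat 1 0) = 2 * `|x|.
Proof.
have e (s : R) (z : R[i]) : z = Complex 0 (s * (x / 2)) -> `|s| = 1 -> cabs z = `|x| / 2.
  move=> -> s1; have -> : Complex 0 (s * (x / 2)) = iC R * rC (s * (x / 2)).
    by apply: ceqP; rewrite !cE /=; ring.
  rewrite cabsM cabsR !normrM s1 mul1r (ger0_norm (_ : 0 <= 2^-1)) ?invr_ge0 //.
  by rewrite csq1_cabs ?mul1r // /csq !cE; ring.
have h i j : cabs (gmat 1 x i j - gmat 1 0 i j) = `|x| / 2.
  have o (k : 'I_2) : k = ord0 \/ k = ord_max.
    by case: k => [[|[|k]] kl] //; [left | right]; exact: val_inj.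
  rewrite !gmatE; case: (o i) => ->; case: (o j) => ->; rewrite !suE.
  - by apply: (e 1); [apply: ceqP; rewrite ?cE /=; ring | rewrite normr1].
  - by apply: (e (-1)); [apply: ceqP; rewrite ?cE /=; ring | rewrite normrN1].
  - by apply: (e 1); [apply: ceqP; rewrite ?cE /=; ring | rewrite normr1].
  - by apply: (e (-1)); [apply: ceqP; rewrite ?cE /=; ring | rewrite normrN1].
by rewrite /mxdist !big_ord_recl !big_ord0 !h; field.
Qed.

End SU11.

(* Sealed against the costly unfolding of matrix entries during conversion. *)
HB.lock Definition gm (R : realType) (l x : R) : 'M[R[i]]_2 := gmat l x.
HB.lock Definition wm (R : realType) : 'M[R[i]]_2 := weyl R.

Section SealedMatrices.
Variable R : realType.
Implicit Types (l x y : R).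

Lemma gmE l x : gm l x = gmat l x. Proof. by rewrite gm.unlock. Qed.

Lemma gmM l x l' x' : l != 0 -> l' != 0 ->
  gm l x * gm l' x' = gm (l * l') (l * x' + x / l').
Proof. by rewrite !gmE; exact: gmatM. Qed.

Lemma gm_SU11 l x : l != 0 -> isSU11 (gm l x).
Proof. by rewrite gmE; exact: gmat_SU11. Qed.

Lemma mxdist_gm1 x : mxdist (gm 1 x) (gm 1 0) = 2 * `|x|.
Proof. by rewrite !gmE mxdist_gmat1. Qed.

Lemma gm1 : gm (1 : R) 0 = 1. Proof. by rewrite gmE gmat1. Qed.

Lemma gmN l x : l != 0 -> gm (- l) (- x) = -1 * gm l x.
Proof. by rewrite !gmE; exact: gmatN. Qed.

Lemma wm_SU11 : isSU11 (wm R). Proof. by rewrite wm.unlock; exact: weyl_SU11. Qed.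

Lemma wm_sqr : wm R * wm R = -1. Proof. by rewrite wm.unlock; exact: weyl_sqr. Qed.

Lemma wm_gm l : l != 0 -> wm R * gm l 0 = gm l^-1 0 * wm R.
Proof. by rewrite !gmE wm.unlock; exact: weyl_gmat. Qed.

Lemma bruhat_gm (M : 'M[R[i]]_2) : isSU11 M ->
  (exists l x, l != 0 /\ M = gm l x) \/
  (exists y l x, l != 0 /\ M = gm 1 y * wm R * gm l x).
Proof.
case/bruhat => [[l [x [l0 ->]]]|[y [l [x [l0 ->]]]]]; [left|right].
  by exists l, x; rewrite gmE.
by exists y, l, x; rewrite !gmE wm.unlock.
Qed.

Lemma gm_ind (P : 'M[R[i]]_2 -> Prop) :
  (forall l x, 0 < l -> P (gm l x)) -> P (wm R) -> P (-1) ->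
  (forall M N, isSU11 M -> isSU11 N -> P M -> P N -> P (M * N)) ->
  forall M, isSU11 M -> P M.
Proof.
move=> Pg; rewrite wm.unlock; apply: SU11_ind => l x.
by rewrite -gmE; exact: Pg.
Qed.

Lemma gm1D x y : gm 1 (x + y) = gm 1 x * gm 1 y.
Proof. by rewrite gmM ?oner_neq0 // !mul1r divr1 addrC. Qed.

Lemma gm_conj l x : 0 < l -> gm l 0 * gm 1 x = gm 1 (l ^+ 2 * x) * gm l 0.
Proof.
move=> l0; have ln : l != 0 by rewrite gt_eqF.
by rewrite !gmM ?oner_neq0 //; congr gm; field.
Qed.

End SealedMatrices.

(** * The parabolic subgroup in a representation *)

Section ProjectiveRep.
Variables (R : realType) (rho : 'M[R[i]]_2 -> vec R -> vec R).
Hypothesis rep : is_rep rho.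
Implicit Types (v w u : vec R) (g h : 'M[R[i]]_2) (l x y : R).

Lemma rep_unitary g : isSU11 g -> unitaryB (rho g).
Proof. by case: rep => h _; exact: h. Qed.

Lemma rep_mul g h : isSU11 g -> isSU11 h -> exists c : R[i], cabs c = 1 /\
  forall v, is_l2 v -> rho (g * h) v = vscale c (rho g (rho h v)).
Proof. by case: rep => _ [h' _]; exact: h'. Qed.

Lemma rep_l2 g v : isSU11 g -> is_l2 v -> is_l2 (rho g v).
Proof. by move=> /rep_unitary gu; exact: unitary_l2. Qed.

Lemma rep_N1 : exists c : R[i], cabs c = 1 /\
  forall v, is_l2 v -> rho (-1) v = vscale c v.
Proof. by case: rep => _ [_ [h _]]. Qed.

Lemma rep_1 : exists c : R[i], cabs c = 1 /\
  forall v, is_l2 v -> rho 1 v = vscale c v.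
Proof.
have [c [c1 hc]] := rep_mul (SU11_N1 R) (SU11_N1 R).
have [d [d1 hd]] := rep_N1.
exists (c * (d * d)); split; first by rewrite !cabsM c1 d1 !mulr1.
move=> v v2; have := hc v v2; rewrite mulrNN mulr1 => ->.
by rewrite !hd // !vscaleA mulrA.
Qed.

Lemma rep_line_mul g h v : isSU11 g -> isSU11 h -> is_l2 v ->
  same_line (rho (g * h) v) (rho g (rho h v)).
Proof.
move=> gS hS v2; have [c [c1 ->]] := rep_mul gS hS; last by [].
exact/same_line_scale/cabs1_neq0.
Qed.

(** The form in which commutation relations of the group are used: the phases of the two lifted
    products combine into a single one, independent of the vector. *)
Lemma rep_comm g h g' h' : isSU11 g -> isSU11 h -> isSU11 g' -> isSU11 h' ->
  g * h = g' * h' -> exists c : R[i], cabs c = 1 /\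
  forall v, is_l2 v -> rho g (rho h v) = vscale c (rho g' (rho h' v)).
Proof.
move=> gS hS gS' hS' e; have [c [c1 hc]] := rep_mul gS hS.
have [d [d1 hd]] := rep_mul gS' hS'.
exists (c^-1 * d); split; first by rewrite cabsM cabsV c1 d1 invr1 mulr1.
move=> v v2; rewrite -vscaleA -hd // -e hc // vscaleA mulVf ?vscale1 //.
exact: cabs1_neq0.
Qed.

End ProjectiveRep.

(** The geometric part of [has_arg]: the pair of boundary representatives, separated from the choice
    of a lift and of the component c. *)
Definition parabolic_frame (R : realType) (rho : 'M[R[i]]_2 -> vec R -> vec R)
    (eta1 eta2 : vec R) : Prop :=
  [/\ isotropic eta1, isotropic eta2, Bform eta1 eta2 = 1,
   (forall l x : R, 0 < l -> same_line (rho (gm l x) eta1) eta1) &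
   (forall l : R, 0 < l -> same_line (rho (gm l 0) eta2) eta2)].

(* Eigenvalues at e1 of rho(g(1,x)) and rho(g(l,0)); unip_of x is the lift T_x
   fixing e1, V_of x = T_x e2, and K_of is the function K of the paper.  They
   are sealed for the same reason as gm. *)
HB.lock Definition nu_of (R : realType) (rho : 'M[R[i]]_2 -> vec R -> vec R) (e1 e2 : vec R) (x : R) : R[i] := Bform (rho (gm 1 x) e1) e2.
HB.lock Definition mu_of (R : realType) (rho : 'M[R[i]]_2 -> vec R -> vec R) (e1 e2 : vec R) (l : R) : R[i] := Bform (rho (gm l 0) e1) e2.
HB.lock Definition unip_of (R : realType) (rho : 'M[R[i]]_2 -> vec R -> vec R) (e1 e2 : vec R) (x : R) (v : vec R) : vec R :=
  vscale (nu_of rho e1 e2 x)^-1 (rho (gm 1 x) v).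
HB.lock Definition V_of (R : realType) (rho : 'M[R[i]]_2 -> vec R -> vec R) (e1 e2 : vec R) (x : R) : vec R := unip_of rho e1 e2 x e2.
HB.lock Definition K_of (R : realType) (rho : 'M[R[i]]_2 -> vec R -> vec R) (e1 e2 : vec R) (x : R) : R[i] := Bform (V_of rho e1 e2 x) e2.

Section Frame.
Variables (R : realType) (rho : 'M[R[i]]_2 -> vec R -> vec R).
Variables (eta1 eta2 : vec R).
Hypotheses (rep : is_rep rho) (frame : parabolic_frame rho eta1 eta2).
Implicit Types (v w u : vec R) (g h : 'M[R[i]]_2) (l x y : R).

Local Notation nu := (nu_of rho eta1 eta2).
Local Notation mu := (mu_of rho eta1 eta2).
Local Notation unip := (unip_of rho eta1 eta2).
Local Notation V := (V_of rho eta1 eta2).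
Local Notation K := (K_of rho eta1 eta2).

Lemma nuE x : nu x = Bform (rho (gm 1 x) eta1) eta2.
Proof. by rewrite nu_of.unlock. Qed.
Lemma muE l : mu l = Bform (rho (gm l 0) eta1) eta2.
Proof. by rewrite mu_of.unlock. Qed.
Lemma unipE x v : unip x v = vscale (nu x)^-1 (rho (gm 1 x) v).
Proof. by rewrite unip_of.unlock. Qed.
Lemma VE x : V x = unip x eta2. Proof. by rewrite V_of.unlock. Qed.
Lemma KE x : K x = Bform (V x) eta2. Proof. by rewrite K_of.unlock. Qed.

Let n10 : (1 : R) != 0. Proof. exact: oner_neq0. Qed.

Lemma frame_iso1 : isotropic eta1. Proof. by case: frame. Qed.
Lemma frame_iso2 : isotropic eta2. Proof. by case: frame. Qed.
Lemma frame_l2_1 : is_l2 eta1. Proof. by case: frame_iso1. Qed.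
Lemma frame_l2_2 : is_l2 eta2. Proof. by case: frame_iso2. Qed.
Lemma frame_B11 : Bform eta1 eta1 = 0. Proof. by case: frame_iso1 => _ []. Qed.
Lemma frame_B22 : Bform eta2 eta2 = 0. Proof. by case: frame_iso2 => _ []. Qed.
Lemma frame_B12 : Bform eta1 eta2 = 1. Proof. by case: frame. Qed.
Let f2_1 := frame_l2_1.
Let f2_2 := frame_l2_2.
Lemma frame_B21 : Bform eta2 eta1 = 1.
Proof. by rewrite (BformC f2_1 f2_2) frame_B12 cconj1. Qed.

Lemma frame_line1 u : same_line u eta1 ->
  u = vscale (Bform u eta2) eta1 /\ Bform u eta2 != 0.
Proof. by move=> [a [a0 ->]]; rewrite BformZl // frame_B12 mulr1. Qed.

Lemma frame_inj (a b : R[i]) : vscale a eta1 = vscale b eta1 -> a = b.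
Proof.
move=> e; have := congr1 (fun v : vec R => Bform v eta2) e.
by rewrite !BformZl // frame_B12 !mulr1.
Qed.


Let nS x : isSU11 (gm 1 x). Proof. exact: gm_SU11. Qed.
Let aS l : 0 < l -> isSU11 (gm l 0).
Proof. by move=> l0; apply: gm_SU11; rewrite gt_eqF. Qed.

Lemma nuP x : rho (gm 1 x) eta1 = vscale (nu x) eta1 /\ nu x != 0.
Proof. by rewrite nuE; apply: frame_line1; case: frame => _ _ _ + _; apply. Qed.

Lemma muP l : 0 < l -> rho (gm l 0) eta1 = vscale (mu l) eta1 /\ mu l != 0.
Proof. by move=> l0; rewrite muE; apply: frame_line1; case: frame => _ _ _ + _; apply. Qed.

Lemma mu_1 : cabs (mu 1) = 1.
Proof.
have [c [c1 hc]] := rep_1 rep.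
by rewrite muE gm1 hc // BformZl // frame_B12 mulr1.
Qed.

(** Invariance of B(eta1, eta2) = 1 ties the eigenvalue at eta2 to the one at eta1. *)
Lemma mu2P l : 0 < l -> rho (gm l 0) eta2 = vscale (cconj (mu l))^-1 eta2.
Proof.
move=> l0; have [e1 m0] := muP l0.
case: frame => _ _ _ _ /(_ l l0)[a [a0 e2]].
rewrite e2; congr vscale; have := unitary_B (rep_unitary rep (aS l0)) f2_1 f2_2.
rewrite e1 e2 BformZl // BformZr // frame_B12 mulr1 => h.
have m0' : cconj (mu l) != 0 by rewrite cconj_eq0.
apply: (mulfI m0'); rewrite divff //.
by apply: (can_inj (@cconjK R)); rewrite !cJ.
Qed.

Lemma mu_mul l l' : 0 < l -> 0 < l' -> cabs (mu (l * l')) = cabs (mu l) * cabs (mu l').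
Proof.
move=> l0 l0'; have [c [c1 hc]] := rep_mul rep (aS l0) (aS l0').
move: (hc _ f2_1); rewrite gmM ?gt_eqF // mulr0 mul0r addr0.
have [e1 m1] := muP l0; have [e2 m2] := muP l0'; have [e3 m3] := muP (mulr_gt0 l0 l0').
rewrite e3 e2 (unitaryZ _ (rep_unitary rep (aS l0))) // e1 !vscaleA => /frame_inj ->.
by rewrite !cabsM c1 mul1r mulrC.
Qed.

Lemma mu_inv l : 0 < l -> cabs (mu l^-1) = (cabs (mu l))^-1.
Proof.
move=> l0; have li : 0 < l^-1 by rewrite invr_gt0.
have [_ m0] := muP l0; have cm0 : cabs (mu l) != 0 by rewrite cabs_eq0.
by apply: (mulfI cm0); rewrite -mu_mul // !divff ?mu_1 // gt_eqF.
Qed.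

Lemma nuD x y : cabs (nu (x + y)) = cabs (nu x) * cabs (nu y).
Proof.
have [c [c1 hc]] := rep_mul rep (nS x) (nS y).
move: (hc _ f2_1); rewrite -gm1D.
have [e1 m1] := nuP x; have [e2 m2] := nuP y; have [e3 m3] := nuP (x + y).
rewrite e3 e2 (unitaryZ _ (rep_unitary rep (nS x))) // e1 !vscaleA => /frame_inj ->.
by rewrite !cabsM c1 mul1r mulrC.
Qed.

Lemma nu_conj l x : 0 < l -> cabs (nu (l ^+ 2 * x)) = cabs (nu x).
Proof.
move=> l0.
have [c [c1 hc]] := rep_comm rep (aS l0) (nS x) (nS (l ^+ 2 * x)) (aS l0) (gm_conj x l0).
have [e1 m1] := muP l0; have [e2 m2] := nuP x; have [e3 m3] := nuP (l ^+ 2 * x).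
move: (hc _ f2_1); rewrite e2 e1 (unitaryZ _ (rep_unitary rep (aS l0))) //.
rewrite (unitaryZ _ (rep_unitary rep (nS (l ^+ 2 * x)))) // e1 e3.
rewrite !vscaleA => /frame_inj /(congr1 (@cabs R)); rewrite !cabsM c1 mul1r mulrC => h.
by apply: (mulfI (_ : cabs (mu l) != 0)); rewrite ?cabs_eq0.
Qed.

(* Conjugation by g(2,0) sends g(1,x) to g(1,x)^4, whence |nu x| = |nu x|^4. *)
Lemma nu_unit x : cabs (nu x) = 1.
Proof.
have h := nu_conj x (ltr0n R 2 : 0 < 2%:R).
have e : 2%:R ^+ 2 * x = (x + x) + (x + x) by ring.
move: h; rewrite e !nuD => h.
have p : 0 < cabs (nu x) by rewrite cabs_gt0; case: (nuP x).
set n := cabs (nu x) in h p *.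
have h3 : n ^+ 3 = 1.
  by apply: (mulfI (_ : n != 0)); [rewrite gt_eqF | rewrite mulr1 -[RHS]h; ring].
by apply/eqP; rewrite -(@pexpr_eq1 _ n 3) ?ltW // h3.
Qed.


Lemma unip_unitary x : unitaryB (unip x).
Proof.
rewrite (_ : unip x = fun v => vscale (nu x)^-1 (rho (gm 1 x) v)).
  apply: unitary_scale; first exact: rep_unitary.
  by rewrite cabsV nu_unit invr1.
by apply/funext => v; rewrite unipE.
Qed.

Lemma unip_eta1 x : unip x eta1 = eta1.
Proof. by rewrite unipE; have [-> n0] := nuP x; rewrite vscaleA mulVf // vscale1. Qed.

Lemma unip_l2 x v : is_l2 v -> is_l2 (unip x v).
Proof. exact/unitary_l2/unip_unitary. Qed.

(** Both sides lift the same isometry, so they differ by a scalar d independent of v. Both fix eta1,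
    so d = 1. The explicit formula for d in [E] guarantees that the same scalar occurs at eta1 and
    at v. *)
Lemma unipD x y v : is_l2 v -> unip (x + y) v = unip x (unip y v).
Proof.
move=> v2; have [c [c1 hc]] := rep_mul rep (nS x) (nS y).
have E u : is_l2 u -> exists d : R[i], d = (nu (x + y))^-1 * c * nu x * nu y /\
    unip (x + y) u = vscale d (unip x (unip y u)).
  move=> u2; eexists; split; first by [].
  have r2 : is_l2 (rho (gm 1 y) u) by apply: rep_l2.
  rewrite !unipE (unitaryZ _ (rep_unitary rep (nS x))) //.
  rewrite gm1D hc // !vscaleA; congr vscale.
  by have [_ nx] := nuP x; have [_ ny] := nuP y; have [_ nxy] := nuP (x + y);
    field; rewrite nx ny nxy.
have [d [de hd]] := E _ f2_1; have [d' [de' ->]] := E _ v2.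
move: hd; rewrite !unip_eta1 -{1}[eta1]vscale1 => /frame_inj.
by rewrite de -de' => <-; rewrite vscale1.
Qed.

Lemma unip0 v : is_l2 v -> unip 0 v = v.
Proof.
move=> v2; apply: (unitary_inj (unip_unitary 0)) => //; first exact: unip_l2.
by rewrite -unipD // addr0.
Qed.


Lemma V_l2 x : is_l2 (V x). Proof. by rewrite VE; exact: unip_l2. Qed.
#[local] Arguments V_l2 : clear implicits.

Lemma V_isotropic x : isotropic (V x).
Proof. by rewrite VE; exact: (unitary_isotropic (unip_unitary x)) frame_iso2. Qed.

Lemma V0 : V 0 = eta2. Proof. by rewrite VE; exact: unip0. Qed.

Lemma unip_V x y : unip x (V y) = V (x + y).
Proof. by rewrite !VE unipD. Qed.

Lemma V_eta1 x : Bform (V x) eta1 = 1.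
Proof.
by rewrite VE -[in X in Bform _ X](unip_eta1 x) (unitary_B (unip_unitary x)) // frame_B21.
Qed.

(** The unitary map [unip y] carries the pair (V (x - y), eta2) to (V x, V y). *)
Lemma V_V x y : Bform (V x) (V y) = K (x - y).
Proof.
have -> : V x = unip y (V (x - y)) by rewrite unip_V addrC subrK.
rewrite [V y]VE (unitary_B (unip_unitary y)) ?KE //; exact: V_l2.
Qed.

Lemma K0 : K 0 = 0. Proof. by rewrite KE V0 frame_B22. Qed.

Lemma KN x : K (- x) = cconj (K x).
Proof.
have V2 := V_l2 x; rewrite [K x]KE -(BformC V2 f2_2).
by rewrite -[- x]sub0r -V_V V0.
Qed.

(** The vector w is the component c(x) of V x orthogonal to eta1 and eta2, so its form is
    nonpositive; as V x is isotropic, this form equals -2 Re K x. *)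
Lemma Re_K_ge0 x : 0 <= cRe (K x).
Proof.
have [s2 qs] := isotropic_sum_qf frame_iso1 frame_iso2 frame_B12.
have V2 := V_l2 x.
pose w := vsub (V x) (vadd (vscale (K x) eta1) eta2).
have w2 : is_l2 w by rewrite /w.
have w1 : Bform w eta1 = 0.
  by rewrite /w BformBl // BformDl // BformZl // V_eta1 frame_B11 frame_B21; ring.
have w2' : Bform w eta2 = 0.
  by rewrite /w BformBl // BformDl // BformZl // frame_B12 frame_B22 KE; ring.
have [] := orth_pos s2 w2 _ (_ : Bform w (vadd eta1 eta2) = 0).
- by rewrite qs.
- by rewrite BformDr // w1 w2' addr0.
move=> + _; rewrite /qf {2}/w BformBr // BformDr // BformZr // w1 w2'.
rewrite /w BformBl // BformDl // BformZl // (BformC V2 f2_1) (BformC V2 f2_2).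
have [_ [_ ->]] := V_isotropic x; rewrite V_eta1 -KE !cE; lra.
Qed.

(** Conjugating [unip x] by rho(g(l,0)) gives [unip (l ^+ 2 * x)] up to one scalar, which evaluation
    at eta1 shows to be 1; the factor left over is the eigenvalue at eta2. *)
Lemma V_scale l x : 0 < l ->
  rho (gm l 0) (V x) = vscale (cconj (mu l))^-1 (V (l ^+ 2 * x)).
Proof.
move=> l0; have [c [c1 hc]] :=
  rep_comm rep (aS l0) (nS x) (nS (l ^+ 2 * x)) (aS l0) (gm_conj x l0).
rewrite VE; have [e1 m1] := muP l0; have [_ nx] := nuP x; have [_ ny] := nuP (l ^+ 2 * x).
have Au := rep_unitary rep (aS l0).
have E u : is_l2 u -> exists d : R[i], d = (nu x)^-1 * c * nu (l ^+ 2 * x) /\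
    rho (gm l 0) (unip x u) = vscale d (unip (l ^+ 2 * x) (rho (gm l 0) u)).
  move=> u2; eexists; split; first by [].
  have r2 : is_l2 (rho (gm 1 x) u) by apply: rep_l2.
  rewrite !unipE (unitaryZ _ Au) // hc // !vscaleA; congr vscale.
  by field; rewrite nx ny.
have [d [de hd]] := E _ f2_1; have [d' [de' ->]] := E _ f2_2.
move: hd; rewrite unip_eta1 e1 (unitaryZ _ (unip_unitary _)) // unip_eta1.
rewrite vscaleA => /frame_inj; rewrite de -de' => h.
have -> : d' = 1 by apply: (mulIf m1); rewrite mul1r.
by rewrite vscale1 mu2P // (unitaryZ _ (unip_unitary _)) // -VE.
Qed.

Lemma K_scale l x : 0 < l -> K (l ^+ 2 * x) = rC (csq (mu l)) * K x.
Proof.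
move=> l0; have [e1 m1] := muP l0; have V2 := V_l2 x; have V2' := V_l2 (l ^+ 2 * x).
have mc : cconj (mu l) != 0 by rewrite cconj_eq0.
have := unitary_B (rep_unitary rep (aS l0)) V2 f2_2.
rewrite V_scale // mu2P // BformZl // BformZr // !cJ -mul_conj -!KE => <-.
by field; rewrite m1 mc.
Qed.

End Frame.
#[global] Arguments V_l2 {R rho eta1 eta2} rep frame x.

(** * Translation lengths *)

Section Displacement.
Variables (R : realType) (A : vec R -> vec R) (eta1 eta2 : vec R) (m : R[i]).
Hypotheses (Au : unitaryB A) (iso1 : isotropic eta1) (iso2 : isotropic eta2).
Hypotheses (B12 : Bform eta1 eta2 = 1) (m0 : m != 0).
Hypotheses (A1 : A eta1 = vscale m eta1).
Hypotheses (A2 : A eta2 = vscale (cconj m)^-1 eta2).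

Let M := cabs m.
Let M0 : 0 < M. Proof. by rewrite cabs_gt0. Qed.
Let l1 : is_l2 eta1. Proof. by case: iso1. Qed.
Let l2 : is_l2 eta2. Proof. by case: iso2. Qed.
Let B11 : Bform eta1 eta1 = 0. Proof. by case: iso1 => _ []. Qed.
Let B22 : Bform eta2 eta2 = 0. Proof. by case: iso2 => _ []. Qed.
Let B21 : Bform eta2 eta1 = 1. Proof. by rewrite (BformC l1 l2) B12 cconj1. Qed.

Let mV : (cconj m)^-1 = m * rC (M ^- 2).
Proof.
have mc : cconj m != 0 by rewrite cconj_eq0.
apply: (mulfI mc); rewrite divff // mulrA (mulrC _ m) mul_conj -rCM.
by rewrite -sqr_cabs divff // expf_neq0 // gt_eqF.
Qed.

(** B(A p, p) is m + (conj m)^-1 = m (1 + M^-2): both terms have the phase of m, so the moduli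
    add. *)
Lemma axis_displacement : posvec (vadd eta1 eta2) /\
  coshd (A (vadd eta1 eta2)) (vadd eta1 eta2) = (M + M^-1) / 2.
Proof.
have [s2 qs] := isotropic_sum_qf iso1 iso2 B12.
split; first by split => //; rewrite -/(qf _) qs ltr0n.
rewrite /coshd -!/(qf _) (unitary_qf Au) // qs.
rewrite (unitaryD Au) // A1 A2 BformDl // !BformDr // !BformZl // B11 B12 B21 B22.
rewrite !mulr0 !mulr1 add0r addr0 mV -[X in X + _]mulr1 -mulrDr -rC1 -rCD.
rewrite cabsM cabsR -/M ger0_norm; last first.
  by rewrite addr_ge0 // invr_ge0 exprn_ge0 // ltW.
rewrite (_ : 2 * 2 = 2 ^+ 2 :> R) // sqrtr_sqr ger0_norm ?ler0n //.
by congr (_ / _); field; rewrite gt_eqF.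
Qed.

(** Write y = a eta1 + b eta2 + c with c orthogonal to both, and z = a conj b, so that qf y = 2 Re z
    + qf c. The axis part of B(A y, y) has modulus at least (M + M^-1) Re z, and |B(A c, c)| <= - qf
    c by Cauchy-Schwarz on the negative complement. Since M + M^-1 >= 2 and qf c <= 0, the
    difference dominates (M + M^-1)/2 times qf y. *)
Lemma displacement_ge y : posvec y -> (M + M^-1) / 2 <= coshd (A y) y.
Proof.
move=> [y2 y0]; have [s2 qs] := isotropic_sum_qf iso1 iso2 B12.
have Mn : M != 0 by rewrite gt_eqF.
have s0 : 0 < qf (vadd eta1 eta2) by rewrite qs ltr0n.
have Ay2 := unitary_l2 Au y2.
pose a := Bform y eta2; pose b := Bform y eta1.
pose c := vsub y (vadd (vscale a eta1) (vscale b eta2)).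
have c2 : is_l2 c by rewrite /c.
have Ac2 := unitary_l2 Au c2.
have c1 : Bform c eta1 = 0.
  by rewrite /c BformBl // BformDl // !BformZl // B11 B21 /b; ring.
have c2' : Bform c eta2 = 0.
  by rewrite /c BformBl // BformDl // !BformZl // B12 B22 /a; ring.
have Ac1 : Bform (A c) eta1 = 0.
  have e : A (vscale m^-1 eta1) = eta1.
    by rewrite (unitaryZ _ Au) // A1 vscaleA mulVf // vscale1.
  by rewrite -e (unitary_B Au) // BformZr // c1 mulr0.
have Ac2' : Bform (A c) eta2 = 0.
  have mc : cconj m != 0 by rewrite cconj_eq0.
  have e : A (vscale (cconj m) eta2) = eta2.
    by rewrite (unitaryZ _ Au) // A2 vscaleA divff // vscale1.
  by rewrite -e (unitary_B Au) // BformZr // c2' mulr0.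
have cs : Bform c (vadd eta1 eta2) = 0 by rewrite BformDr // c1 c2' addr0.
have Acs : Bform (A c) (vadd eta1 eta2) = 0 by rewrite BformDr // Ac1 Ac2' addr0.
have yE : y = vadd (vadd (vscale a eta1) (vscale b eta2)) c.
  by apply/funext => n; rewrite /c /vadd /vsub; ring.
have [qc _] := orth_pos s2 c2 s0 cs.
have Z : cabs (Bform (A c) c) <= - qf c.
  rewrite -(@ler_pXn2r _ 2) ?nnegrE ?cabs_ge0 ?oppr_ge0 // sqr_cabs.
  apply: le_trans (orth_pos_CS s2 Ac2 c2 s0 Acs cs) _.
  by rewrite (unitary_qf Au) // sqrrN expr2.
have cc1 : Bform eta1 c = 0 by rewrite (BformC c2 l1) c1 cconj0.
have cc2 : Bform eta2 c = 0 by rewrite (BformC c2 l2) c2' cconj0.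
pose z := a * cconj b.
have qy : qf y = 2 * cRe z + qf c.
  rewrite {1}yE qfD // qfD // !qfZ // BformDl // !BformZl // BformZr // cc1 cc2.
  by rewrite /qf B11 B22 B12 /z !cE; ring.
have By : Bform (A y) y = m * (z + rC (M ^- 2) * cconj z) + Bform (A c) c.
  rewrite {1}yE (unitaryD Au) // (unitaryD Au) // !(unitaryZ _ Au) // A1 A2.
  have s12 : is_l2 (vadd (vscale a eta1) (vscale b eta2)) by [].
  rewrite !BformDl // !BformZl //.
  rewrite [in X in Bform (A c) X]yE BformDr // BformDr // !BformZr // Ac1 Ac2'.
  rewrite (BformC y2 l1) (BformC y2 l2) -/a -/b mV /z !cJ.
  ring.
have Zy := cabsD (Bform (A y) y) (- Bform (A c) c); rewrite cabsN in Zy.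
rewrite {1}By addrK cabsM -/M in Zy.
have Rz := Re_le_cabs (z + rC (M ^- 2) * cconj z).
have Rz' := le_trans (ler_norm _) Rz.
have ReE : cRe (z + rC (M ^- 2) * cconj z) = (1 + M ^- 2) * cRe z by rewrite !cE; ring.
rewrite ReE in Rz'.
have h1 : M * ((1 + M ^- 2) * cRe z) <= M * cabs (z + rC (M ^- 2) * cconj z).
  by rewrite ler_pM2l.
have h2 : M * ((1 + M ^- 2) * cRe z) = (M + M^-1) * cRe z by field.
have big : 2 <= M + M^-1.
  have := sqr_ge0 (M - 1); rewrite -(pmulr_rge0 _ (_ : 0 < M^-1)) ?invr_gt0 //.
  have -> : M^-1 * (M - 1) ^+ 2 = M + M^-1 - 2 by field.
  by rewrite subr_ge0.
have q0 : 0 < qf y by exact: y0.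
rewrite /coshd -!/(qf _) (unitary_qf Au) // -expr2 sqrtr_sqr gtr0_norm //.
rewrite ler_pdivlMr //.
have -> : (M + M^-1) / 2 * qf y = (M + M^-1) * cRe z + (M + M^-1) / 2 * qf c.
  by rewrite qy; field.
rewrite h2 in h1; move: (M + M^-1) big h1 => S big h1.
have := ler_wpM2r (_ : 0 <= - qf c) big; rewrite oppr_ge0 => /(_ qc); lra.
Qed.

Lemma inf_displacement :
  inf [set hdist (A x) x | x in posvec (R := R)] = `|ln M|.
Proof.
have [px cx] := axis_displacement.
have M1 : 1 <= (M + M^-1) / 2.
  have Mn : M != 0 by rewrite gt_eqF.
  have := sqr_ge0 (M - 1); rewrite -(pmulr_rge0 _ (_ : 0 < M^-1)) ?invr_gt0 //.
  have -> : M^-1 * (M - 1) ^+ 2 = M + M^-1 - 2 by field.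
  lra.
have lb : lbound [set hdist (A x) x | x in posvec (R := R)] `|ln M|.
  move=> _ [y py <-]; rewrite hdistE -acosh_expR //.
  by apply: acosh_le => //; exact: displacement_ge.
have mem : [set hdist (A x) x | x in posvec (R := R)] `|ln M|.
  by exists (vadd eta1 eta2) => //; rewrite hdistE cx acosh_expR.
apply/eqP; rewrite eq_le; apply/andP; split.
  by apply: ge_inf => //; exists `|ln M|.
by apply: lb_le_inf => //; exists `|ln M|.
Qed.

End Displacement.

(** * The function K and the translation length *)

Section FrameLength.
Variables (R : realType) (rho : 'M[R[i]]_2 -> vec R -> vec R).
Variables (eta1 eta2 : vec R) (t : R).
Hypotheses (rep : is_rep rho) (frame : parabolic_frame rho eta1 eta2).
Hypothesis ell : has_ell rho t.
Implicit Types (v w u : vec R) (g h : 'M[R[i]]_2) (l x y : R).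
Local Notation nu := (nu_of rho eta1 eta2).
Local Notation mu := (mu_of rho eta1 eta2).
Local Notation unip := (unip_of rho eta1 eta2).
Local Notation V := (V_of rho eta1 eta2).
Local Notation K := (K_of rho eta1 eta2).

Let iso1 := frame_iso1 frame.
Let iso2 := frame_iso2 frame.
Let B12 := frame_B12 frame.
Let f2_1 : is_l2 eta1. Proof. exact: frame_l2_1 frame. Qed.
Let f2_2 : is_l2 eta2. Proof. exact: frame_l2_2 frame. Qed.

Let aS l : 0 < l -> isSU11 (gm l 0).
Proof. by move=> l0; apply: gm_SU11; rewrite gt_eqF. Qed.
Let nS x : isSU11 (gm 1 x). Proof. by apply: gm_SU11; rewrite oner_neq0. Qed.

Lemma ln_mu l : 0 < l -> `|ln (cabs (mu l))| = t * `|ln l|.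
Proof.
move=> l0; have [e1 m0] := muP frame l0; have e2 := mu2P rep frame l0.
have [_ h] := ell; rewrite -h // -gmE.
by rewrite (inf_displacement (rep_unitary rep (aS l0)) iso1 iso2 B12 m0 e1 e2).
Qed.

Let t0 : 0 < t. Proof. by case: ell. Qed.

Lemma cabs_mu_neq1 l : 1 < l -> cabs (mu l) != 1.
Proof.
move=> l1; apply/eqP => e; have := ln_mu (lt_trans ltr01 l1).
rewrite e ln1 normr0 => /esym/eqP; rewrite mulf_eq0 gt_eqF //= normr_eq0.
by rewrite gt_eqF // ln_gt0.
Qed.

(* For p = [eta1 + eta2], cosh d(rho(g(1,x)) p, p) = |2 + K x| / 2, and Re K >= 0. *)
Lemma K_small (k : R) : 0 < k ->
  exists2 d : R, 0 < d & forall x, `|x| < d -> csq (K x) < k.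
Proof.
move=> k0; have [s2 qs] := isotropic_sum_qf iso1 iso2 B12.
have ps : posvec (vadd eta1 eta2) by split => //; rewrite -/(qf _) qs ltr0n.
(* As |2 + K|^2 >= 4 + |K|^2, having |K x|^2 >= k would force the hyperbolic cosine |2 + K x| / 2 to
   be at least this number; its logarithm is the tolerance requested from continuity. *)
have r1 : 1 < Num.sqrt (1 + k / 4).
  by rewrite -[X in X < _]sqrtr1 ltr_sqrt; lra.
have [_ [_ [_ cont]]] := rep.
have [d d0 hd] := cont _ ps (gm 1 0) (nS 0) _ (ln_gt0 r1).
exists (d / 2); first by rewrite divr_gt0.
move=> x xd; rewrite ltNge; apply/negP => kx.
have := hd (gm 1 x) (nS x); rewrite mxdist_gm1.
have -> : 2 * `|x| < d by lra.
move=> /(_ isT); rewrite hdistE => hl.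
have [_ nx] := nuP frame x; have [_ n0] := nuP frame 0.
have U x' : rho (gm 1 x') (vadd eta1 eta2) = vscale (nu x') (unip x' (vadd eta1 eta2)).
  by rewrite unipE vscaleA divff ?vscale1 //; have [] := nuP frame x'.
have V2 := V_l2 rep frame x.
have B : cabs (Bform (rho (gm 1 x) (vadd eta1 eta2)) (rho (gm 1 0) (vadd eta1 eta2)))
    = cabs (2%:R + K x).
  have u2 := unitary_l2 (unip_unitary rep frame x) s2.
  rewrite !U (unip0 rep frame) // BformZl // BformZr //; try exact: l2_scale.
  rewrite !cabsM cabsJ !(nu_unit rep frame) !mul1r.
  rewrite (unitaryD (unip_unitary rep frame x)) // (unip_eta1 frame) -VE.
  rewrite BformDl // !BformDr // (frame_B11 frame) B12 (V_eta1 rep frame) -KE.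
  by congr cabs; ring.
have px : posvec (rho (gm 1 x) (vadd eta1 eta2)).
  exact: (unitary_posvec (rep_unitary rep (nS x))).
have p0 : posvec (rho (gm 1 0) (vadd eta1 eta2)).
  exact: (unitary_posvec (rep_unitary rep (nS 0))).
have c1 := coshd_ge1 px p0.
have := le_expR_acosh c1; apply/negP; rewrite -ltNge.
apply: (@lt_le_trans _ _ (Num.sqrt (1 + k / 4))).
  by rewrite -[X in _ < X]lnK ?posrE ?(lt_trans ltr01) // ltr_expR.
rewrite /coshd -!/(qf _) !(unitary_qf (rep_unitary rep _)) // qs B.
rewrite (_ : 2 * 2 = 2 ^+ 2 :> R) // sqrtr_sqr ger0_norm ?ler0n //.
rewrite ler_pdivlMr // -(@ler_pXn2r _ 2) ?nnegrE ?cabs_ge0 ?mulr_ge0 ?sqrtr_ge0 //.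
rewrite exprMn sqr_sqrtr; last lra.
rewrite sqr_cabs; have := Re_K_ge0 rep frame x; move: kx; rewrite /csq.
rewrite (_ : (2%:R : R[i]) = rC 2) ?cE; last by apply: ceqP => //=; rewrite addr0.
nra.
Qed.

(* The other sign |mu l| = l^-t would make K blow up at 0. *)
Lemma cabs_mu l : K 1 != 0 -> 1 < l -> cabs (mu l) = expR (t * ln l).
Proof.
move=> K1 l1; have l0 := lt_trans ltr01 l1.
have lnl : 0 < ln l by rewrite ln_gt0.
have [_ m0] := muP frame l0.
have M0 : 0 < cabs (mu l) by rewrite cabs_gt0.
have := ln_mu l0; rewrite (gtr0_norm lnl).
have [Mge|Mlt] := leP 0 (ln (cabs (mu l))).
  by rewrite (ger0_norm Mge) => <-; rewrite lnK.
rewrite (ltr0_norm Mlt) => _; exfalso.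
have Mle1 : cabs (mu l) <= 1 by rewrite -(lnK M0) -expR0 ler_expR ltW.
(* Multiplying the argument by l^2 multiplies K by |mu l|^2 <= 1, so |K| cannot decrease along the
   points l^(-2n), which tend to 0. *)
have Kdec n : csq (K 1) <= csq (K (l ^- (2 * n)%N)).
  elim: n => [|n IH]; first by rewrite muln0 expr0 invr1.
  apply: le_trans IH _.
  rewrite (_ : l ^- (2 * n)%N = l ^+ 2 * l ^- (2 * n.+1)%N); last first.
    by rewrite mulnS exprD; field; rewrite expf_neq0 gt_eqF.
  rewrite (K_scale rep frame) // csqM csqR.
  rewrite ler_piMl ?csq_ge0 // -sqr_cabs -exprM exprn_ile1 //.
  exact: cabs_ge0.
have k0 : 0 < csq (K 1) by rewrite csq_gt0.
have [d d0 hd] := K_small k0.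
have z1 : `|l ^- 2| < 1.
  rewrite ger0_norm ?invr_ge0 ?exprn_ge0 ?(ltW l0) //.
  by rewrite invf_lt1 ?exprn_gt0 // exprn_egt1.
have /cvgrPdist_lt/(_ d d0)[N _ hN] := cvg_geometric 1 z1.
have := hN N (leqnn N); rewrite /= sub0r normrN mul1r -exprVn -exprM exprVn => /hd.
by rewrite ltNge Kdec.
Qed.

(** For y > 1 use [K_scale] with l the square root of y; x < 1 is recovered by scaling it up to 1
    with y = x^-1. *)
Lemma K_pow x : K 1 != 0 -> 0 < x -> K x = rC (expR (t * ln x)) * K 1.
Proof.
move=> K1.
have big y : 1 < y -> forall z, K (y * z) = rC (expR (t * ln y)) * K z.
  move=> y1 z; have y0 := lt_trans ltr01 y1.
  have s1 : 1 < Num.sqrt y by rewrite -[X in X < _]sqrtr1 ltr_sqrt.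
  have s0 := lt_trans ltr01 s1.
  rewrite -{1}(sqr_sqrtr (ltW y0)) (K_scale rep frame) //; congr (rC _ * _).
  rewrite -sqr_cabs (cabs_mu K1 s1) -expRM_natl; congr expR.
  by rewrite -{2}(sqr_sqrtr (ltW y0)) lnXn // -mulr_natl; ring.
move=> x0; have [x1|x1|->] := ltrgtP x 1; last by rewrite ln1 mulr0 expR0 mul1r.
  have xi : 1 < x^-1 by rewrite invf_gt1.
  have := big _ xi x; rewrite mulVf ?gt_eqF // => ->.
  by rewrite mulrA -rCM lnV ?posrE // -expRD mulrN subrr expR0 mul1r.
by have := big _ x1 1; rewrite mulr1.
Qed.

(** The Weyl element inverts g(2,0), so invariance of B under rho(g(2,0)) multiplies |B(rho(w) eta1,
    eta2)| by |mu 2|^-2. As |mu 2| is not 1, this pairing vanishes, and orthogonal isotropic vectors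
    are collinear. *)
Lemma frame_weyl : same_line (rho (wm R) eta1) eta2.
Proof.
have wS := wm_SU11 R.
apply: isotropic_orth_line => //.
  exact: (unitary_isotropic (rep_unitary rep wS)).
have p2 : 0 < (2 : R) by rewrite ltr0n.
have pv : 0 < (2^-1 : R) by rewrite invr_gt0.
have pn : (2^-1 : R) != 0 by rewrite gt_eqF.
have comm : gm 2 0 * wm R = wm R * gm (2^-1) 0 by rewrite wm_gm // invrK.
have [c [c1 hc]] := rep_comm rep (aS p2) wS wS (aS pv) comm.
have [e1 m1] := muP frame p2; have e2 := mu2P rep frame p2.
have [e3 m3] := muP frame pv.
have w2 := rep_l2 rep wS f2_1.
have Au := rep_unitary rep (aS p2).
have := unitary_B Au w2 f2_2.
rewrite hc // e3 (unitaryZ _ (rep_unitary rep wS)) // vscaleA e2.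
rewrite BformZl // BformZr // !cJ => /(congr1 (@cabs R)).
rewrite !cabsM c1 mul1r cabsV (mu_inv rep frame) // mulrA => h.
apply/eqP; rewrite -cabs_eq0; apply/negPn/negP => Bn.
have M0 : cabs (mu 2) != 0 by rewrite cabs_eq0.
have : cabs (mu 2) ^+ 2 == 1.
  rewrite -invr_eq1 -exprVn expr2; apply/eqP; apply: (mulIf Bn).
  by rewrite mul1r.
rewrite pexpr_eq1 ?cabs_ge0 //; apply/negP; apply: cabs_mu_neq1.
by rewrite ltr1n.
Qed.

End FrameLength.

(** * Unitary extension of Gram isometries *)

Section Approximation.
Variable R : realType.

(* The graph of v i |-> v' i extended linearly, not assumed to be well defined. *)
Inductive span2 (I : Type) (v v' : I -> vec R) : vec R -> vec R -> Prop :=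
| span2_0 : span2 v v' (vzero R) (vzero R)
| span2_add (a : R[i]) i u u' : span2 v v' u u' ->
    span2 v v' (vadd (vscale a (v i)) u) (vadd (vscale a (v' i)) u').

(** The closure of the graph [span2]. With v' = v and w' = w it expresses membership in the closed
    span of v. *)
Definition approx (I : Type) (v v' : I -> vec R) (w w' : vec R) : Prop :=
  [/\ is_l2 w, is_l2 w' & forall e : R, 0 < e -> exists u u',
    [/\ span2 v v' u u', nsq (vsub u w) <= e & nsq (vsub u' w') <= e]].

Definition total (I : Type) (v : I -> vec R) : Prop :=
  forall w, is_l2 w -> approx v v w w.

Section Families.
Variables (I : Type) (v v' : I -> vec R).
Hypotheses (v2 : forall i, is_l2 (v i)) (v2' : forall i, is_l2 (v' i)).
Implicit Types (u w y z : vec R) (a : R[i]).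

Lemma span2_l2 u u' : span2 v v' u u' -> is_l2 u /\ is_l2 u'.
Proof.
elim=> [|a i w w' _ [w2 w2']]; first by split; exact: l2_zero.
have vi : is_l2 (v i) by exact: v2.
have vi' : is_l2 (v' i) by exact: v2'.
by split.
Qed.

Lemma span2_lin a u u' w w' : span2 v v' u u' -> span2 v v' w w' ->
  span2 v v' (vadd (vscale a u) w) (vadd (vscale a u') w').
Proof.
move=> su sw; elim: su => [|b i y y' _ IH].
  have e z : vadd (vscale a (vzero R)) z = z.
    by apply/funext => n; rewrite /vadd /vscale /vzero mulr0 add0r.
  by rewrite !e.
have e (p q r : vec R) : vadd (vscale a (vadd (vscale b p) q)) r =
    vadd (vscale (a * b) p) (vadd (vscale a q) r).
  by apply/funext => n; rewrite /vadd /vscale; ring.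
by rewrite !e; exact: span2_add.
Qed.

Lemma span2_sub u u' w w' : span2 v v' u u' -> span2 v v' w w' ->
  span2 v v' (vsub u w) (vsub u' w').
Proof.
move=> su sw; have := span2_lin (-1) sw su.
have e (p q : vec R) : vadd (vscale (-1) p) q = vsub q p.
  by apply/funext => n; rewrite /vadd /vscale /vsub; ring.
by rewrite !e.
Qed.

Lemma span2_gen i : span2 v v' (v i) (v' i).
Proof.
have := span2_add 1 i (span2_0 v v').
by rewrite !vscale1 !vaddv0.
Qed.

Lemma span2_gram : (forall i j, Bform (v i) (v j) = Bform (v' i) (v' j)) ->
  forall u u' w w', span2 v v' u u' -> span2 v v' w w' -> Bform u w = Bform u' w'.
Proof.
move=> gram u u' w w' su sw; have [w2 w2'] := span2_l2 sw.
elim: su => [|a i y y' sy IH]; first by rewrite !Bform0l.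
have [y2 y2'] := span2_l2 sy; have vi : is_l2 (v i) by exact: v2.
have vi' : is_l2 (v' i) by exact: v2'.
rewrite !BformDl // !BformZl // IH; congr (_ * _ + _).
elim: sw {w2 w2' IH} => [|b j z z' sz IH]; first by rewrite !Bform0r.
have [z2 z2'] := span2_l2 sz; have vj : is_l2 (v j) by exact: v2.
have vj' : is_l2 (v' j) by exact: v2'.
by rewrite !BformDr // !BformZr // IH gram.
Qed.

Lemma approx_lin a w w' z z' : approx v v' w w' -> approx v v' z z' ->
  approx v v' (vadd (vscale a w) z) (vadd (vscale a w') z').
Proof.
move=> [w2 w2' hw] [z2 z2' hz]; split => // e e0.
have c0 : 0 < 4 * (csq a + 1) by have := csq_ge0 a; lra.
have e1 : 0 < e / (4 * (csq a + 1)) by rewrite divr_gt0.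
have e2 : 0 < e / 4 by rewrite divr_gt0.
have [u [u' [su hu hu']]] := hw _ e1; have [y [y' [sy hy hy']]] := hz _ e2.
exists (vadd (vscale a u) y), (vadd (vscale a u') y').
have [u2 u2'] := span2_l2 su; have [y2 y2'] := span2_l2 sy.
have key (p q r s : vec R) : is_l2 p -> is_l2 q -> is_l2 r -> is_l2 s ->
    nsq (vsub p r) <= e / (4 * (csq a + 1)) -> nsq (vsub q s) <= e / 4 ->
    nsq (vsub (vadd (vscale a p) q) (vadd (vscale a r) s)) <= e.
  move=> p2 q2 r2 s2 h1 h2.
  rewrite (_ : vsub _ _ = vadd (vscale a (vsub p r)) (vsub q s)); last first.
    by apply/funext => n; rewrite /vadd /vscale /vsub; ring.
  apply: le_trans (nsqD_le _ _) _ => //; rewrite nsqZ //.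
  have h3 : csq a * nsq (vsub p r) <= e / 4.
    apply: (@le_trans _ _ (csq a * (e / (4 * (csq a + 1))))).
      by rewrite ler_wpM2l // csq_ge0.
    have -> : csq a * (e / (4 * (csq a + 1))) = csq a / (csq a + 1) * (e / 4).
      by field; have := csq_ge0 a; rewrite gt_eqF //; lra.
    rewrite ler_piMl ?(ltW e2) // ler_pdivrMr; have := csq_ge0 a; lra.
  by lra.
split; [exact: span2_lin | exact: key | exact: key].
Qed.

(** Continuity of B in its first variable, by Cauchy-Schwarz, arranged so that an equality known on
    simultaneous approximations of w and w' passes to the limit. *)
Lemma Bform_limit w w' y y' : is_l2 w -> is_l2 w' -> is_l2 y -> is_l2 y' ->
  (forall e : R, 0 < e -> exists u u', [/\ is_l2 u /\ is_l2 u',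
     nsq (vsub u w) <= e, nsq (vsub u' w') <= e & Bform u y = Bform u' y']) ->
  Bform w y = Bform w' y'.
Proof.
move=> w2 w2' y2 y2' h; apply/eqP; rewrite -subr_eq0 -csq_eq0.
rewrite eq_le csq_ge0 andbT; apply/ler_addgt0Pl => e e0; rewrite addr0.
have yn := nsq_ge0 y2; have yn' := nsq_ge0 y2'.
have c0 : 0 < 2 * (nsq y + nsq y' + 1) by lra.
have [u [u' [[u2 u2'] hu hu' E]]] := h _ (divr_gt0 e0 c0).
have -> : Bform w y - Bform w' y' = Bform (vsub u' w') y' - Bform (vsub u w) y.
  by rewrite !BformBl // E; ring.
have := csqD_le (Bform (vsub u' w') y') (- Bform (vsub u w) y).
move=> /le_trans; apply; rewrite csqN.
have h1 := Bform_CS (l2_sub u2 w2) y2; have h2 := Bform_CS (l2_sub u2' w2') y2'.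
have h3 : nsq (vsub u w) * nsq y <= e / (2 * (nsq y + nsq y' + 1)) * nsq y.
  exact: ler_wpM2r.
have h4 : nsq (vsub u' w') * nsq y' <= e / (2 * (nsq y + nsq y' + 1)) * nsq y'.
  exact: ler_wpM2r.
have h5 : 2 * (e / (2 * (nsq y + nsq y' + 1)) * nsq y + e / (2 * (nsq y + nsq y' + 1)) * nsq y') <= e.
  have -> : 2 * (e / (2 * (nsq y + nsq y' + 1)) * nsq y + e / (2 * (nsq y + nsq y' + 1)) * nsq y')
     = (nsq y + nsq y') / (nsq y + nsq y' + 1) * e by field; rewrite gt_eqF; lra.
  rewrite ler_piMl ?(ltW e0) // ler_pdivrMr; lra.
lra.
Qed.

End Families.

Lemma span2_sym (I : Type) (v v' : I -> vec R) u u' :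
  span2 v v' u u' -> span2 v' v u' u.
Proof. by elim=> [|a i w w' _ IH]; [exact: span2_0 | exact: span2_add]. Qed.

Lemma span2_diag (I : Type) (v : I -> vec R) u u' : span2 v v u u' -> u = u'.
Proof. by elim=> [|a i w w' _ ->]. Qed.

Lemma span2_transfer (I : Type) (v v' : I -> vec R) u u' :
  span2 v v u u' -> exists w, span2 v v' u w.
Proof.
elim=> [|a i w w' _ [y sy]]; first by exists (vzero R); exact: span2_0.
by exists (vadd (vscale a (v' i)) y); exact: span2_add.
Qed.

Lemma approx_sym (I : Type) (v v' : I -> vec R) w w' :
  approx v v' w w' -> approx v' v w' w.
Proof.
move=> [w2 w2' h]; split => // e /h[u [u' [su hu hu']]].
by exists u', u; split => //; exact: span2_sym.
Qed.

Lemma total_orth (I : Type) (v : I -> vec R) w : (forall i, is_l2 (v i)) ->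
  total v -> is_l2 w -> (forall i, Bform w (v i) = 0) -> w = vzero R.
Proof.
move=> v2 tot w2 h; apply: nondegenerate => // y y2.
have [_ _ ay] := tot y y2.
have z2 : is_l2 (vzero R) by exact: l2_zero.
have span_orth u u' : span2 v v u u' -> Bform u w = 0.
  elim=> [|a i z z' sz IH]; first by rewrite Bform0l.
  have [zl2 _] := span2_l2 v2 v2 sz; have vi := v2 i.
  by rewrite BformDl // BformZl // IH (BformC w2 vi) h cconj0; ring.
suff yw : Bform y w = 0 by rewrite (BformC y2 w2) yw cconj0.
rewrite -(Bform0l w2).
apply: (@Bform_limit y (vzero R) w w) => // e e0.
have [u [u' [su hu _]]] := ay e e0; have [u2 _] := span2_l2 v2 v2 su.
exists u, (vzero R); split => //.
  by rewrite nsq_subvv // ltW.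
by rewrite (span_orth _ _ su) Bform0l.
Qed.

Lemma unitary_comp (S T : vec R -> vec R) : unitaryB S -> unitaryB T ->
  unitaryB (fun v => S (T v)).
Proof.
move=> Su Tu; split.
  by move=> v v2; apply: (unitary_l2 Su); exact: (unitary_l2 Tu).
split.
  move=> a v w v2 w2; rewrite (unitary_lin a Tu) // (unitary_lin a Su) //;
    exact: (unitary_l2 Tu).
split.
  move=> w w2; have [y [y2 <-]] := unitary_surj Su w2.
  by have [x [x2 <-]] := unitary_surj Tu y2; exists x.
move=> v w v2 w2; rewrite (unitary_B Su) ?(unitary_B Tu) //;
  exact: (unitary_l2 Tu).
Qed.

(** By surjectivity S w - T w = S z for some z. Pairing with S (v i) = T (v i) and using invariance
    shows that z is orthogonal to every v i, hence zero. *)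
Lemma unitary_eq_total (I : Type) (v : I -> vec R) (S T : vec R -> vec R) :
  (forall i, is_l2 (v i)) -> total v -> unitaryB S -> unitaryB T ->
  (forall i, S (v i) = T (v i)) -> forall w, is_l2 w -> S w = T w.
Proof.
move=> v2 tot Su Tu agree w w2.
have Sw2 := unitary_l2 Su w2; have Tw2 := unitary_l2 Tu w2.
have d2 : is_l2 (vsub (S w) (T w)) by [].
have [z [z2 zE]] := unitary_surj Su d2.
have z0 : z = vzero R.
  apply: (total_orth v2 tot z2) => i; have vi := v2 i.
  rewrite -(unitary_B Su z2 vi) zE BformBl //; last exact: (unitary_l2 Su).
  by rewrite (unitary_B Su w2 vi) agree (unitary_B Tu w2 vi) subrr.
move: zE; rewrite z0 (unitary0 Su) => /esym e.
by apply/funext => n; have := congr1 (fun y : vec R => y n) e; exact: subr0_eq.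
Qed.

Section Extension.
Variables (I : Type) (v v' : I -> vec R).
Hypotheses (v2 : forall i, is_l2 (v i)) (v2' : forall i, is_l2 (v' i)).
Hypothesis gram : forall i j, Bform (v i) (v j) = Bform (v' i) (v' j).
Hypotheses (tot : total v) (tot' : total v').
Variables (x x' : vec R).
Hypotheses (sx : span2 v v' x x') (x1 : Bform x x = 1).

(** Equal Gram matrices preserve B on the spans, hence also [hsq x], which becomes [hsq x'] on the
    other side; each of the two is comparable to the l2 norm. This is the purpose of the positive
    vector x in the span. *)
Lemma span2_bounded : exists2 C : R, 0 < C &
  forall u u', span2 v v' u u' -> nsq u' <= C * nsq u.
Proof.
have [x2 x2'] := span2_l2 v2 v2' sx.
have B := span2_gram v2 v2' gram.
have x1' : Bform x' x' = 1 by rewrite -(B _ _ _ _ sx sx).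
have e2 := @l2_ebase R.
have h0 := hsq_ge0 x2' x1' e2; have n0 := nsq_ge0 x2.
exists ((2 * hsq x' (ebase R) + 1) * (2 * nsq x + 1)); first by rewrite mulr_gt0 //; lra.
move=> u u' su; have [u2 u2'] := span2_l2 v2 v2' su.
apply: le_trans (nsq_le_hsq x2' x1' u2') _.
rewrite -mulrA; apply: ler_wpM2l; first lra.
have -> : hsq x' u' = hsq x u.
  by rewrite /hsq /qf -(B _ _ _ _ su sx) -(B _ _ _ _ su su).
exact: hsq_le_nsq.
Qed.

(** Approximants of w in the span of v have partners in the span of v'; boundedness makes the
    partners Cauchy, and completeness gives w'. *)
Lemma approx_exists w : is_l2 w -> exists w', approx v v' w w'.
Proof.
move=> w2; have [_ _ hw] := tot w2.
have [C C0 hC] := span2_bounded.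
have pick n : exists p : vec R * vec R,
    span2 v v' p.1 p.2 /\ nsq (vsub p.1 w) <= n.+1%:R^-1.
  have n0 : 0 < n.+1%:R^-1 :> R by rewrite invr_gt0 ltr0n.
  have [u [u' [su hu _]]] := hw _ n0.
  by have [y sy] := span2_transfer v' su; exists (u, y).
have [p hp] := choice pick.
have p2 n : is_l2 (p n).1 by have [/(span2_l2 v2 v2')[]] := hp n.
have p2' n : is_l2 (p n).2 by have [/(span2_l2 v2 v2')[]] := hp n.
have small (e : R) : 0 < e -> exists N, forall n, (N <= n)%N -> n.+1%:R^-1 <= e.
  move=> e0; have [N hN] : exists N : nat, e^-1 < N.+1%:R.
    exists (Num.truncn e^-1); exact: truncnS_gt.
  exists N => n Nn; rewrite invf_ple ?posrE ?ltr0n //.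
  by apply: le_trans (ltW hN) _; rewrite ler_nat.
have [||w' [w2' hw']] := @l2_complete R (fun n => (p n).2); first by [].
  move=> e e0; have e4 : 0 < e / (C * 4) by rewrite divr_gt0 // mulr_gt0.
  have [N hN] := small _ e4; exists N => k l Nk Nl.
  have [sk nk] := hp k; have [sl nl] := hp l.
  apply: le_trans (hC _ _ (span2_sub sk sl)) _.
  have := nsq_dist_le (p2 k) w2 (p2 l); rewrite (nsq_subC w2 (p2 l)) => h.
  have h' : nsq (vsub (p k).1 (p l).1) <= 4 * (e / (C * 4)).
    apply: le_trans h _; have := le_trans nk (hN k Nk); have := le_trans nl (hN l Nl).
    by move: (e / (C * 4)) => d; lra.
  have := ler_wpM2l (ltW C0) h'; have -> // : C * (4 * (e / (C * 4))) = e.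
  by field; rewrite gt_eqF.
exists w'; split => // e e0.
have [N1 h1] := small _ e0; have [N2 h2] := hw' _ e0.
have [sp np] := hp (maxn N1 N2).
exists (p (maxn N1 N2)).1, (p (maxn N1 N2)).2; split => //.
  by apply: le_trans np (h1 _ (leq_maxl _ _)).
exact: h2 (leq_maxr _ _).
Qed.

Lemma approx_Bform w w' z z' : approx v v' w w' -> approx v v' z z' ->
  Bform w z = Bform w' z'.
Proof.
move=> [w2 w2' hw] [z2 z2' hz].
have B := span2_gram v2 v2' gram.
have step y y' : span2 v v' y y' -> Bform w y = Bform w' y'.
  move=> sy; have [y2 y2'] := span2_l2 v2 v2' sy.
  apply: Bform_limit => // e e0; have [u [u' [su hu hu']]] := hw e e0.
  by exists u, u'; split => //; [exact: span2_l2 su | exact: B].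
rewrite (BformC z2 w2) (BformC z2' w2'); congr cconj.
apply: Bform_limit => // e e0; have [u [u' [su hu hu']]] := hz e e0.
have [u2 u2'] := span2_l2 v2 v2' su.
exists u, u'; split => //.
by rewrite (BformC w2 u2) (BformC w2' u2') (step _ _ su).
Qed.

End Extension.

(** Exchanging the two families, every z' is related to some z, and then B(w', z') and B(w'', z')
    both equal B(w, z). Nondegeneracy concludes. *)
Lemma approx_inj (I : Type) (v v' : I -> vec R) x x' w w' w'' :
  (forall i, is_l2 (v i)) -> (forall i, is_l2 (v' i)) ->
  (forall i j, Bform (v i) (v j) = Bform (v' i) (v' j)) -> total v' ->
  span2 v v' x x' -> Bform x x = 1 ->
  approx v v' w w' -> approx v v' w w'' -> w' = w''.
Proof.
move=> v2 v2' gram tot' sx x1 a1 a2.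
have [w2 w2' _] := a1; have [_ w2'' _] := a2.
have x1' : Bform x' x' = 1 by rewrite -(span2_gram v2 v2' gram sx sx).
have gram' i j : Bform (v' i) (v' j) = Bform (v i) (v j) by [].
have d0 : vsub w' w'' = vzero R.
  apply: nondegenerate => // z' z2'.
  have [z /approx_sym az] := approx_exists v2' v2 gram' tot' (span2_sym sx) x1' z2'.
  rewrite BformBl // -(approx_Bform v2 v2' gram a1 az).
  by rewrite -(approx_Bform v2 v2' gram a2 az) subrr.
by apply/funext => n; have := congr1 (fun y : vec R => y n) d0; exact: subr0_eq.
Qed.

(** U selects a point of the closed graph over each w. Linearity and the values on the v i follow
    from [approx_inj], surjectivity from the existence statement with the families exchanged. *)
Lemma unitary_extension (I : Type) (v v' : I -> vec R) x x' :
  (forall i, is_l2 (v i)) -> (forall i, is_l2 (v' i)) ->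
  (forall i j, Bform (v i) (v j) = Bform (v' i) (v' j)) ->
  total v -> total v' -> span2 v v' x x' -> Bform x x = 1 ->
  exists U, unitaryB U /\ forall i, U (v i) = v' i.
Proof.
move=> v2 v2' gram tot tot' sx x1.
have x1' : Bform x' x' = 1 by rewrite -(span2_gram v2 v2' gram sx sx).
have gram' i j : Bform (v' i) (v' j) = Bform (v i) (v j) by [].
(* [choice] requires a value at every sequence; outside l2 it is the zero vector. *)
have pick w : exists w', is_l2 w -> approx v v' w w'.
  have [w2|nw2] := pselect (is_l2 w).
    by have [w' h] := approx_exists v2 v2' gram tot sx x1 w2; exists w'.
  by exists (vzero R).
have [U hU] := choice pick.
have inj := approx_inj v2 v2' gram tot' sx x1.
exists U; split.
  split; first by move=> w /hU[].
  split.
    move=> a w z w2 z2; apply: (inj (vadd (vscale a w) z)); first exact: hU.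
    by apply: approx_lin => //; exact: hU.
  split.
    move=> w' w2'.
    have [w /approx_sym aw] := approx_exists v2' v2 gram' tot' (span2_sym sx) x1' w2'.
    have [w2 _ _] := aw; exists w; split => //.
    exact: inj (hU _ w2) aw.
  by move=> w z w2 z2; rewrite -(approx_Bform v2 v2' gram (hU _ w2) (hU _ z2)).
move=> i; apply: (inj (v i)); first exact: hU.
split => // e e0; exists (v i), (v' i).
have z (y : vec R) : is_l2 y -> nsq (vsub y y) <= e.
  by move=> y2; rewrite nsq_subvv // ltW.
by split; [exact: span2_gen | exact: z | exact: z].
Qed.

Lemma approx_closed (I : Type) (v : I -> vec R) : (forall i, is_l2 (v i)) ->
  closed_subspace (fun w => approx v v w w).
Proof.
move=> v2; split; first by move=> w [].
split.
  split; [exact: l2_zero | exact: l2_zero |] => e e0.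
  exists (vzero R), (vzero R); have z := nsq_subvv (@l2_zero R).
  by split; [exact: span2_0 | rewrite z ltW | rewrite z ltW].
split; first by move=> a w z; exact: approx_lin.
move=> u w hu w2 lim; split => // e e0.
have e4 : 0 < e / 4 by rewrite divr_gt0.
have s0 : 0 < Num.sqrt (e / 4) by rewrite sqrtr_gt0.
have /cvgrPdist_lt/(_ _ s0)[N _ hN] := lim.
have := hN N (leqnn N); rewrite /= sub0r normrN l2norm_nsq ger0_norm ?sqrtr_ge0 //.
rewrite ltr_sqrt // => lt1.
have [u2 _ hN'] := hu N; have [y [y' [sy h1 _]]] := hN' _ e4.
have yy := span2_diag sy; exists y, y'; rewrite -yy in sy *.
have [y2 _] := span2_l2 v2 v2 sy.
have h : nsq (vsub y w) <= e.
  by apply: le_trans (nsq_dist_le y2 u2 w2) _; lra.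
by split.
Qed.

End Approximation.

(** * The orbit of the parabolic fixed point *)

Section BruhatIndex.
Variable R : realType.
Implicit Types (g : 'M[R[i]]_2) (i j : option R).

(* The circle G/P is indexed by option R, None being the coset P; j is the
   index of the coset gP. *)
Definition bruhat_index g j : Prop := exists l x : R, l != 0 /\
  g = (if j is Some y then gm 1 y * wm R * gm l x else gm l x).

Definition coset_rep i : 'M[R[i]]_2 := if i is Some y then gm 1 y * wm R else 1.

Lemma bruhat_index_exists g : isSU11 g -> exists j, bruhat_index g j.
Proof.
case/bruhat_gm => [[l [x [l0 ->]]]|[y [l [x [l0 ->]]]]].
  by exists None, l, x.
by exists (Some y), l, x.
Qed.

Lemma coset_rep_SU11 i : isSU11 (coset_rep i).
Proof.
case: i => [y|]; last exact: SU11_1.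
by apply: SU11_mul (wm_SU11 R); apply: gm_SU11; rewrite oner_neq0.
Qed.

Lemma coset_rep_index i : bruhat_index (coset_rep i) i.
Proof.
by exists 1, 0; split; rewrite ?oner_neq0 //; case: i => [y|] /=; rewrite gm1 ?mulr1.
Qed.

End BruhatIndex.

Definition orbit_vec (R : realType) (rho : 'M[R[i]]_2 -> vec R -> vec R)
  (eta1 eta2 : vec R) (i : option R) : vec R :=
  if i is Some x then V_of rho eta1 eta2 x else eta1.

Section Orbit.
Variables (R : realType) (rho : 'M[R[i]]_2 -> vec R -> vec R).
Variables (eta1 eta2 : vec R) (t : R).
Hypotheses (rep : is_rep rho) (frame : parabolic_frame rho eta1 eta2).
Implicit Types (v w u : vec R) (g h : 'M[R[i]]_2) (l x y : R).
Local Notation nu := (nu_of rho eta1 eta2).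
Local Notation V := (V_of rho eta1 eta2).
Local Notation K := (K_of rho eta1 eta2).
Local Notation Lv := (orbit_vec rho eta1 eta2).

Let f2_1 : is_l2 eta1. Proof. exact: frame_l2_1 frame. Qed.
Let f2_2 : is_l2 eta2. Proof. exact: frame_l2_2 frame. Qed.
Let nS x : isSU11 (gm 1 x). Proof. by apply: gm_SU11; rewrite oner_neq0. Qed.

Lemma orbit_vec_l2 i : is_l2 (Lv i).
Proof. by case: i => [x|]; [exact: V_l2 rep frame x | exact: f2_1]. Qed.

Lemma gm_line l x : l != 0 -> same_line (rho (gm l x) eta1) eta1.
Proof.
move=> l0; have fl : forall l x : R, 0 < l -> same_line (rho (gm l x) eta1) eta1.
  by case: frame.
have [lp|ln|e] := ltrgt0P l; first exact: fl.
  have lp : 0 < - l by rewrite oppr_gt0.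
  have gS : isSU11 (gm (- l) (- x)) by apply: gm_SU11; rewrite gt_eqF.
  rewrite -[l]opprK -[x]opprK gmN ?gt_eqF //.
  apply: same_line_trans (rep_line_mul rep (SU11_N1 R) gS f2_1) _.
  have [c [c1 hc]] := rep_N1 rep.
  rewrite hc; last exact: (rep_l2 rep).
  apply: same_line_trans (same_line_scale _ (cabs1_neq0 c1)) _.
  exact: fl.
by rewrite e eqxx in l0.
Qed.

Section Weyl.
Hypothesis weyl_line : same_line (rho (wm R) eta1) eta2.

Lemma V_line x : same_line (rho (gm 1 x * wm R) eta1) (V x).
Proof.
apply: same_line_trans (rep_line_mul rep (nS x) (wm_SU11 R) f2_1) _.
apply: same_line_trans (unitary_same_line (rep_unitary rep (nS x)) f2_2 weyl_line) _.
rewrite VE unipE; apply: same_line_sym; apply: same_line_scale.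
by rewrite invr_eq0; have [] := nuP frame x.
Qed.

Lemma bruhat_line g j : bruhat_index g j -> same_line (rho g eta1) (Lv j).
Proof.
move=> [l [x [l0 ->]]]; case: j => [y|] /=; last exact: gm_line.
have nw : isSU11 (gm 1 y * wm R) by exact: SU11_mul (nS y) (wm_SU11 R).
apply: same_line_trans (rep_line_mul rep nw (gm_SU11 x l0) f2_1) _.
apply: same_line_trans (V_line y).
exact: unitary_same_line (rep_unitary rep nw) f2_1 (gm_line x l0).
Qed.

Lemma orbit_line g i j : isSU11 g -> bruhat_index (g * coset_rep i) j ->
  same_line (rho g (Lv i)) (Lv j).
Proof.
move=> gS gij; have iS := coset_rep_SU11 i.
have gu := rep_unitary rep gS.
apply: same_line_trans (bruhat_line gij).
apply: same_line_trans (same_line_sym (rep_line_mul rep gS iS f2_1)).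
apply: (unitary_same_line gu); first exact: (rep_l2 rep).
exact/same_line_sym/bruhat_line/coset_rep_index.
Qed.

Lemma span_invariant g u u' : isSU11 g -> span2 Lv Lv u u' ->
  span2 Lv Lv (rho g u) (rho g u').
Proof.
move=> gS; have gu := rep_unitary rep gS; have Lv2 := orbit_vec_l2.
elim=> [|a i w w' sw IH]; first by rewrite (unitary0 gu); exact: span2_0.
have [w2 w2'] := span2_l2 orbit_vec_l2 orbit_vec_l2 sw.
have i2 : is_l2 (Lv i) by exact: orbit_vec_l2.
have [j gij] := bruhat_index_exists (SU11_mul gS (coset_rep_SU11 i)).
have [b [b0 e]] := orbit_line gS gij.
by rewrite !(unitary_lin a gu) // e !vscaleA; exact: span2_add.
Qed.

(** The closed span of the orbit vectors contains the positive vector eta1 + eta2 and is invariant: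
    the span because the group permutes the orbit lines, its closure because each rho(g) is bounded.
    A proper one would contradict irreducibility. *)
Lemma orbit_total : irreducible rho -> total Lv.
Proof.
move=> [_ irr] w w2; apply: contrapT => nw; apply: irr.
have cl := approx_closed orbit_vec_l2.
exists (fun w => approx Lv Lv w w); split.
  split => //; exists (vadd eta1 eta2).
  have [s2 qs] := isotropic_sum_qf (frame_iso1 frame) (frame_iso2 frame) (frame_B12 frame).
  split; last by split => //; rewrite -/(qf _) qs ltr0n.
  have gen i : approx Lv Lv (Lv i) (Lv i).
    have i2 : is_l2 (Lv i) by exact: orbit_vec_l2.
    split => // e e0; exists (Lv i), (Lv i).
    have z : nsq (vsub (Lv i) (Lv i)) <= e by rewrite nsq_subvv // ltW.
    by split => //; exact: span2_gen.
  have := approx_lin orbit_vec_l2 orbit_vec_l2 1 (gen None) (gen (Some 0)).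
  by rewrite vscale1 /= (V0 rep frame).
split; first by exists w.
move=> g gS z [z2 _ hz]; have gu := rep_unitary rep gS.
have gz2 := unitary_l2 gu z2.
have [C [C0 hC]] := unitary_bounded gu.
split => // e e0; have [u [u' [su h1 _]]] := hz _ (divr_gt0 e0 C0).
have uu := span2_diag su; rewrite -uu in su.
have [u2 _] := span2_l2 orbit_vec_l2 orbit_vec_l2 su.
exists (rho g u), (rho g u).
have h : nsq (vsub (rho g u) (rho g z)) <= e.
  rewrite -(unitaryB_sub gu) //; apply: le_trans (hC _ (l2_sub u2 z2)) _.
  by rewrite mulrC -ler_pdivlMr.
by split => //; exact: span_invariant.
Qed.

End Weyl.

Lemma orbit_gramE i j : Bform (Lv i) (Lv j) =
  match i, j with
  | None, None => 0
  | Some x, Some y => K (x - y)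
  | _, _ => 1
  end.
Proof.
case: i j => [x|] [y|] /=.
- exact: (V_V rep frame).
- exact: (V_eta1 rep frame).
- have V2 := V_l2 rep frame y.
  by rewrite (BformC V2 f2_1) (V_eta1 rep frame) cconj1.
- exact: frame_B11 frame.
Qed.

Hypothesis ell : has_ell rho t.
Hypothesis K1 : K 1 != 0.

Lemma K_neq0 x : x != 0 -> K x != 0.
Proof.
have pos y : 0 < y -> K y != 0.
  move=> y0; rewrite (K_pow rep frame ell K1 y0) mulf_neq0 // rC_eq0.
  by rewrite gt_eqF // expR_gt0.
move=> x0; have [xp|xn|e] := ltrgt0P x; first exact: pos.
  rewrite -[x]opprK (KN rep frame) cconj_eq0; apply: pos.
  by rewrite oppr_gt0.
by rewrite e eqxx in x0.
Qed.

(** Distinct boundary points are never orthogonal; dividing by these entries is what allows scalars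
    attached to different orbit vectors to be compared. *)
Lemma orbit_gram_neq0 i j : i != j -> Bform (Lv i) (Lv j) != 0.
Proof.
rewrite orbit_gramE; case: i j => [x|] [y|] // ij; rewrite ?oner_neq0 //.
by apply: K_neq0; rewrite subr_eq0; apply: contra ij => /eqP ->.
Qed.

End Orbit.

(** * Equal Gram matrices give equivalent representations *)

Section Classification.
Variables (R : realType) (rho1 rho2 : 'M[R[i]]_2 -> vec R -> vec R).
Variables (e1 e2 f1 f2 : vec R) (t : R).
Hypotheses (irr1 : irreducible rho1) (irr2 : irreducible rho2).
Hypotheses (frame1 : parabolic_frame rho1 e1 e2) (frame2 : parabolic_frame rho2 f1 f2).
Hypotheses (ell1 : has_ell rho1 t) (ell2 : has_ell rho2 t).
Hypothesis K1 : K_of rho1 e1 e2 1 != 0.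
Hypothesis K12 : K_of rho1 e1 e2 1 = K_of rho2 f1 f2 1.

Let rep1 : is_rep rho1. Proof. by case: irr1 => [[]]. Qed.
Let rep2 : is_rep rho2. Proof. by case: irr2 => [[]]. Qed.
Let K2 : K_of rho2 f1 f2 1 != 0. Proof. by rewrite -K12. Qed.
Local Notation L1 := (orbit_vec rho1 e1 e2).
Local Notation L2 := (orbit_vec rho2 f1 f2).

Lemma K_eq x : K_of rho1 e1 e2 x = K_of rho2 f1 f2 x.
Proof.
have pos y : 0 < y -> K_of rho1 e1 e2 y = K_of rho2 f1 f2 y.
  move=> y0; rewrite (K_pow rep1 frame1 ell1 K1 y0) (K_pow rep2 frame2 ell2 K2 y0).
  by rewrite K12.
have [xp|xn|->] := ltrgt0P x; first exact: pos.
  rewrite -[x]opprK (KN rep1 frame1) (KN rep2 frame2); congr cconj; apply: pos.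
  by rewrite oppr_gt0.
by rewrite (K0 rep1 frame1) (K0 rep2 frame2).
Qed.

Lemma orbit_gram_eq i j : Bform (L1 i) (L1 j) = Bform (L2 i) (L2 j).
Proof.
rewrite (orbit_gramE rep1 frame1) (orbit_gramE rep2 frame2).
by case: i j => [x|] [y|] //; exact: K_eq.
Qed.

(* U rho1(g) and rho2(g) U differ on the orbit vectors by scalars s i with
   s i * conj (s j) = 1 for i <> j; having three indices forces s to be constant. *)
Lemma equivalent_of_frames : equivalent rho1 rho2.
Proof.
have w1 := frame_weyl rep1 frame1 ell1.
have w2 := frame_weyl rep2 frame2 ell2.
have tot1 := orbit_total rep1 frame1 w1 irr1.
have tot2 := orbit_total rep2 frame2 w2 irr2.
have L1l2 := orbit_vec_l2 rep1 frame1.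
have L2l2 := orbit_vec_l2 rep2 frame2.
have [U [Uu UL]] : exists U, unitaryB U /\ forall i, U (L1 i) = L2 i.
  have s := span2_add 1 None (span2_gen L1 L2 (Some 0)).
  (* The vector e1 + e2 has form 2, so this factor makes it the unit positive vector required by
     [unitary_extension]. *)
  have := span2_lin (rC (Num.sqrt 2^-1)) s (span2_0 L1 L2).
  rewrite !vscale1 !vaddv0 => sx.
  apply: (unitary_extension _ _ _ tot1 tot2 sx); [exact: L1l2 | exact: L2l2
    | exact: orbit_gram_eq |].
  have [s2 qs] := isotropic_sum_qf (frame_iso1 frame1) (frame_iso2 frame1) (frame_B12 frame1).
  have -> : vadd (L1 None) (L1 (Some 0)) = vadd e1 e2.
    by rewrite /= (V0 rep1 frame1).
  rewrite BformZl ?BformZr //; first last.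
    exact: l2_scale.
  rewrite mulrA mul_conj (Bform_qf s2) qs csqR sqr_sqrtr ?invr_ge0 ?ler0n //.
  by rewrite -rCM mulVf // pnatr_eq0.
exists U; split => // g gS.
have gu1 := rep_unitary rep1 gS; have gu2 := rep_unitary rep2 gS.
have Sc i : exists s : R[i], s != 0 /\ rho2 g (U (L1 i)) = vscale s (U (rho1 g (L1 i))).
  have [j gij] := bruhat_index_exists (SU11_mul gS (coset_rep_SU11 i)).
  have [a [a0 ea]] := orbit_line rep1 frame1 w1 gS gij.
  have [b [b0 eb]] := orbit_line rep2 frame2 w2 gS gij.
  have j2 : is_l2 (L1 j) by exact: L1l2.
  exists (b / a); split; first by rewrite mulf_neq0 // invr_eq0.
  by rewrite UL eb ea (unitaryZ _ Uu) // UL vscaleA mulfVK.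
have [s hs] := choice Sc.
have sB i j : i != j -> s i * cconj (s j) = 1.
  move=> ij; have [si ei] := hs i; have [sj ej] := hs j.
  have Bn := orbit_gram_neq0 rep1 frame1 ell1 K1 ij.
  have i2 : is_l2 (L1 i) by exact: L1l2.
  have j2 : is_l2 (L1 j) by exact: L1l2.
  have Ui := unitary_l2 Uu i2; have Uj := unitary_l2 Uu j2.
  have gi := unitary_l2 gu1 i2; have gj := unitary_l2 gu1 j2.
  have Ugi := unitary_l2 Uu gi; have Ugj := unitary_l2 Uu gj.
  have := unitary_B gu2 Ui Uj; rewrite ei ej BformZl // BformZr //.
  rewrite (unitary_B Uu gi gj) (unitary_B gu1 i2 j2) (unitary_B Uu i2 j2) mulrA => h.
  by apply: (mulIf Bn); rewrite h mul1r.
have n10 : (1 : R) != 0 by rewrite oner_neq0.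
pose c := s None.
have c0 : c != 0 by have [] := hs None.
have cc0 : cconj c != 0 by rewrite cconj_eq0.
have sS x : s (Some x) * cconj c = 1 by exact: sB.
have s1c : s (Some 1) = c.
  have h01 : s (Some 0) * cconj (s (Some 1)) = 1.
    by apply: sB; apply/eqP => -[/eqP]; rewrite eq_sym (negbTE n10).
  have s00 : s (Some 0) != 0 by have [] := hs (Some 0).
  by apply: (can_inj (@cconjK R)); apply: (mulfI s00); rewrite h01 sS.
have cu : c * cconj c = 1 by rewrite -[X in X * _]s1c sS.
have cabs1 : cabs c = 1.
  by apply: csq1_cabs; apply: (@rC_inj R); rewrite -mul_conj cu.
have sc i : s i = c.
  by case: i => [x|] //; apply: (mulIf cc0); rewrite sS cu.
exists c; split => // v v2.
have := unitary_eq_total L1l2 tot1 (unitary_comp gu2 Uu)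
  (unitary_scale (unitary_comp Uu gu1) cabs1).
by move=> /(_ _)/(_ _ v2) -> // i; have [_ ->] := hs i; rewrite sc.
Qed.

End Classification.

(** * The argument *)

Section Argument.
Variable R : realType.
Implicit Types (rho : 'M[R[i]]_2 -> vec R -> vec R).

Lemma frame_has_arg rho e1 e2 : is_rep rho -> parabolic_frame rho e1 e2 ->
  K_of rho e1 e2 1 != 0 ->
  has_arg rho (K_of rho e1 e2 1 / rC (cabs (K_of rho e1 e2 1))).
Proof.
move=> rep frame K0; have i1 := frame_iso1 frame; have i2 := frame_iso2 frame.
have l1 := frame_l2_1 frame; have l2 := frame_l2_2 frame.
have V2 := V_l2 rep frame 1.
pose k := K_of rho e1 e2 1.
have [_ _ _ f1 f2] := frame.
(* The last witness c is what remains of V 1 once its components along e1 and e2 are removed. *)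
exists e1, e2, (fun v => vscale (nu_of rho e1 e2 1)^-1 (rho (gmat 1 1) v)), k,
  (vsub (V_of rho e1 e2 1) (vadd (vscale k e1) e2)).
have TE v : vscale (nu_of rho e1 e2 1)^-1 (rho (gmat 1 1) v) = unip_of rho e1 e2 1 v.
  by rewrite unipE gmE.
split => //; split => //; split; first exact: frame_B12 frame.
split; first by move=> l x l0; rewrite -gmE; exact: f1.
split; first by move=> l l0; rewrite -gmE; exact: f2.
split.
  exists (nu_of rho e1 e2 1)^-1; split => //.
  by rewrite cabsV (nu_unit rep frame) invr1.
split; first by rewrite TE (unip_eta1 frame).
split => //.
split.
  rewrite BformBl // BformDl // BformZl // (V_eta1 rep frame) (frame_B11 frame).
  by rewrite (frame_B21 frame); ring.
split.
  rewrite BformBl // BformDl // BformZl // (frame_B12 frame) (frame_B22 frame).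
  by rewrite -KE -/k; ring.
split => //.
rewrite TE -VE; apply/funext => n; rewrite /vsub /vadd; ring.
Qed.

(** A lift fixing e1 is determined: its scalar c0 must be the inverse of the eigenvalue of
    rho(g(1,1)) at e1, so T agrees with [unip_of] at 1 and k is K(1). *)
Lemma has_arg_frame rho u : is_rep rho -> has_arg rho u -> exists e1 e2,
  [/\ parabolic_frame rho e1 e2, K_of rho e1 e2 1 != 0 &
    u = K_of rho e1 e2 1 / rC (cabs (K_of rho e1 e2 1))].
Proof.
move=> rep [e1 [e2 [T [k [c [i1 [i2 [B12 [f1 [f2 [[c0 [c01 TE]] [T1]]]]]]]]]]]].
move=> [c2 [cB1 [cB2 [T2 [k0 uE]]]]].
have frame : parabolic_frame rho e1 e2.
  split => //; first by move=> l x l0; rewrite gmE; exact: f1.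
  by move=> l l0; rewrite gmE; exact: f2.
have l1 := frame_l2_1 frame; have l2 := frame_l2_2 frame.
have [n1 n0] := nuP frame 1.
have c0E : c0 = (nu_of rho e1 e2 1)^-1.
  apply: (mulIf n0); rewrite mulVf //; apply: (frame_inj frame).
  by rewrite -vscaleA -n1 gmE vscale1 -[RHS]T1 TE.
have VT : V_of rho e1 e2 1 = T e2 by rewrite VE unipE -c0E gmE TE.
have Kk : K_of rho e1 e2 1 = k.
  rewrite KE VT T2 !BformDl // BformZl // B12 cB2 (frame_B22 frame); ring.
by exists e1, e2; rewrite Kk.
Qed.

(** Opposite real scalings keep B(e1, e2) = 1 and the eigenvalue at e1, hence the lift; K is
    quadratic in e2. The modulus of K(1) can thus be adjusted without touching its argument. *)
Lemma frame_scale rho e1 e2 (s : R) : is_rep rho -> parabolic_frame rho e1 e2 ->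
  0 < s ->
  parabolic_frame rho (vscale (rC s) e1) (vscale (rC s^-1) e2) /\
  K_of rho (vscale (rC s) e1) (vscale (rC s^-1) e2) 1 =
    rC (s ^- 2) * K_of rho e1 e2 1.
Proof.
move=> rep frame s0; have i1 := frame_iso1 frame; have i2 := frame_iso2 frame.
have l1 := frame_l2_1 frame; have l2 := frame_l2_2 frame.
have sn : s != 0 by rewrite gt_eqF.
have sC : rC s != 0 by rewrite rC_eq0.
have sV : rC s^-1 != 0 by rewrite rC_eq0 invr_eq0.
have [_ _ _ f1 f2] := frame.
have nS : isSU11 (gm (1 : R) 1) by apply: gm_SU11; rewrite oner_neq0.
have nu := rep_unitary rep nS.
have V2 := V_l2 rep frame 1.
have g1 := unitary_l2 nu l1.
have line g (a : R[i]) v : isSU11 g -> is_l2 v -> a != 0 -> same_line (rho g v) v ->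
    same_line (rho g (vscale a v)) (vscale a v).
  move=> gS v2 a0 h; rewrite (unitaryZ _ (rep_unitary rep gS)) //.
  apply: same_line_trans (same_line_scale _ a0) _.
  by apply: same_line_trans h _; apply: same_line_sym; exact: same_line_scale.
split.
  split.
  - exact: same_line_isotropic (same_line_scale _ sC) i1.
  - exact: same_line_isotropic (same_line_scale _ sV) i2.
  - rewrite BformZl // BformZr // cJ (frame_B12 frame) mulr1 -rCM divff //.
  - move=> l x l0; apply: line => //; last exact: f1.
    by apply: gm_SU11; rewrite gt_eqF.
  - move=> l l0; apply: line => //; last exact: f2.
    by apply: gm_SU11; rewrite gt_eqF.
have nuS : nu_of rho (vscale (rC s) e1) (vscale (rC s^-1) e2) 1 = nu_of rho e1 e2 1.
  rewrite !nuE (unitaryZ _ nu) // BformZl // BformZr // cJ mulrA -rCM divff //.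
  by rewrite rC1 mul1r.
have VS : V_of rho (vscale (rC s) e1) (vscale (rC s^-1) e2) 1 =
    vscale (rC s^-1) (V_of rho e1 e2 1).
  by rewrite !VE !unipE nuS (unitaryZ _ nu) // !vscaleA mulrC.
rewrite !KE VS BformZl // BformZr // cJ mulrA -rCM; congr (rC _ * _).
by rewrite -exprVn expr2.
Qed.

(** Taking s^2 = |K(1)| in [frame_scale] makes K(1) equal to u, so a common argument becomes a
    common value of K(1). *)
Lemma has_arg_normalized_frame rho u : is_rep rho -> has_arg rho u ->
  u != 0 /\ exists e1 e2, parabolic_frame rho e1 e2 /\ K_of rho e1 e2 1 = u.
Proof.
move=> rep /(has_arg_frame rep)[e1 [e2 [frame K0 ->]]].
have k0 : 0 < cabs (K_of rho e1 e2 1) by rewrite cabs_gt0.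
split; first by rewrite mulf_neq0 // invr_eq0 rC_eq0 gt_eqF.
have s0 : 0 < Num.sqrt (cabs (K_of rho e1 e2 1)) by rewrite sqrtr_gt0.
have [frame' K'] := frame_scale rep frame s0.
eexists; eexists; split; first exact: frame'.
by rewrite K' sqr_sqrtr ?ltW // rCV mulrC.
Qed.

(** The phase of the intertwining relation at g(1,1) multiplies both the lift and its eigenvalue at
    the fixed vector, so it cancels in V. *)
Lemma frame_transport rho1 rho2 e1 e2 (U : vec R -> vec R) :
  is_rep rho1 -> is_rep rho2 -> unitaryB U ->
  (forall g, isSU11 g -> exists c : R[i], cabs c = 1 /\
    forall v, is_l2 v -> rho2 g (U v) = vscale c (U (rho1 g v))) ->
  parabolic_frame rho1 e1 e2 ->
  parabolic_frame rho2 (U e1) (U e2) /\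
  K_of rho2 (U e1) (U e2) 1 = K_of rho1 e1 e2 1.
Proof.
move=> rep1 rep2 Uu hU frame; have i1 := frame_iso1 frame; have i2 := frame_iso2 frame.
have l1 := frame_l2_1 frame; have l2 := frame_l2_2 frame.
have [_ _ _ f1 f2] := frame.
have line g v : isSU11 g -> is_l2 v -> same_line (rho1 g v) v ->
    same_line (rho2 g (U v)) (U v).
  move=> gS v2 h; have [c [c1 ->]] := hU g gS; last by [].
  apply: same_line_trans (same_line_scale _ (cabs1_neq0 c1)) _.
  exact: unitary_same_line.
split.
  split; [exact: (unitary_isotropic Uu) | exact: (unitary_isotropic Uu) | | |].
  - by rewrite (unitary_B Uu) // (frame_B12 frame).
  - move=> l x l0; apply: line => //; last exact: f1.
    by apply: gm_SU11; rewrite gt_eqF.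
  - move=> l l0; apply: line => //; last exact: f2.
    by apply: gm_SU11; rewrite gt_eqF.
have nS : isSU11 (gm (1 : R) 1) by apply: gm_SU11; rewrite oner_neq0.
have [c [c1 hc]] := hU _ nS; have cn := cabs1_neq0 c1.
have g1 := unitary_l2 (rep_unitary rep1 nS) l1.
have g2 := unitary_l2 (rep_unitary rep1 nS) l2.
have V2 := V_l2 rep1 frame 1.
have Ug1 := unitary_l2 Uu g1; have Ul2 := unitary_l2 Uu l2.
have nuS : nu_of rho2 (U e1) (U e2) 1 = c * nu_of rho1 e1 e2 1.
  by rewrite !nuE hc // BformZl // (unitary_B Uu).
have VS : V_of rho2 (U e1) (U e2) 1 = U (V_of rho1 e1 e2 1).
  rewrite !VE !unipE nuS hc // (unitaryZ _ Uu) // vscaleA; congr vscale.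
  by rewrite invfM mulrAC mulVf // mul1r.
by rewrite !KE VS (unitary_B Uu).
Qed.

End Argument.

(** * Existence of the frame *)

Section NormLimits.
Variable R : realType.

Definition nsq_cvg (u : nat -> vec R) (w : vec R) : Prop :=
  forall e : R, 0 < e -> exists N, forall n, (N <= n)%N -> nsq (vsub (u n) w) <= e.

Lemma nsq_cvg_unitary (S : vec R -> vec R) u w : unitaryB S ->
  (forall n, is_l2 (u n)) -> is_l2 w -> nsq_cvg u w ->
  nsq_cvg (fun n => S (u n)) (S w).
Proof.
move=> Su u2 w2 lim e e0; have [C [C0 hC]] := unitary_bounded Su.
have [N hN] := lim _ (divr_gt0 e0 C0); exists N => n /hN h.
rewrite -(unitaryB_sub Su) //; apply: le_trans (hC _ (l2_sub (u2 n) w2)) _.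
by rewrite mulrC -ler_pdivlMr.
Qed.

Lemma nsq_cvg_Bform u z w y : (forall n, is_l2 (u n)) -> (forall n, is_l2 (z n)) ->
  is_l2 w -> is_l2 y -> nsq_cvg u w -> nsq_cvg z y ->
  forall e : R, 0 < e -> exists N, forall n, (N <= n)%N ->
    csq (Bform (u n) (z n) - Bform w y) <= e.
Proof.
move=> u2 z2 w2 y2 lu lz e e0.
have wn := nsq_ge0 w2; have yn := nsq_ge0 y2.
(* Two uses of [csqD_le] put a factor 2 on the quadratic error and 4 on each linear one; the
   condition d <= 1 absorbs d^2 into d. *)
pose C := 2 + 4 * nsq y + 4 * nsq w.
have C0 : 0 < C by rewrite /C; lra.
have [d [d0 d1 dC]] : exists d : R, [/\ 0 < d, d <= 1 & d * C <= e].
  exists (Num.min 1 (e / C)); rewrite lt_min ltr01 divr_gt0 // ge_min lexx.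
  by split => //; rewrite -ler_pdivlMr // ge_min lexx orbT.
have [N1 h1] := lu _ d0; have [N2 h2] := lz _ d0.
exists (maxn N1 N2) => n; rewrite geq_max => /andP[/h1 a1 /h2 a2].
have un := u2 n; have zn := z2 n.
have -> : Bform (u n) (z n) - Bform w y = Bform (vsub (u n) w) (vsub (z n) y) +
    (Bform (vsub (u n) w) y + Bform w (vsub (z n) y)).
  by rewrite !BformBl // !BformBr //; ring.
have c1 := csqD_le (Bform (vsub (u n) w) (vsub (z n) y))
  (Bform (vsub (u n) w) y + Bform w (vsub (z n) y)).
have c2 := csqD_le (Bform (vsub (u n) w) y) (Bform w (vsub (z n) y)).
have b1 := Bform_CS (l2_sub un w2) (l2_sub zn y2).
have b2 := Bform_CS (l2_sub un w2) y2.
have b3 := Bform_CS w2 (l2_sub zn y2).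
have p1 := nsq_ge0 (l2_sub un w2); have p2 := nsq_ge0 (l2_sub zn y2).
have m1 : nsq (vsub (u n) w) * nsq (vsub (z n) y) <= d * 1.
  by apply: ler_pM => //; apply: le_trans a2 d1.
have m2 : nsq (vsub (u n) w) * nsq y <= d * nsq y by exact: ler_wpM2r.
have m3 : nsq w * nsq (vsub (z n) y) <= d * nsq w by rewrite mulrC; exact: ler_wpM2r.
apply: le_trans dC; rewrite /C.
have -> : d * (2 + 4 * nsq y + 4 * nsq w) = 2 * (d * 1) + 4 * (d * nsq y) + 4 * (d * nsq w).
  by ring.
lra.
Qed.

(* The factor 2 in the quasi-triangle inequality of nsq is beaten by the ratio 1/4. *)
Lemma nsq_geometric_cauchy (u : nat -> vec R) (D : R) :
  (forall n, is_l2 (u n)) -> 0 <= D ->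
  (forall n, nsq (vsub (u n) (u n.+1)) <= D * 4^-1 ^+ n) ->
  exists w, is_l2 w /\ nsq_cvg u w.
Proof.
move=> u2 D0 step.
(* The constant 4 D reproduces itself in the induction: with q = 4^-n, 2 (D q + 4 D q / 4) = 4 D
   q. *)
have tail k : forall n, nsq (vsub (u n) (u (n + k)%N)) <= 4 * D * 4^-1 ^+ n.
  elim: k => [|k IH] n.
    by rewrite addn0 nsq_subvv // !mulr_ge0 // exprn_ge0 // invr_ge0.
  rewrite addnS -addSn.
  apply: le_trans (nsq_dist_le (u2 n) (u2 n.+1) (u2 (n.+1 + k)%N)) _.
  have := IH n.+1; have := step n; rewrite exprS.
  by move: (4^-1 ^+ n) => q h1 h2; lra.
apply: l2_complete => // e e0.
have q1 : `|4^-1 : R| < 1 by rewrite ger0_norm ?invr_ge0 // invf_lt1 // ltr1n.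
(* Comparing u k and u l through u N costs 2 (4 D q + 4 D q) = 16 D q; adding 1 keeps the divisor
   positive when D = 0. *)
have D1 : 0 < 16 * D + 1 by lra.
have /cvgrPdist_lt/(_ _ (divr_gt0 e0 D1))[N _ hN] := cvg_geometric 1 q1.
have := hN N (leqnn N); rewrite /= sub0r normrN mul1r ger0_norm; last first.
  by rewrite exprn_ge0 // invr_ge0.
move=> qN; exists N => k l Nk Nl.
apply: le_trans (nsq_dist_le (u2 k) (u2 N) (u2 l)) _.
rewrite (nsq_subC (u2 k) (u2 N)).
have := tail (k - N)%N N; have := tail (l - N)%N N; rewrite !subnKC // => t1 t2.
have q0 : 0 <= 4^-1 ^+ N :> R by rewrite exprn_ge0 // invr_ge0.
move: qN; rewrite ltr_pdivlMr //; move: (4^-1 ^+ N) t1 t2 q0 => q; lra.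
Qed.

End NormLimits.

(** Parameters in geometric progression, scaled so that rho(g(drift t n, 0)) has translation length
    exactly n when the length is t. *)
HB.lock Definition drift (R : realType) (t : R) (n : nat) : R := expR (n%:R / t).

Section Existence.
Variables (R : realType) (rho : 'M[R[i]]_2 -> vec R -> vec R) (t : R).
Hypotheses (rep : is_rep rho) (ell : has_ell rho t).
Implicit Types (l x y : R).

Let t0 : 0 < t. Proof. by case: ell. Qed.
Let e0l2 := @l2_ebase R.
Let e0q : qf (ebase R) = 1. Proof. by rewrite /qf Bform_ebase1. Qed.
Let e0pos : posvec (ebase R).
Proof. by split => //; rewrite Bform_ebase1 ltr01. Qed.

Local Notation lam := (drift t).
Let lamE n : lam n = expR (n%:R / t). Proof. by rewrite drift.unlock. Qed.
Let lam0 n : 0 < lam n. Proof. by rewrite lamE expR_gt0. Qed.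
Local Notation G n := (gm (lam n) 0).
Let GS n : isSU11 (G n). Proof. by apply: gm_SU11; rewrite gt_eqF. Qed.
Local Notation x_ n := (rho (G n) (ebase R)).
Let x2 n : is_l2 (x_ n). Proof. exact: (rep_l2 rep). Qed.
#[local] Arguments x2 : clear implicits.
Let xq n : qf (x_ n) = 1. Proof. by rewrite (unitary_qf (rep_unitary rep (GS n))). Qed.
Local Notation beta n := (Bform (x_ n) (ebase R)).

Let coshd_e0 g : isSU11 g -> coshd (rho g (ebase R)) (ebase R) =
  cabs (Bform (rho g (ebase R)) (ebase R)).
Proof.
move=> gS; rewrite /coshd -!/(qf _) (unitary_qf (rep_unitary rep gS)) // e0q.
by rewrite mulr1 sqrtr1 divr1.
Qed.

(* As g(lam,0)^n = g(lam^n,0), the length function gives linear drift at every point. *)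
Let beta_ge n : 2 ^+ n / 2 <= cabs (beta n).
Proof.
have [_ h] := ell; have hn := h _ (lam0 n).
have px := unitary_posvec (rep_unitary rep (GS n)) e0pos.
have c1 := coshd_ge1 px e0pos.
have drift : n%:R <= hdist (x_ n) (ebase R).
  have -> : n%:R = t * `|ln (lam n)|.
    rewrite lamE expRK ger0_norm ?divr_ge0 ?ler0n ?ltW //.
    by rewrite mulrC divfK // gt_eqF.
  rewrite -hn; apply: ge_inf; last by exists (ebase R); rewrite -?gmE.
  exists 0 => _ [y py <-]; rewrite hdistE acosh_ge0 // coshd_ge1 // -gmE.
  exact: unitary_posvec (rep_unitary rep (GS n)) py.
(* The bound expR (acosh q) <= 2 q, together with 2 <= e, converts distance at least n into a
   pairing of modulus at least 2^n / 2. *)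
have b1 := expR_acosh_le c1; rewrite -hdistE coshd_e0 // in b1.
have b2 : 2 ^+ n <= expR (hdist (x_ n) (ebase R)).
  apply: (@le_trans _ _ (expR n%:R)); last by rewrite ler_expR.
  rewrite -[n%:R]mulr1 expRM_natl lerXn2r ?nnegrE ?expR_ge0 //.
  by have := expR_ge1Dx (1 : R).
rewrite ler_pdivrMr // mulrC; exact: le_trans b2 b1.
Qed.

Let beta_gt0 n : 0 < cabs (beta n).
Proof. by apply: lt_le_trans (beta_ge n); rewrite divr_gt0 // exprn_gt0. Qed.
Let beta_neq0 n : beta n != 0. Proof. by rewrite -cabs_gt0. Qed.

Local Notation w_ n := (vscale (beta n)^-1 (x_ n)).
Let wl2 n : is_l2 (w_ n). Proof. exact: l2_scale (x2 n). Qed.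
#[local] Arguments wl2 : clear implicits.

(** Moves the displacement of S at x_n back to the base point, where it becomes that of the
    conjugate g = G_n^-1 S G_n. *)
Let comm_bound (S g : 'M[R[i]]_2) n : isSU11 S -> isSU11 g -> S * G n = G n * g ->
  cabs (Bform (rho S (x_ n)) (x_ n)) = cabs (Bform (rho g (ebase R)) (ebase R)).
Proof.
move=> SS gS e; have [c [c1 hc]] := rep_comm rep SS (GS n) (GS n) gS e.
have xn := x2 n; have gl2 := rep_l2 rep gS e0l2; have Ggl2 := rep_l2 rep (GS n) gl2.
rewrite hc // BformZl // cabsM c1 mul1r.
by rewrite (unitary_B (rep_unitary rep (GS n))).
Qed.

(* The limit of w_n = x_n / B(x_n, e0), where x_n = rho(g(e^(n/t),0)) e0; it is
   isotropic because |B(x_n, e0)| tends to infinity, and rho(p) fixes its line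
   because B(rho(p) x_n, x_n) stays bounded. *)
Lemma attracting_point : exists w, isotropic w /\
  forall l x, 0 < l -> same_line (rho (gm l x) w) w.
Proof.
pose D := cabs (Bform (rho (G 1) (ebase R)) (ebase R)).
have D0 : 0 <= D by exact: cabs_ge0.
have G_D n : cabs (Bform (x_ n.+1) (x_ n)) = D.
  have e : G n.+1 = G n * G 1.
    rewrite gmM ?gt_eqF // mulr0 mul0r addr0; congr gm.
    by rewrite !lamE -expRD -mulrDl -natrD addn1.
  have [c [c1 hc]] := rep_mul rep (GS n) (GS 1).
  have Gl := rep_l2 rep (GS 1) e0l2; have GGl := rep_l2 rep (GS n) Gl.
  have xn := x2 n; rewrite e hc // BformZl // cabsM c1 mul1r.
  by rewrite (unitary_B (rep_unitary rep (GS n))).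
(* All w_n lie in the slice where coordinate 0 is 1, so the squared norm of a difference is minus
   its form. This is at most 2 Re B(w_n, w_(n+1)), which decays like 4^-n because |B(x_(n+1), x_n)|
   is the constant D. *)
have wcoord n : w_ n 0%N = 1.
  by rewrite -(Bform_ebase (wl2 n)) BformZl // ?mulVf //; exact: x2.
have wq n : qf (w_ n) = (csq (beta n))^-1.
  by rewrite qfZ ?xq ?mulr1 ?csqV //; exact: x2.
have inv_le n : (cabs (beta n))^-1 <= 2 * 2^-1 ^+ n.
  rewrite -[leRHS]invrK lef_pV2 ?posrE // ?invr_gt0 ?mulr_gt0 ?exprn_gt0 ?invr_gt0 //.
  by rewrite invfM exprVn invrK mulrC.
have step n : nsq (vsub (w_ n) (w_ n.+1)) <= (4 * D) * 4^-1 ^+ n.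
  have d2 := l2_sub (wl2 n) (wl2 n.+1).
  have := qf_nsq d2; rewrite {2}/vsub !wcoord subrr csq0 mulr0 sub0r => /esym/eqP.
  rewrite eqr_oppLR => /eqP ->; rewrite qfB // !wq.
  have B1 : cRe (Bform (w_ n) (w_ n.+1)) <= (cabs (beta n))^-1 * (cabs (beta n.+1))^-1 * D.
    apply: le_trans (ler_norm _) _; apply: le_trans (Re_le_cabs _) _.
    have xn := x2 n; have xn1 := x2 n.+1.
    rewrite BformZl // BformZr // !cabsM cabsJ !cabsV mulrA.
    by rewrite (BformC (x2 n.+1) (x2 n)) cabsJ G_D.
  have p1 : 0 <= (csq (beta n))^-1 by rewrite invr_ge0 csq_ge0.
  have p2 : 0 <= (csq (beta n.+1))^-1 by rewrite invr_ge0 csq_ge0.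
  have B2 : (cabs (beta n))^-1 * (cabs (beta n.+1))^-1 * D <=
      (2 * 2^-1 ^+ n) * (2 * 2^-1 ^+ n.+1) * D.
    by apply: ler_wpM2r => //; apply: ler_pM; rewrite ?invr_ge0 ?cabs_ge0.
  have E : (2 * 2^-1 ^+ n) * (2 * 2^-1 ^+ n.+1) * D = 2 * D * 4^-1 ^+ n.
    have -> : (4^-1 : R) = 2^-1 ^+ 2 by field.
    by rewrite -exprM mulnC exprM exprS expr2; field.
  by rewrite E in B2; lra.
have D4 : 0 <= 4 * D by rewrite mulr_ge0.
have [w [w2 lim]] := nsq_geometric_cauchy (u := fun n => w_ n) wl2 D4 step.
have w01 : 1 = w 0%N.
  apply/eqP; rewrite -subr_eq0 -csq_eq0 eq_le csq_ge0 andbT.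
  apply/ler_addgt0Pl => e e0; rewrite addr0; have [N hN] := lim e e0.
  by have := le_trans (nsq_ge 0%N (l2_sub (wl2 N) w2)) (hN N (leqnn N));
    rewrite {1}/vsub wcoord.
(* B(rho(S) w, w) is the limit of B(rho(S) x_n, x_n) divided by |beta n|^2, hence 0 as soon as the
   numerators stay bounded. *)
have key S : isSU11 S -> (exists D' N0, forall n, (N0 <= n)%N ->
    cabs (Bform (rho S (x_ n)) (x_ n)) <= D') -> Bform (rho S w) w = 0.
  move=> SS [D' [N0 hD']]; have Su := rep_unitary rep SS.
  have D'0 : 0 <= D' by apply: le_trans (hD' N0 (leqnn _)); exact: cabs_ge0.
  apply/eqP; rewrite -csq_eq0 eq_le csq_ge0 andbT.
  apply/ler_addgt0Pl => e e0; rewrite addr0.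
  have e4 : 0 < e / 4 by rewrite divr_gt0.
  have Sw2 n : is_l2 (rho S (w_ n)) by exact: (rep_l2 rep).
  have [N1 h1] := nsq_cvg_Bform Sw2 wl2 (rep_l2 rep SS w2) w2
    (nsq_cvg_unitary Su wl2 w2 lim) lim e4.
  have q1 : `|4^-1 : R| < 1 by rewrite ger0_norm ?invr_ge0 // invf_lt1 // ltr1n.
  (* With s = 4^-n <= 1, the squared pairing at stage n is at most (4 s)^2 D'^2 <= 16 s D'^2. *)
  have D1 : 0 < 16 * D' ^+ 2 + 1 by have := sqr_ge0 D'; lra.
  have /cvgrPdist_lt/(_ _ (divr_gt0 e4 D1))[N2 _ h2] := cvg_geometric 1 q1.
  pose n := maxn N0 (maxn N1 N2).
  have n0 : (N0 <= n)%N by rewrite leq_max leqnn.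
  have n1 : (N1 <= n)%N by rewrite !leq_max leqnn orbT.
  have n2 : (N2 <= n)%N by rewrite !leq_max leqnn !orbT.
  have s0 : 0 <= 4^-1 ^+ n :> R by rewrite exprn_ge0 // invr_ge0.
  have := h2 n n2; rewrite /= sub0r normrN mul1r ger0_norm // => sn.
  have {h1} := h1 n n1.
  have r0 : 0 <= (cabs (beta n))^-1 by rewrite invr_ge0 cabs_ge0.
  have wE : cabs (Bform (rho S (w_ n)) (w_ n)) =
      (cabs (beta n))^-1 ^+ 2 * cabs (Bform (rho S (x_ n)) (x_ n)).
    have xn := x2 n; have Sxn := rep_l2 rep SS xn.
    rewrite (unitaryZ _ Su) // BformZl // BformZr // !cabsM cabsJ cabsV.
    by rewrite expr2 mulrA.
  have r2 : (cabs (beta n))^-1 ^+ 2 <= 4 * 4^-1 ^+ n.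
    have -> : 4 * 4^-1 ^+ n = (2 * 2^-1 ^+ n) ^+ 2 :> R.
      rewrite exprMn -exprM mulnC exprM.
      by congr (_ * _ ^+ n); field.
    rewrite lerXn2r ?nnegrE // ?inv_le // mulr_ge0 // exprn_ge0 // invr_ge0 //.
  have small : csq (Bform (rho S (w_ n)) (w_ n)) <= e / 4.
    rewrite -sqr_cabs wE exprMn.
    have a1 : ((cabs (beta n))^-1 ^+ 2) ^+ 2 <= (4 * 4^-1 ^+ n) ^+ 2.
      by rewrite lerXn2r ?nnegrE ?exprn_ge0 ?mulr_ge0.
    have a2 : cabs (Bform (rho S (x_ n)) (x_ n)) ^+ 2 <= D' ^+ 2.
      by rewrite lerXn2r ?nnegrE ?cabs_ge0 // hD'.
    apply: le_trans (ler_pM (sqr_ge0 _) (sqr_ge0 _) a1 a2) _.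
    have s1 : 4^-1 ^+ n <= 1 :> R by rewrite exprn_ile1 ?invr_ge0 // invf_le1 // ler1n.
    move: sn; rewrite ltr_pdivlMr //.
    move: (4^-1 ^+ n) s0 s1 => s s0 s1 sn.
    have D2 := sqr_ge0 D'.
    have : s * (s * D' ^+ 2) <= 1 * (s * D' ^+ 2).
      by apply: ler_wpM2r => //; exact: mulr_ge0.
    move: (D' ^+ 2) D2 sn => P D2 sn; lra.
  set b := Bform (rho S (w_ n)) (w_ n) in small *.
  set a := Bform (rho S w) w => hab.
  have -> : a = b + - (b - a) by ring.
  apply: le_trans (csqD_le _ _) _; rewrite csqN; lra.
have ww : Bform w w = 0.
  have [c [c1 hc]] := rep_1 rep.
  have := key 1 (SU11_1 R); rewrite hc // BformZl //.
  move=> h; apply/eqP; have : c * Bform w w == 0.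
    apply/eqP; apply: h.
    exists (cabs (Bform (rho 1 (ebase R)) (ebase R))), 0%N => n _.
    by rewrite (comm_bound (SU11_1 R) (SU11_1 R)) // mul1r mulr1.
  by rewrite mulf_eq0 (negbTE (cabs1_neq0 c1)).
have wi : isotropic w.
  split => //; split => // wz; move: w01; rewrite wz /vzero => /eqP.
  by rewrite oner_eq0.
have line S : isSU11 S -> Bform (rho S w) w = 0 -> same_line (rho S w) w.
  move=> SS h; apply: isotropic_orth_line => //.
  exact: (unitary_isotropic (rep_unitary rep SS)).
have lineA l : 0 < l -> same_line (rho (gm l 0) w) w.
  move=> l0; have lS : isSU11 (gm l 0) by apply: gm_SU11; rewrite gt_eqF.
  apply: line => //; apply: key => //.
  exists (cabs (Bform (rho (gm l 0) (ebase R)) (ebase R))), 0%N => n _.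
  rewrite (comm_bound lS lS) // !gmM ?gt_eqF //.
  by congr gm; rewrite ?mulr0 ?mul0r // mulrC.
have lineN y : same_line (rho (gm 1 y) w) w.
  have nS (z : R) : isSU11 (gm 1 z) by apply: gm_SU11; rewrite oner_neq0.
  apply: line => //; apply: key => //.
  have [_ [_ [_ cont]]] := rep.
  have [d d0 hd] := cont _ e0pos (gm 1 0) (nS 0) _ ltr01.
  (* Conjugation by G_n turns g(1,y) into g(1, y / lam_n^2), which tends to 1. Since lam_n >= 1 +
     n/t, from this index on it is d-close to 1, so it moves the base point by less than 1 and the
     pairing is at most e. *)
  exists (expR 1), (Num.truncn (2 * `|y| * t / d)).+1 => n Nn.
  have ln := lam0 n; have lnn : lam n != 0 by rewrite gt_eqF.
  have comm : gm 1 y * G n = G n * gm 1 (y / lam n ^+ 2).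
    rewrite !gmM ?oner_neq0 //; congr gm; first by rewrite mul1r mulr1.
    by field.
  rewrite (comm_bound _ _ comm) //.
  have big : 1 + n%:R / t <= lam n by rewrite lamE; exact: expR_ge1Dx.
  have nt : 2 * `|y| / d < n%:R / t.
    rewrite ltr_pdivlMr //; apply: (@lt_le_trans _ _ (Num.truncn (2 * `|y| * t / d)).+1%:R).
      have -> : 2 * `|y| / d * t = 2 * `|y| * t / d by ring.
      exact: truncnS_gt.
    by rewrite ler_nat.
  have nt0 : 0 <= n%:R / t by rewrite divr_ge0 ?ler0n // ltW.
  have lam1 : 1 <= lam n by apply: le_trans big; rewrite lerDl.
  have ylam : 2 * `|y / lam n ^+ 2| < d.
    rewrite normrM normfV (ger0_norm (exprn_ge0 2 (ltW ln))) mulrA.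
    rewrite ltr_pdivrMr ?exprn_gt0 //.
    have h1 : 2 * `|y| < d * lam n.
      rewrite (mulrC d) -ltr_pdivrMr //; apply: lt_le_trans nt (le_trans _ big).
      by rewrite lerDr ler01.
    apply: lt_le_trans h1 _; rewrite ler_pM2l // expr2 ler_peMl // ltW //.
  have := hd _ (nS (y / lam n ^+ 2)); rewrite mxdist_gm1 => /(_ ylam).
  rewrite hdistE => hh; have gu := rep_unitary rep (nS (y / lam n ^+ 2)).
  have p1 := unitary_posvec gu e0pos.
  have p2 := unitary_posvec (rep_unitary rep (nS 0)) e0pos.
  have c1 := coshd_ge1 p1 p2.
  have := le_trans (le_expR_acosh c1) (_ : _ <= expR 1).
  rewrite ler_expR (ltW hh) => /(_ isT).
  have [c [c1' hc]] := rep_1 rep.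
  rewrite /coshd -!/(qf _) !(unitary_qf (rep_unitary rep _)) // e0q mulr1 sqrtr1 divr1.
  have gl2 := unitary_l2 gu e0l2.
  by rewrite gm1 hc // BformZr // cabsM cabsJ c1' mul1r.
exists w; split => // l x l0.
have nS : isSU11 (gm 1 (x * l)) by apply: gm_SU11; rewrite oner_neq0.
have lS : isSU11 (gm l 0) by apply: gm_SU11; rewrite gt_eqF.
have -> : gm l x = gm 1 (x * l) * gm l 0.
  rewrite gmM ?oner_neq0 ?gt_eqF //; congr gm; first by rewrite mul1r.
  by rewrite mulr0 add0r mulfK // gt_eqF.
apply: same_line_trans (rep_line_mul rep nS lS w2) _.
apply: same_line_trans (unitary_same_line (rep_unitary rep nS) w2 (lineA l l0)) _.
exact: lineN.
Qed.

(** If the attracting point w were orthogonal to its Weyl image, the two lines would coincide, and w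
    would be fixed by generators of the whole group. Otherwise the image can be normalised, and it
    is fixed by the g(l,0) because the Weyl element inverts them. *)
Lemma weyl_frame_exists : ~ has_fixed_point rho -> exists e1 e2,
  parabolic_frame rho e1 e2 /\ same_line (rho (wm R) e1) e2.
Proof.
move=> nofix; have [w [wi fw]] := attracting_point.
have [w2 [wn ww]] := wi; have wS := wm_SU11 R; have wu := rep_unitary rep wS.
have Ww2 := unitary_l2 wu w2.
have Wi := unitary_isotropic wu wi.
have Bn : Bform w (rho (wm R) w) != 0.
  apply/eqP => B0; apply: nofix.
  exists w; split => //; split => //; split; first by rewrite ww.
  have B0' : Bform (rho (wm R) w) w = 0 by rewrite (BformC w2 Ww2) B0 cconj0.
  apply: gm_ind => //.
  - exact: isotropic_orth_line.
  - have [c [c1 hc]] := rep_N1 rep.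
    by rewrite hc //; exact: same_line_scale (cabs1_neq0 c1).
  - move=> M N MS NS hM hN; apply: same_line_trans (rep_line_mul rep MS NS w2) _.
    exact: same_line_trans (unitary_same_line (rep_unitary rep MS) w2 hN) hM.
pose a := (cconj (Bform w (rho (wm R) w)))^-1.
have a0 : a != 0 by rewrite invr_eq0 cconj_eq0.
exists w, (vscale a (rho (wm R) w)).
have sl := same_line_scale (rho (wm R) w) a0.
split; last exact: same_line_sym.
split => //.
- exact: same_line_isotropic sl Wi.
- by rewrite BformZr // /a !cJ mulVf.
move=> l l0; have lS : isSU11 (gm l 0) by apply: gm_SU11; rewrite gt_eqF.
have li : 0 < l^-1 by rewrite invr_gt0.
have liS : isSU11 (gm l^-1 0) by apply: gm_SU11; rewrite gt_eqF.
have lu := rep_unitary rep lS.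
apply: same_line_trans (unitary_same_line lu Ww2 sl) _.
apply: same_line_trans (same_line_sym sl).
have comm : gm l 0 * wm R = wm R * gm l^-1 0.
  by rewrite wm_gm ?invr_eq0 ?gt_eqF // invrK.
have [c [c1 hc]] := rep_comm rep lS wS wS liS comm.
rewrite hc //; apply: same_line_trans (same_line_scale _ (cabs1_neq0 c1)) _.
by apply: (unitary_same_line wu) => //; exact: fw.
Qed.

(** If K(1) = 0, scaling and conjugation make K vanish identically; then each V y is isotropic and
    orthogonal to e2, hence on its line. So the parabolic subgroup fixes both lines while the Weyl
    element exchanges them. *)
Lemma K_neq0_of_no_pair e1 e2 : parabolic_frame rho e1 e2 ->
  same_line (rho (wm R) e1) e2 -> ~ has_invariant_pair rho ->
  K_of rho e1 e2 1 != 0.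
Proof.
move=> frame wl nopair; apply/eqP => K1; apply: nopair.
have i1 := frame_iso1 frame; have i2 := frame_iso2 frame.
have l1 := frame_l2_1 frame; have l2 := frame_l2_2 frame.
have [_ _ _ f1 f2] := frame.
have wS := wm_SU11 R; have wu := rep_unitary rep wS.
have Kpos y : 0 < y -> K_of rho e1 e2 y = 0.
  move=> y0; have s0 : 0 < Num.sqrt y by rewrite sqrtr_gt0.
  by rewrite -[y]mulr1 -{1}(sqr_sqrtr (ltW y0)) (K_scale rep frame) // K1 mulr0.
have Kall y : K_of rho e1 e2 y = 0.
  have [yp|yn|->] := ltrgt0P y; [exact: Kpos | | exact: K0 rep frame].
  by rewrite -[y]opprK (KN rep frame) Kpos ?oppr_gt0 // cconj0.
have nline y : same_line (rho (gm 1 y) e2) e2.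
  have [_ n0] := nuP frame y.
  have -> : rho (gm 1 y) e2 = vscale (nu_of rho e1 e2 y) (V_of rho e1 e2 y).
    by rewrite VE unipE vscaleA divff // vscale1.
  apply: same_line_trans (same_line_scale _ n0) _.
  apply: isotropic_orth_line => //; first exact: V_isotropic rep frame y.
  by rewrite -KE Kall.
have ll : same_line (rho (wm R) e2) e1.
  have Wl : is_l2 (rho (wm R) e1) by exact: (rep_l2 rep).
  apply: same_line_trans (unitary_same_line wu Wl (same_line_sym wl)) _.
  apply: same_line_trans (same_line_sym (rep_line_mul rep wS wS l1)) _.
  rewrite wm_sqr; have [c [c1 hc]] := rep_N1 rep.
  by rewrite hc //; exact: same_line_scale (cabs1_neq0 c1).
exists e1, e2; split => //; split => //; split.
  move=> [a [_ e]]; have := frame_B12 frame.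
  rewrite e BformZl // (frame_B22 frame) mulr0 => /eqP.
  by rewrite eq_sym oner_eq0.
apply: gm_ind.
- move=> l x l0; left; split; first exact: f1.
  have nS : isSU11 (gm 1 (x * l)) by apply: gm_SU11; rewrite oner_neq0.
  have lS : isSU11 (gm l 0) by apply: gm_SU11; rewrite gt_eqF.
  have -> : gm l x = gm 1 (x * l) * gm l 0.
    rewrite gmM ?oner_neq0 ?gt_eqF //; congr gm; first by rewrite mul1r.
    by rewrite mulr0 add0r mulfK // gt_eqF.
  apply: same_line_trans (rep_line_mul rep nS lS l2) _.
  apply: same_line_trans (unitary_same_line (rep_unitary rep nS) l2 (f2 l l0)) _.
  exact: nline.
- by right.
- left; have [c [c1 hc]] := rep_N1 rep.
  by rewrite !hc //; split; exact: same_line_scale (cabs1_neq0 c1).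
- move=> M N MS NS hM hN; have Mu := rep_unitary rep MS.
  have comp v v' v'' : is_l2 v -> is_l2 v' -> same_line (rho N v) v' ->
      same_line (rho M v') v'' -> same_line (rho (M * N) v) v''.
    move=> v2 v2' h h'; apply: same_line_trans (rep_line_mul rep MS NS v2) _.
    exact: same_line_trans (unitary_same_line Mu v2' h) h'.
  case: hN => -[n1 n2]; case: hM => -[m1 m2].
  + by left; split; [exact: comp n1 m1 | exact: comp n2 m2].
  + by right; split; [exact: comp n1 m1 | exact: comp n2 m2].
  + by right; split; [exact: comp n1 m2 | exact: comp n2 m1].
  + by left; split; [exact: comp n1 m2 | exact: comp n2 m1].
Qed.

End Existence.

Theorem mainTheorem3 (R : realType) (rho1 rho2 : 'M[R[i]]_2 -> vec R -> vec R) :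
  irreducible rho1 -> irreducible rho2 ->
  (exists t : R, has_ell rho1 t /\ has_ell rho2 t) ->
  (equivalent rho1 rho2 <-> exists u : R[i], has_arg rho1 u /\ has_arg rho2 u).
Proof.
move=> irr1 irr2 [t [ell1 ell2]].
have [[rep1 [nofix nopair]] _] := irr1; have [[rep2 _] _] := irr2.
split.
  move=> [U [Uu hU]].
  have [e1 [e2 [frame wl]]] := weyl_frame_exists rep1 ell1 nofix.
  have K1 := K_neq0_of_no_pair rep1 frame wl nopair.
  have [frame' K'] := frame_transport rep1 rep2 Uu hU frame.
  exists (K_of rho1 e1 e2 1 / rC (cabs (K_of rho1 e1 e2 1))); split.
    exact: frame_has_arg.
  by rewrite -K'; apply: frame_has_arg; rewrite ?K'.
move=> [u [/(has_arg_normalized_frame rep1)[u0 [e1 [e2 [frame1 K1]]]]]].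
move=> /(has_arg_normalized_frame rep2)[_ [f1 [f2 [frame2 K2]]]].
by apply: (equivalent_of_frames irr1 irr2 frame1 frame2 ell1 ell2); rewrite K1 ?K2.
Qed.
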